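(* Let $d\in\{2,3\}$ and let $\Omega\subset\mathbb{R}^d$ be a bounded convex domain. Let $0<\theta_1,\ldots,\theta_s\le 1$, $a_1>0$, $a_r\ge 0$ for $r=2,\ldots,s$, $1<\alpha_l\le 2$, and let $\varepsilon^{+}_{\alpha_l},\varepsilon^{-}_{\alpha_l}\ge 0$ be constants ($l=1,\ldots,d$). Consider, with time step $\tau=T/N$, $t_n=n\tau$, the semi-discrete scheme $$\sum_{r=1}^{s}\frac{a_r\omega^{\theta_r}_0}{\tau^{\theta_r}}U^n-\sum_{l=1}^d\varepsilon^+_{\alpha_l}\frac{\partial^{\alpha_l}_+U^n}{\partial x^{\alpha_l}_{l,+}}-\sum_{l=1}^d\varepsilon^-_{\alpha_l}\frac{\partial^{\alpha_l}_-U^n}{\partial x^{\alpha_l}_{l,-}}=f(\cdot,t_n)-\sum_{r=1}^{s}\frac{a_r}{\tau^{\theta_r}}\sum_{k=1}^{n-1}\omega^{\theta_r}_kU^{n-k}+\sum_{r=1}^{s}\frac{a_r}{\tau^{\theta_r}}\sum_{k=0}^{n-1}\omega^{\theta_r}_kU^0$$ in $\Omega$, $n=1,\ldots,N$, with $U^n=g(\cdot,t_n)$ on $\partial\Omega$. This scheme is unconditionally stable: for every $T>0$ and every $N\in\mathbb{Z}^+$ (i.e. with no restriction on $\tau$), if $(U^n)_{n=0}^N$ and $(\tilde U^n)_{n=0}^N$ are two solutions of the scheme with the same $f$ and $g$ but possibly different initial data $U^0,\tilde U^0\in L^2(\Omega)$, then $e^n=U^n-\tilde U^n$ satisfies $$\|e^n\|_{0,\Omega}\le\|e^0\|_{0,\Omega},\qquad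 n=1,\ldots,N.$$
   Context: Notation: $\mathbf{x}=(x_1,\ldots,x_d)$, $(u,v)=\int_\Omega uv\,d\Omega$, $\|u\|_{0,\Omega}=\sqrt{(u,u)}$. Coefficients: $\omega^{\theta}_0=1$, $\omega^{\theta}_k=\left(1-\frac{\theta+1}{k}\right)\omega^{\theta}_{k-1}$ for $k\ge1$ (the first-order, $q=1$, Lubich/Grünwald-Letnikov coefficients). Spatial fractional derivatives: for $\mathbf{x}\in\Omega$ let $X_{l,L}$ and $X_{l,R}$ be the minimum and maximum of the $l$-th coordinate over the points of $\overline\Omega$ whose other coordinates agree with those of $\mathbf{x}$. For $1<\alpha<2$, $$\frac{\partial^{\alpha}_+v}{\partial x^{\alpha}_{l,+}}(\mathbf{x})=\frac{1}{\Gamma(2-\alpha)}\int_{X_{l,L}}^{x_l}\frac{\partial^2_{x_l}v|_{x_l=\xi}}{(x_l-\xi)^{\alpha-1}}\,d\xi,\qquad \frac{\partial^{\alpha}_-v}{\partial x^{\alpha}_{l,-}}(\mathbf{x})=\frac{1}{\Gamma(2-\alpha)}\int_{x_l}^{X_{l,R}}\frac{\partial^2_{x_l}v|_{x_l=\xi}}{(\xi-x_l)^{\alpha-1}}\,d\xi$$ (Caputo derivatives); for $\alpha=2$ both equal $\partial^2_{x_l}v$. Standing assumption (zero gradient on $\partial\Omega$): solutions are assumed to have zero gradient on $\partial\Omega$, so that the differences $e^n$, $n\ge 1$, of two solutions with the same boundary data vanish together with their gradient on $\partial\Omega$. Precisely, for $n\ge1$ and every $l$, $e^n$ belongs to the closures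 $J^{\alpha_l}_{L,0}(\Omega)$ and $J^{\alpha_l}_{R,0}(\Omega)$ of $C_0^\infty(\Omega)$ in the norms $\left(\|v\|^2_{0,\Omega}+\|D_{l,+}^{\alpha_l}v\|^2_{0,\Omega}\right)^{1/2}$ and $\left(\|v\|^2_{0,\Omega}+\|D_{l,-}^{\alpha_l}v\|^2_{0,\Omega}\right)^{1/2}$. Here $D^{\alpha}_{l,\pm}$ are the left/right Riemann-Liouville derivatives in $x_l$ with base points $X_{l,L}$, $X_{l,R}$: for $1<\alpha<2$, $D^{\alpha}_{l,+}v=\frac{1}{\Gamma(2-\alpha)}\partial^2_{x_l}\int_{X_{l,L}}^{x_l}\frac{v|_{x_l=\xi}}{(x_l-\xi)^{\alpha-1}}d\xi$ and $D^{\alpha}_{l,-}v=\frac{1}{\Gamma(2-\alpha)}\partial^2_{x_l}\int_{x_l}^{X_{l,R}}\frac{v|_{x_l=\xi}}{(\xi-x_l)^{\alpha-1}}d\xi$, and $D^2_{l,\pm}=\partial^2_{x_l}$. On such functions the Caputo derivatives above coincide with $D^{\alpha_l}_{l,\pm}$. *)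

(* Defs.v *)
From HB Require Import structures.
From mathcomp Require Import all_boot all_order all_algebra.
From mathcomp Require Import all_classical all_reals all_analysis.

Set Implicit Arguments.
Unset Strict Implicit.
Unset Printing Implicit Defensive.
Import Order.TTheory GRing.Theory Num.Theory.
Import numFieldNormedType.Exports.
Local Open Scope classical_set_scope.
Local Open Scope ring_scope.

(* The sigma-algebra on 'rV[R]_n is the one generated by the coordinates,
   exactly as the library does for n.-tuple T.  The Lebesgue measure on
   'rV[R]_n.+1 is the image of the product measure on R * 'rV[R]_n. *)

Definition measure_rV_display : measure_display. Proof. exact. Qed.

Section measurable_rV.
Variables (R : realType) (n : nat).

Definition rV_coord (i : 'I_n) (x : 'rV[R]_n) : R := x 0 i.

Let rV_set0 : g_sigma_preimage rV_coord set0.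
Proof. exact: sigma_algebra0. Qed.

Let rV_setC A : g_sigma_preimage rV_coord A -> g_sigma_preimage rV_coord (~` A).
Proof. exact: sigma_algebraC. Qed.

Let rV_bigcup (F : (set 'rV[R]_n)^nat) :
  (forall i, g_sigma_preimage rV_coord (F i)) ->
  g_sigma_preimage rV_coord (\bigcup_i (F i)).
Proof. exact: sigma_algebra_bigcup. Qed.

HB.instance Definition _ := @isMeasurable.Build measure_rV_display
  'rV[R]_n (g_sigma_preimage rV_coord) rV_set0 rV_setC rV_bigcup.

End measurable_rV.

Lemma measurable_rV_coord (R : realType) n (i : 'I_n) :
  measurable_fun [set: 'rV[R]_n] (@rV_coord R n i).
Proof.
move=> _ Y mY; rewrite setTI; apply: sub_sigma_algebra => /=.
rewrite -bigcup_seq/=; exists i => /=; first by rewrite mem_index_enum.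
by exists Y => //; rewrite setTI.
Qed.

Lemma measurable_fun_rV d (T : measurableType d) (R : realType) n
    (f : T -> 'rV[R]_n) :
  (forall i, measurable_fun [set: T] (fun t => f t 0 i)) ->
  measurable_fun [set: T] f.
Proof.
move=> mf.
have H : g_sigma_preimage (fun i => @rV_coord R n i \o f) `<=` measurable.
  apply: smallest_sub; first exact: sigma_algebra_measurable.
  case: n => [|n] in f mf *; first by rewrite big_ord0.
  rewrite -bigcup_mkord_ord; apply: bigcup_sub => i Ii.
  by move=> A [B mB <-]; exact: mf.
by move=> _ A mA; apply: H; rewrite g_sigma_preimage_comp; exists A.
Qed.

Section lebesgue_rV.
Variable R : realType.

Definition rV_cons n (p : R * 'rV[R]_n) : 'rV[R]_n.+1 :=
  row_mx (const_mx p.1 : 'rV_1) p.2.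

Definition rV_uncons n (x : 'rV[R]_n.+1) : R * 'rV[R]_n :=
  (x 0 0, rsubmx (x : 'rV_(1 + n))).

Lemma rV_consK n : cancel (@rV_cons n) (@rV_uncons n).
Proof.
case=> t y; rewrite /rV_uncons /rV_cons row_mxKr; congr pair.
have -> : (0 : 'I_n.+1) = lshift n (0 : 'I_1) by exact/val_inj.
by apply: etrans (row_mxEl _ _ 0 0) _; rewrite mxE.
Qed.

Lemma measurable_rV_cons n : measurable_fun setT (@rV_cons n).
Proof.
apply: measurable_fun_rV => i.
case: (@split_ordP 1 n i) => j ->.
  rewrite (_ : (fun _ => _) = fst); first exact: measurable_fst.
  by apply/funext => p; apply: etrans (row_mxEl _ _ 0 j) _; rewrite mxE.
rewrite (_ : (fun _ => _) = @rV_coord R n j \o snd).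
  exact: (measurableT_comp (measurable_rV_coord j) measurable_snd).
by apply/funext => p; exact: row_mxEr.
Qed.

Lemma measurable_rV_uncons n : measurable_fun setT (@rV_uncons n).
Proof.
apply/measurable_fun_pairP; split; first exact: measurable_rV_coord.
apply: measurable_fun_rV => i /=.
under eq_fun do rewrite mxE.
exact: measurable_rV_coord.
Qed.

Section step.
Variables (n : nat) (mu : {sigma_finite_measure set 'rV[R]_n -> \bar R}).

Definition lebesgue_rV_step : set 'rV[R]_n.+1 -> \bar R :=
  pushforward (lebesgue_measure \x mu)%E (@rV_cons n).

Let step0 : lebesgue_rV_step set0 = 0%E.
Proof. by rewrite /lebesgue_rV_step /pushforward preimage_set0 measure0. Qed.

Let step_ge0 A : (0 <= lebesgue_rV_step A)%E.
Proof. exact: (measure_ge0 (lebesgue_measure \x mu)%E). Qed.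

Let step_sigma_additive : semi_sigma_additive lebesgue_rV_step.
Proof.
move=> F mF tF mUF; rewrite /lebesgue_rV_step /pushforward preimage_bigcup.
apply: measure_semi_sigma_additive.
- by move=> i; rewrite -[X in measurable X]setTI; exact: measurable_rV_cons.
- apply/trivIsetP => /= i j _ _ ij; rewrite -preimage_setI.
  by move/trivIsetP : tF => /(_ _ _ _ _ ij) ->//; rewrite preimage_set0.
- by rewrite -preimage_bigcup -[X in measurable X]setTI; exact: measurable_rV_cons.
Qed.

HB.instance Definition _ := isMeasure.Build _ _ _
  lebesgue_rV_step step0 step_ge0 step_sigma_additive.

Let step_sigma_finite : sigma_finite setT lebesgue_rV_step.
Proof.
have /sigma_finiteP[F [TF ndF Foo]] := sigma_finiteT (@lebesgue_measure R).
have /sigma_finiteP[G [TG ndG Goo]] := sigma_finiteT mu.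
exists (fun k => @rV_uncons n @^-1` (F k `*` G k)).
  rewrite -preimage_bigcup (_ : \bigcup_k _ = setT) ?preimage_setT//.
  rewrite -setXTT TF TG predeqE => -[x y]; split=> [[k _ []/= ? ?]|].
    by split; exists k.
  move=> [/= [i _ Fx] [j _ Gy]]; exists (maxn i j) => //; split.
    by move: x Fx; exact/subsetPset/ndF/leq_maxl.
  by move: y Gy; exact/subsetPset/ndG/leq_maxr.
move=> k; have [mF Fk] := Foo k; have [mG Gk] := Goo k; split.
  rewrite -[X in measurable X]setTI.
  by apply: measurable_rV_uncons => //; exact: measurableX.
rewrite /lebesgue_rV_step /pushforward -comp_preimage.
rewrite (_ : _ \o _ = id); last by apply/funext => p; exact: rV_consK.
by rewrite preimage_id product_measure1E// lte_mul_pinfty// ge0_fin_numE.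
Qed.

HB.instance Definition _ := Measure_isSigmaFinite.Build _ _ _
  lebesgue_rV_step step_sigma_finite.

End step.

Fixpoint lebesgue_rV n : {sigma_finite_measure set 'rV[R]_n -> \bar R} :=
  match n with
  | 0 => \d_(0 : 'rV[R]_0)
  | n'.+1 => lebesgue_rV_step (lebesgue_rV n')
  end.

End lebesgue_rV.

Section domain.
Variables (R : realType) (d : nat).
Implicit Types (Om : set 'rV[R]_d) (u v w : 'rV[R]_d -> R) (x y : 'rV[R]_d).

Definition bounded_convex_domain Om :=
  [/\ open Om, Om !=set0, bounded_set Om &
      @convex_set R 'rV[R]_d Om].

Definition frontier Om : set 'rV[R]_d := closure Om `\` interior Om.

Definition L2 Om v :=
  measurable_fun Om v /\
  (lebesgue_rV R d).-integrable Om (fun x => (v x ^+ 2)%:E).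

Definition inner Om u v : R := \int[lebesgue_rV R d]_(x in Om) (u x * v x).

Definition L2norm Om u : R := Num.sqrt (inner Om u u).

Definition basis_vec (l : 'I_d) : 'rV[R]_d := delta_mx 0 l.

Definition partial (l : 'I_d) v : 'rV[R]_d -> R := fun x => 'D_(basis_vec l) v x.

Definition partial2 l v := partial l (partial l v).

(* The point x with its l-th coordinate replaced by xi. *)
Definition set_coord (l : 'I_d) x (xi : R) : 'rV[R]_d :=
  \row_j (if j == l then xi else x 0 j).

Definition line_coords Om (l : 'I_d) x : set R :=
  [set xi | closure Om (set_coord l x xi)].

Definition XL Om l x : R := inf (line_coords Om l x).
Definition XR Om l x : R := sup (line_coords Om l x).

(* Plus: the operators based at the left end X_L of the line through x;
   Minus: those based at the right end X_R. *)
Variant side := Plus | Minus.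

Definition ray Om (sg : side) l x : set R :=
  match sg with
  | Plus => `]XL Om l x, x 0 l[%classic
  | Minus => `]x 0 l, XR Om l x[%classic
  end.

Definition Gamma (z : R) : R :=
  \int[lebesgue_measure]_(t in `]0, +oo[%classic) (t `^ (z - 1) * expR (- t)).

Definition frac_integrand l (alpha : R) v x (xi : R) : R :=
  v (set_coord l x xi) / `|x 0 l - xi| `^ (alpha - 1).

Definition frac_integral Om sg l alpha v x : R :=
  (Gamma (2 - alpha))^-1 *
  \int[lebesgue_measure]_(xi in ray Om sg l x) frac_integrand l alpha v x xi.

Definition caputo Om sg l alpha v : 'rV[R]_d -> R :=
  if alpha == 2 then partial2 l v
  else frac_integral Om sg l alpha (partial2 l v).

Definition riemann_liouville Om sg l alpha v : 'rV[R]_d -> R :=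
  if alpha == 2 then partial2 l v
  else partial2 l (frac_integral Om sg l alpha v).

(* The derivatives 'D are total functions, so that the existence of the
   classical second derivative in x_l has to be required: v is differentiable
   in x_l in Om, and its derivative is absolutely continuous on the segments of
   Om parallel to the l-th axis, i.e. it is the integral of its own derivative. *)
Definition twice_diff_along Om l v :=
  (forall x, Om x -> derivable v x (basis_vec l)) /\
  (forall x (h : R), 0 <= h -> Om x -> Om (x + h *: basis_vec l) ->
    lebesgue_measure.-integrable `[0, h]%classic
      (fun r : R => (partial2 l v (x + r *: basis_vec l))%:E) /\
    partial l v (x + h *: basis_vec l) - partial l v x =
      \int[lebesgue_measure]_(r in `[0, h]%classic)
        partial2 l v (x + r *: basis_vec l)).

Definition caputo_defined Om sg l alpha v x :=
  if alpha == 2 then derivable (partial l v) x (basis_vec l)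
  else lebesgue_measure.-integrable (ray Om sg l x)
         (fun xi => (frac_integrand l alpha (partial2 l v) x xi)%:E).

Definition smooth v :=
  forall (s : seq 'I_d) (w := foldr partial v s),
    continuous w /\ (forall l x, derivable w x (basis_vec l)).

Definition test_function Om v :=
  smooth v /\
  exists2 K : set 'rV[R]_d, compact K /\ K `<=` Om &
    forall x, ~ K x -> v x = 0.

(* v lies in the closure J of the test functions for the norm
   (|v|^2 + |D v|^2)^(1/2), and w is its Riemann-Liouville derivative D v,
   i.e. the L2 limit of the D phi for the test functions phi approaching v. *)
Definition J0_with_derivative Om sg l alpha v w :=
  [/\ L2 Om v, L2 Om w &
      forall e : R, 0 < e -> exists phi,
        [/\ test_function Om phi,
            L2 Om (riemann_liouville Om sg l alpha phi) &
            Num.sqrt (L2norm Om (v - phi) ^+ 2 +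
              L2norm Om (w - riemann_liouville Om sg l alpha phi) ^+ 2) < e]].

Definition J0 Om sg l alpha v :=
  exists w, J0_with_derivative Om sg l alpha v w.

(* v, defined on the closure of Om, is differentiable at each point y of the
   frontier with zero gradient there. *)
Definition zero_gradient_on_frontier Om v :=
  forall y, frontier Om y ->
    (fun x => (v x - v y) / `|x - y|) @ within (closure Om) y^' --> (0 : R).

Fixpoint omega (theta : R) (k : nat) : R :=
  match k with
  | 0 => 1
  | k'.+1 => (1 - (theta + 1) / k%:R) * omega theta k'
  end.

Definition scheme_lhs Om (s : nat) (a theta : nat -> R)
    (alpha epsp epsm : 'I_d -> R) (tau : R) v x : R :=
  (\sum_(1 <= r < s.+1) a r * omega (theta r) 0 / tau `^ theta r) * v x
  - \sum_(l < d) epsp l * caputo Om Plus l (alpha l) v x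
  - \sum_(l < d) epsm l * caputo Om Minus l (alpha l) v x.

Definition scheme_rhs (s : nat) (a theta : nat -> R) (tau : R)
    (f : 'rV[R]_d -> R -> R) (U : nat -> 'rV[R]_d -> R) (n : nat) x : R :=
  f x (n%:R * tau)
  - \sum_(1 <= r < s.+1) a r / tau `^ theta r *
      \sum_(1 <= k < n) omega (theta r) k * U (n - k)%N x
  + \sum_(1 <= r < s.+1) a r / tau `^ theta r *
      \sum_(0 <= k < n) omega (theta r) k * U 0 x.

Definition scheme_solution Om (s : nat) (a theta : nat -> R)
    (alpha epsp epsm : 'I_d -> R) (tau : R) (N : nat)
    (f g : 'rV[R]_d -> R -> R) (U : nat -> 'rV[R]_d -> R) :=
  L2 Om (U 0) /\
  forall n, (1 <= n <= N)%N ->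
    [/\ forall l, twice_diff_along Om l (U n),
        {ae lebesgue_rV R d, forall x, Om x ->
          forall l sg, caputo_defined Om sg l (alpha l) (U n) x},
        {ae lebesgue_rV R d, forall x, Om x ->
          scheme_lhs Om s a theta alpha epsp epsm tau (U n) x =
          scheme_rhs s a theta tau f U n x} &
        forall x, frontier Om x -> U n x = g x (n%:R * tau)].

End domain.

(* Main.v *)
Require Import Defs.
From mathcomp Require Import all_boot all_order all_algebra.
From mathcomp Require Import all_classical all_reals all_analysis.
From mathcomp Require Import measurable_realfun ring lra.
Import Order.TTheory GRing.Theory Num.Theory.
Import numFieldNormedType.Exports.
Local Open Scope classical_set_scope.
Local Open Scope ring_scope.
Set Implicit Arguments.
Unset Strict Implicit.
Unset Printing Implicit Defensive.

(* Let [e n = U n - V n], and for [n >= 1] let [w] be the L2 limit of the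
   Riemann-Liouville derivatives of test functions approaching [e n].
   (1) On almost every line parallel to an axis (reflected for the operators based
   at the right end), [w] is the difference of the
   Caputo derivatives of [U n] and [V n]: for test functions [phi] with Volterra
   operator [K] (kernel [t^(1 - alpha)]) one has [I I (K phi'') = K phi], where
   [I] is integration from the left end of the line.  This passes to the limit as
   [I I w = K (e n)]; the zero gradient gives [e n = I I G] with [G] the
   difference of the second derivatives, and [K I I = I I K], hence [w = K G].
   (2) Test functions satisfy [(phi, D phi) <= 0] because their autocorrelation is
   maximal at 0, so [(w, e n) <= 0].
   (3) The weights of the history terms are nonpositive with nonnegative partial
   sums; pairing the scheme with [e n] therefore bounds [|e n|^2] by a convex
   combination of the [(|e j|^2 + |e n|^2) / 2], [j < n], and induction applies. *)

(** [J0] provides [w] only as an L2 limit over the whole domain, whereas the scheme contains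
    pointwise Caputo derivatives; (1) exists to match the two. The identity for test functions is
    integrated twice before the limit is taken, because integration and the Volterra operator are
    bounded in L1 and differentiation is not. As [Om] has finite measure, L2 approximation yields L1
    approximation, and this can be read on almost every line. The zero gradient intervenes at the
    base point of each line: two integrations lose an affine function, and the vanishing of the
    value and of the slope there recovers it. The regularity of the solutions is stated line by
    line, so the way back from the lines to [Om] requires a jointly measurable representative of the
    difference of the Caputo derivatives; otherwise null sections would not give a null set. For
    [alpha = 2] the identity takes the place of the Volterra operator. *)

Section reflection.
Context {R : realType}.
Notation mu := (@lebesgue_measure R).

Lemma measurable_reflect (c : R) : measurable_fun setT (fun t : R => c - t).
Proof. exact: measurable_funB. Qed.

(** Lebesgue measure is determined by its values on the intervals []a, b]]; their preimages are [[c
    - b, c - a[], of the same length. *)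
Lemma lebesgue_measure_reflect (c : R) (A : set R) : measurable A ->
  pushforward mu ((fun t => c - t) : _ -> measurableTypeR R) A = mu A.
Proof.
move=> mA; apply/esym/lebesgue_measure_unique => //=.
  exact: measurable_reflect.
move=> mc _ [[a b]] _ <-.
rewrite /pushforward (_ : _ @^-1` _ = `[c - b, c - a[%classic); last first.
  by apply/seteqP; split=> t /=; rewrite !in_itv/= => /andP[? ?];
    apply/andP; split; lra.
rewrite !lebesgue_measure_itv/= !lte_fin ltrD2l ltrN2.
by rewrite -!EFinD; congr (if _ then _%:E else _); ring.
Qed.

Lemma ge0_integral_reflect (c : R) (A : set R) (f : R -> \bar R) :
  measurable A -> measurable_fun A f -> (forall x, A x -> 0 <= f x)%E ->
  (\int[mu]_(x in A) f x =
   \int[mu]_(x in [set x | A (c - x)%R]) f (c - x)%R)%E.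
Proof.
move=> mA mf f0.
transitivity
  (\int[pushforward mu ((fun t => c - t)%R : _ -> measurableTypeR R)]_(x in A) f x)%E.
  apply: eq_measure_integral => /= [|mc B mB _]; first exact: measurable_reflect.
  exact/esym/lebesgue_measure_reflect.
rewrite ge0_integral_pushforward//; first exact: measurable_reflect.
by move=> x /set_mem; exact: f0.
Qed.
End reflection.

Section kernel.
Context {R : realType}.
Notation mu := (@lebesgue_measure R).

Lemma measurable_kernel (g : R) :
  measurable_fun setT (fun p : R * R => `|p.1 - p.2| `^ (- g)).
Proof.
apply: (measurableT_comp (measurable_powR (- g))).
by apply: measurableT_comp => //; exact: measurable_funB.
Qed.

(** Exhaustion of []0, L[] by the intervals [[L / (n + 1), L]]: the primitive [t^(1 - g) / (1 - g)]
    bounds all truncated integrals by its value at [L], and monotone convergence concludes. *)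
Lemma integral_power_lty (g L : R) : 0 <= g < 1 -> 0 < L ->
  (\int[mu]_(t in `]0%R, L[) (t `^ (- g))%:E < +oo)%E.
Proof.
move=> /andP[g0 g1] L0.
pose F (n : nat) : set R := `[L / n.+1%:R, L]%classic.
have mf : measurable_fun setT (fun t : R => (t `^ (- g))%:E).
  exact/measurable_EFinP.
have LV n : 0 < L / n.+1%:R by rewrite divr_gt0.
have ndF : nondecreasing_seq F.
  move=> m n mn; apply/subsetPset => t; rewrite /F/= !in_itv/= => /andP[h ->].
  rewrite andbT (le_trans _ h)// ler_pM2l// lef_pV2 ?posrE// ler_nat.
  by rewrite ltnS.
have bF n : (\int[mu]_(t in F n) (t `^ (- g))%:E <= (L `^ (1 - g) / (1 - g))%:E)%E.
  (* For [n = 0] the interval is the single point [L], while the fundamental theorem asks for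
     distinct ends. *)
  have [n0|n0] := eqVneq n 0%N.
    rewrite /F n0 divr1 set_itv1 integral_set1 lee_fin divr_ge0 ?powR_ge0//.
    by rewrite subr_ge0 ltW.
  have LnL : L / n.+1%:R < L.
    by rewrite ltr_pdivrMr// ltr_pMr// ltr1n ltnS lt0n.
  have d (x : R) : 0 < x -> derivable (fun t : R => t `^ (1 - g)) x 1.
    by move=> x0; apply: derivable_powR; rewrite in_itv/= x0.
  have c (x : R) : 0 < x -> (t `^ (1 - g) @[t --> x] --> x `^ (1 - g)).
    by move=> x0; have /derivable1_diffP/differentiable_continuous h := d _ x0; exact: h.
  rewrite (@continuous_FTC2 _ _ (fun t => t `^ (1 - g) / (1 - g)))//.
  - rewrite -EFinB lee_fin gerBl divr_ge0 ?powR_ge0// subr_ge0; exact: ltW.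
  - apply/continuous_in_subspaceT => x; rewrite inE/= in_itv/= => /andP[x0 _].
    apply/differentiable_continuous/derivable1_diffP.
    by apply: derivable_powR; rewrite in_itv/= andbT (lt_le_trans _ x0).
  - split => [x|/=|/=].
    + rewrite in_itv/= => /andP[x0 _]; apply: derivableM => //.
      by apply: d; exact: lt_trans x0.
    + apply: cvg_at_right_filter; apply: cvgM; last exact: cvg_cst.
      exact: c.
    + apply: cvg_at_left_filter; apply: cvgM; last exact: cvg_cst.
      exact: c.
  - move=> x; rewrite in_itv/= => /andP[x0 _].
    have x_gt0 : 0 < x by exact: lt_trans x0.
    rewrite derive1E deriveMr; last exact: d.
    rewrite -derive1E powR_derive1 ?in_itv/= ?x_gt0//.
    rewrite mulrA mulVf ?mul1r; last lra.
    by congr (_ `^ _); ring.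
have -> : `]0, L[%classic = `]0, L[%classic `&` \bigcup_n F n.
  apply/seteqP; split=> [t|t []//]; rewrite /= in_itv/= => /andP[t0 tL]; split.
    by rewrite /= t0.
  exists (Num.truncn (L / t)) => //; rewrite /F /= in_itv/= (ltW tL) andbT.
  rewrite ler_pdivrMr// -ler_pdivrMl// mulrC.
  exact/ltW/truncnS_gt.
have mUF : measurable (\bigcup_n F n) by apply: bigcupT_measurable => n; exact: measurable_itv.
apply: (@le_lt_trans _ _ (\int[mu]_(t in \bigcup_n F n) (t `^ (- g))%:E)%E).
  apply: ge0_subset_integral => //.
  - by apply: measurableI.
  - exact: measurable_funTS.
  - by move=> x _; rewrite lee_fin powR_ge0.
apply: (@le_lt_trans _ _ (L `^ (1 - g) / (1 - g))%:E); last exact: ltry.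
have h : (\int[mu]_(t in F n) (t `^ (- g))%:E)%E @[n --> \oo] -->
    (\int[mu]_(t in \bigcup_n F n) (t `^ (- g))%:E)%E.
  apply: ge0_nondecreasing_set_cvg_integral => //.
  - by move=> n; exact: measurable_itv.
  - by move=> n; exact: measurable_funTS.
  - by move=> n x _; rewrite lee_fin powR_ge0.
rewrite -(cvg_lim _ h)//; apply: lime_le; first by apply/cvg_ex; eexists; exact: h.
by near=> n; exact: bF.
Unshelve. all: by end_near. Qed.
End kernel.

Section generic.
Context d (T : measurableType d) (R : realType) (m : {measure set T -> \bar R}).

Lemma integrable_fine (D : set T) (f : T -> \bar R) : measurable D ->
  m.-integrable D f -> m.-integrable D (fun x => (fine (f x))%:E).
Proof.
move=> mD /integrableP[mf intf]; apply/integrableP; split.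
  by apply/measurable_EFinP; apply: measurableT_comp => //; exact: measurable_fine.
apply: le_lt_trans intf; apply: ge0_le_integral => //.
- apply: measurableT_comp => //; apply/measurable_EFinP.
  by apply: measurableT_comp => //; exact: measurable_fine.
- exact: measurableT_comp.
- by move=> x _; case: (f x) => //= [|]; rewrite normr0 leey.
Qed.

Lemma integral_fine (D : set T) (f : T -> \bar R) : measurable D ->
  m.-integrable D f -> (\int[m]_(x in D) (fine (f x))%:E = \int[m]_(x in D) f x)%E.
Proof.
move=> mD intf; apply: ae_eq_integral => //.
- by case/integrableP: (integrable_fine mD intf).
- by case/integrableP: intf.
- have := integrable_ae mD intf; apply: filterS => x /[apply].
  by move=> h; rewrite fineK.
Qed.

Lemma integrable_scale (D : set T) (c : R) (f : T -> R) : measurable D ->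
  m.-integrable D (EFin \o f) -> m.-integrable D (fun x => (c * f x)%:E).
Proof. by move=> mD fi; have := integrableZl mD c fi; apply: eq_integrable. Qed.

Lemma integrable_addR (D : set T) (f g : T -> R) : measurable D ->
  m.-integrable D (EFin \o f) -> m.-integrable D (EFin \o g) ->
  m.-integrable D (fun x => (f x + g x)%:E).
Proof. by move=> mD fi gi; have := integrableD mD fi gi; apply: eq_integrable. Qed.

Lemma integrable_subR (D : set T) (f g : T -> R) : measurable D ->
  m.-integrable D (EFin \o f) -> m.-integrable D (EFin \o g) ->
  m.-integrable D (fun x => (f x - g x)%:E).
Proof. by move=> mD fi gi; have := integrableB mD fi gi; apply: eq_integrable. Qed.

Lemma ae_impl (P Q : T -> Prop) : (forall x, P x -> Q x) ->
  {ae m, forall x, P x} -> {ae m, forall x, Q x}.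
Proof. by move=> PQ; apply: filterS. Qed.

Lemma ae_and (P Q : T -> Prop) :
  {ae m, forall x, P x} -> {ae m, forall x, Q x} -> {ae m, forall x, P x /\ Q x}.
Proof. exact: filterI. Qed.
End generic.

(** * Fubini's theorem on a triangle *)

Section integrable_fubini_G.
Local Open Scope ereal_scope.
Context d1 d2 (T1 : measurableType d1) (T2 : measurableType d2) (R : realType).
Variable m1 : {sigma_finite_measure set T1 -> \bar R}.
Variable m2 : {sigma_finite_measure set T2 -> \bar R}.
Variable f : T1 * T2 -> \bar R.
Hypothesis imf : (m1 \x m2).-integrable setT f.

Lemma integrable_fubini_G : m2.-integrable setT (fubini_G m1 f).
Proof.
have mf : measurable_fun setT f by exact: measurable_int imf.
apply/integrableP; split; first exact: measurable_fubini_G imf.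
apply: (@le_lt_trans _ _ (\int[m2]_y \int[m1]_x `|f (x, y)|)); last first.
  exact/integrable21ltyP.
apply: ge0_le_integral => //.
- by apply: measurableT_comp => //; exact: measurable_fubini_G imf.
- apply: (measurable_fun_fubini_tonelli_G (abse \o f)).
    exact: measurableT_comp.
  by move=> p; exact: abse_ge0.
- move=> y _; apply: le_abse_integral => //; exact: measurableT_comp.
Qed.
End integrable_fubini_G.

Section triangle.
Context {R : realType}.
Notation mu := (@lebesgue_measure R).
Implicit Types (a x : R).

(** The pair is [(s, xi)], outer variable first: [s] runs in []a, x[] and [xi] in []a, s[], as in an
    iterated Volterra integral. *)
Definition triangle a x : set (R * R) := [set p | a < p.2 /\ p.2 < p.1 /\ p.1 < x].

Lemma measurable_triangle a x : measurable (triangle a x).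
Proof.
have m (f g : R * R -> R) : measurable_fun setT f -> measurable_fun setT g ->
    measurable [set p | f p < g p].
  move=> mf mg; have := measurable_fun_ltr mf mg => /(_ measurableT [set true]).
  by rewrite setTI; exact.
rewrite (_ : triangle a x = [set p : R * R | a < p.2] `&`
   ([set p | p.2 < p.1] `&` [set p | p.1 < x])); last by apply/seteqP; split.
by apply: measurableI; [exact: m|apply: measurableI; exact: m].
Qed.

Section swap.
Variables (f : R * R -> \bar R) (a x : R).
Let F := f \_ (triangle a x).

Lemma triangle_xsection s :
  (\int[mu]_xi F (s, xi) =
   ((fun s => \int[mu]_(xi in `]a, s[) f (s, xi)) \_ `]a, x[) s)%E.
Proof.
rewrite patchE; case: ifPn => sax.
  rewrite [RHS]integral_mkcond; apply: eq_integral => xi _.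
  rewrite /F !patchE; congr (if _ then _ else _).
  move: sax; rewrite inE/= in_itv/= => /andP[sa sx].
  by apply/idP/idP; rewrite !inE/= in_itv/=; [case=> -> [->]|case/andP].
apply: integral0_eq => xi _; rewrite /F patchE memNset//=.
case=> /= axi [xis sx]; move/negP: sax; apply; rewrite inE/= in_itv/= sx.
by rewrite (lt_trans axi).
Qed.

Lemma triangle_ysection xi :
  (\int[mu]_s F (s, xi) =
   ((fun xi => \int[mu]_(s in `]xi, x[) f (s, xi)) \_ `]a, x[) xi)%E.
Proof.
rewrite patchE; case: ifPn => sax.
  rewrite [RHS]integral_mkcond; apply: eq_integral => s _.
  rewrite /F !patchE; congr (if _ then _ else _).
  move: sax; rewrite inE/= in_itv/= => /andP[sa sx].
  by apply/idP/idP; rewrite !inE/= in_itv/=; [case=> _ [-> ->]|case/andP].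
apply: integral0_eq => s _; rewrite /F patchE memNset//=.
case=> /= axi [xis sx]; move/negP: sax; apply; rewrite inE/= in_itv/= axi.
by rewrite (lt_trans xis).
Qed.
End swap.

(** Dirichlet's interchange formula: both sides are iterated integrals of [f] extended by 0 off the
    triangle. *)
Lemma triangle_tonelli (f : R * R -> \bar R) a x : measurable_fun setT f ->
  (forall p, 0 <= f p)%E ->
  (\int[mu]_(s in `]a, x[) \int[mu]_(xi in `]a, s[) f (s, xi) =
   \int[mu]_(xi in `]a, x[) \int[mu]_(s in `]xi, x[) f (s, xi))%E.
Proof.
move=> mf f0; have mF : measurable_fun setT (f \_ (triangle a x)).
  apply/(measurable_restrictT _ _).1; first exact: measurable_triangle.
  exact: measurable_funTS.
have F0 p : (0 <= (f \_ (triangle a x)) p)%E by apply: erestrict_ge0.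
rewrite integral_mkcond [RHS]integral_mkcond.
under eq_integral do rewrite -triangle_xsection.
under [RHS]eq_integral do rewrite -triangle_ysection.
exact: fubini_tonelli.
Qed.

Section signed.
Variables (f : R * R -> R) (a x : R).
Hypothesis mf : measurable_fun setT f.
Hypothesis fi :
  (\int[mu]_(xi in `]a, x[) \int[mu]_(s in `]xi, x[) `|f (s, xi)|%:E < +oo)%E.

Let F := (EFin \o f) \_ (triangle a x).

Let mF : measurable_fun setT F.
Proof.
apply/(measurable_restrictT _ _).1; first exact: measurable_triangle.
by apply: measurable_funTS; exact/measurable_EFinP.
Qed.

(** [fi] controls absolute values in one order of integration only; Tonelli on the triangle turns it
    into integrability on the plane. *)
Let iF : (mu \x mu)%E.-integrable setT F.
Proof.
apply/integrable12ltyP => //.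
pose G p := `|f p|%:E.
have FG s : (\int[mu]_y `|F (s, y)| = \int[mu]_y ((G \_ (triangle a x)) (s, y)))%E.
  by apply: eq_integral => y _; rewrite /F !patchE; case: ifP; rewrite ?abse0.
under eq_integral do rewrite FG triangle_xsection.
rewrite -integral_mkcond triangle_tonelli; first exact: fi.
  by apply/measurable_EFinP; exact: measurableT_comp.
by move=> p; rewrite lee_fin.
Qed.

Lemma triangle_integrable_xsection :
  {ae mu, forall s, s \in `]a, x[ -> mu.-integrable `]a, s[ (fun xi => (f (s, xi))%:E)}.
Proof.
have := ae_integrable1 iF; apply: filterS => s + sax.
rewrite (_ : (fun y => F (s, y)) = (fun xi => (f (s, xi))%:E) \_ `]a, s[).
  by move=> h; apply/integrable_mkcond; first exact: measurable_itv.
apply/funext => xi; rewrite /F !patchE; congr (if _ then _ else _).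
move: sax; rewrite in_itv/= => /andP[sa sx].
by apply/idP/idP; rewrite !inE/= in_itv/=; [case=> -> [->]|case/andP].
Qed.

Lemma triangle_integrable :
  mu.-integrable `]a, x[ (fun s => (\int[mu]_(xi in `]a, s[) f (s, xi))%:E).
Proof.
apply: integrable_fine => //; apply/integrable_mkcond; first exact: measurable_itv.
rewrite (_ : _ \_ _ = fubini_F mu F); first exact: integrable_fubini_F.
by apply/funext => s; rewrite -(triangle_xsection (EFin \o f)).
Qed.

Lemma triangle_fubini :
  \int[mu]_(s in `]a, x[) \int[mu]_(xi in `]a, s[) f (s, xi) =
  \int[mu]_(xi in `]a, x[) \int[mu]_(s in `]xi, x[) f (s, xi).
Proof.
congr fine.
have h1 : mu.-integrable `]a, x[ (fun s => \int[mu]_(xi in `]a, s[) (f (s, xi))%:E)%E.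
  apply/integrable_mkcond; first exact: measurable_itv.
  rewrite (_ : _ \_ _ = fubini_F mu F); first exact: integrable_fubini_F.
  by apply/funext => s; rewrite -(triangle_xsection (EFin \o f)).
have h2 : mu.-integrable `]a, x[ (fun xi => \int[mu]_(s in `]xi, x[) (f (s, xi))%:E)%E.
  apply/integrable_mkcond; first exact: measurable_itv.
  rewrite (_ : _ \_ _ = fubini_G mu F); last first.
    by apply/funext => s; rewrite -(triangle_ysection (EFin \o f)).
  exact: integrable_fubini_G iF.
rewrite !integral_fine// integral_mkcond [RHS]integral_mkcond.
under eq_integral do rewrite -(triangle_xsection (EFin \o f)).
under [RHS]eq_integral do rewrite -(triangle_ysection (EFin \o f)).
exact: Fubini.
Qed.

End signed.
End triangle.

(** * Integration and fractional integration on an interval *)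

Section volterra.
Context {R : realType}.
Notation mu := (@lebesgue_measure R).
Implicit Types (a x : R) (h : R -> R).

Definition power_int (g L : R) : R := \int[mu]_(t in `]0, L[) (t `^ (- g)).

Definition prim a h x : R := \int[mu]_(t in `]a, x[) h t.

(** Up to the factor [1 / Gamma (1 - g)], the Riemann-Liouville integral of order [1 - g] based at
    [a]. It is used with [g = alpha - 1]; the exponent 0 gives back [prim]. *)
Definition vol (g a : R) h (x : R) : R :=
  \int[mu]_(t in `]a, x[) (h t * `|x - t| `^ (- g)).

Lemma power_intE (g L : R) : 0 <= g < 1 -> 0 < L ->
  ((power_int g L)%:E = \int[mu]_(t in `]0%R, L[) (t `^ (- g))%:E)%E.
Proof.
move=> g01 L0; rewrite /power_int fineK// ge0_fin_numE ?integral_power_lty//.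
by apply: integral_ge0 => t _; rewrite lee_fin powR_ge0.
Qed.

Lemma power_int_ge0 (g L : R) : 0 <= power_int g L.
Proof. by apply: Rintegral_ge0 => t _; exact: powR_ge0. Qed.

Lemma le_power_int (g L M : R) : 0 <= g < 1 -> 0 < L -> L <= M ->
  power_int g L <= power_int g M.
Proof.
move=> g01 L0 LM; rewrite -lee_fin !power_intE//; last exact: lt_le_trans LM.
apply: ge0_subset_integral => //.
- by apply: measurable_funTS; exact/measurable_EFinP.
- by move=> t _; rewrite lee_fin powR_ge0.
- by apply: subset_itvl; rewrite bnd_simp.
Qed.

Lemma measurable_kernelr (g x : R) (D : set R) : measurable_fun D (fun t : R => (`|x - t| `^ (- g))).
Proof.
apply: measurable_funTS; apply: (measurableT_comp (measurable_powR (- g))).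
by apply: measurableT_comp => //; exact: measurable_funB.
Qed.

Lemma measurable_kernell (g x : R) (D : set R) : measurable_fun D (fun t : R => (`|t - x| `^ (- g))).
Proof.
apply: measurable_funTS; apply: (measurableT_comp (measurable_powR (- g))).
by apply: measurableT_comp => //; exact: measurable_funB.
Qed.

Lemma kernel_intr (g u x : R) :
  (\int[mu]_(t in `]u, x[) (`|x - t| `^ (- g))%:E =
   \int[mu]_(t in `]0%R, (x - u)%R[) (t `^ (- g))%:E)%E.
Proof.
rewrite (ge0_integral_reflect x); first last.
- by move=> t _; rewrite lee_fin powR_ge0.
- by apply/measurable_EFinP; exact: measurable_kernelr.
- exact: measurable_itv.
rewrite (_ : mkset _ = `]0, x - u[%classic).
  apply: eq_integral => t; rewrite inE/= in_itv/= => /andP[t0 _].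
  by rewrite opprB addrCA subrr addr0 gtr0_norm.
by apply/seteqP; split=> t /=; rewrite !in_itv/= => /andP[? ?];
  apply/andP; split; lra.
Qed.

Lemma kernel_intl (g u x : R) :
  (\int[mu]_(t in `]u, x[) (`|t - u| `^ (- g))%:E =
   \int[mu]_(t in `]0%R, (x - u)%R[) (t `^ (- g))%:E)%E.
Proof.
rewrite -kernel_intr (ge0_integral_reflect (u + x)); first last.
- by move=> t _; rewrite lee_fin powR_ge0.
- by apply/measurable_EFinP; exact: measurable_kernell.
- exact: measurable_itv.
rewrite (_ : mkset _ = `]u, x[%classic).
  by apply: eq_integral => t _; congr (`|_| `^ _)%:E; ring.
by apply/seteqP; split=> t /=; rewrite !in_itv/= => /andP[? ?];
  apply/andP; split; lra.
Qed.

Section weighted.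
Variables (g a x : R) (h : R -> R) (k : R * R -> R).
Hypothesis g01 : 0 <= g < 1.
Hypothesis ih : mu.-integrable `]a, x[ (EFin \o h).
Hypotheses (mk : measurable_fun setT k) (k0 : forall p, 0 <= k p).
Hypothesis ik : forall xi, xi \in `]a, x[ ->
  (\int[mu]_(s in `]xi, x[) (k (s, xi))%:E = (power_int g (x - xi))%:E)%E.

(** Extension of [h] by 0, so that [f] is measurable on the whole plane; on the triangle [fE] gives
    back the original integrand. *)
Let h' := h \_ `]a, x[.
Let f p := h' p.2 * k p.

Let mh' : measurable_fun setT h'.
Proof.
apply/(measurable_restrictT _ _).1 => //.
by case/integrableP : ih => /measurable_EFinP.
Qed.

Let mf : measurable_fun setT f.
Proof. by apply: measurable_funM => //; exact: measurableT_comp. Qed.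

(** By [ik] the integral of the kernel in [s] is [power_int g (x - xi)], which is at most
    [power_int g (x - a)]. This is the L1 operator bound of the Volterra operator. *)
Lemma weighted_tonelli_le :
  (\int[mu]_(xi in `]a, x[) \int[mu]_(s in `]xi, x[) `|f (s, xi)|%:E <=
  (power_int g (x - a))%:E * \int[mu]_(t in `]a, x[) `|h t|%:E)%E.
Proof.
have mah : measurable_fun `]a, x[ (fun t => `|h t|%:E).
  apply/measurable_EFinP; apply: measurableT_comp => //.
  by case/integrableP : ih => /measurable_EFinP.
rewrite -ge0_integralZl//; [|by rewrite lee_fin power_int_ge0].
have E xi : xi \in `]a, x[%classic ->
  (\int[mu]_(s in `]xi, x[) `|f (s, xi)|%:E =
    (`|h xi| * power_int g (x - xi))%:E)%E.
  move=> xiax; rewrite EFinM -ik//; last by move: xiax; rewrite inE.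
  rewrite -ge0_integralZl//; last 2 first.
  - by apply/measurable_EFinP; apply: measurable_funTS;
      apply: measurableT_comp => //; exact: measurable_pair2.
  - by move=> s _; rewrite lee_fin.
  apply: eq_integral => s _; rewrite /f /h' patchE xiax normrM EFinM.
  by rewrite (ger0_norm (k0 _)).
rewrite [leLHS](_ : _ = \int[mu]_(xi in `]a, x[) (`|h xi| * power_int g (x - xi))%:E)%E;
  last by apply: eq_integral => xi xiax; exact: E.
apply: ge0_le_integral => //.
- by move=> xi _; rewrite lee_fin mulr_ge0 ?power_int_ge0.
- have : measurable_fun `]a, x[ (fun xi => \int[mu]_(s in `]xi, x[) `|f (s, xi)|%:E)%E.
    have : measurable_fun setT (fubini_G mu ((fun p => `|f p|%:E) \_ (triangle a x))).
      apply: measurable_fun_fubini_tonelli_G.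
        apply/(measurable_restrictT _ _).1; first exact: measurable_triangle.
        by apply: measurable_funTS; apply/measurable_EFinP; exact: measurableT_comp.
      by move=> p; exact: erestrict_ge0.
    rewrite /fubini_G; under eq_fun do rewrite triangle_ysection.
    by move=> h1; apply/(measurable_restrictT _ _).2.
  by apply: eq_measurable_fun => xi xiax; rewrite E.
- by apply: measurable_funeM.
- move=> xi; rewrite /= in_itv/= => /andP[axi xix].
  rewrite -EFinM lee_fin mulrC ler_wpM2r// le_power_int// ?subr_gt0//.
  by rewrite lerD2l lerN2 ltW.
Qed.

Lemma weighted_tonelli_lty :
  (\int[mu]_(xi in `]a, x[) \int[mu]_(s in `]xi, x[) `|f (s, xi)|%:E < +oo)%E.
Proof.
apply: le_lt_trans weighted_tonelli_le _.
apply: lte_mul_pinfty => //; first by rewrite lee_fin power_int_ge0.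
by case/integrableP : ih.
Qed.

Let fE s xi : s \in `]a, x[%classic -> xi \in `]a, s[%classic ->
  f (s, xi) = h xi * k (s, xi).
Proof.
rewrite !inE/= !in_itv/= => /andP[_ sx] /andP[axi xis].
by rewrite /f /h'/= patchE mem_set//= in_itv/= axi (lt_trans xis).
Qed.

Let FE s : s \in `]a, x[%classic ->
  \int[mu]_(xi in `]a, s[) f (s, xi) = \int[mu]_(xi in `]a, s[) (h xi * k (s, xi)).
Proof. by move=> sax; apply: eq_Rintegral => xi xias; exact: fE. Qed.

Lemma weighted_integrable :
  mu.-integrable `]a, x[
    (fun s => (\int[mu]_(xi in `]a, s[) (h xi * k (s, xi)))%:E).
Proof.
have := triangle_integrable mf weighted_tonelli_lty.
by apply: eq_integrable => // s sax; rewrite FE.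
Qed.

Lemma weighted_ae_integrable :
  {ae mu, forall s, s \in `]a, x[ ->
     mu.-integrable `]a, s[ (fun xi => (h xi * k (s, xi))%:E)}.
Proof.
have := triangle_integrable_xsection mf weighted_tonelli_lty.
apply: ae_impl.
move=> s + sax => /(_ sax).
by apply: eq_integrable => // xi xias; rewrite fE// inE.
Qed.

(** The right-hand side sees [k] only through [ik]: two kernels with the same integrals over the
    intervals []xi, x[] therefore give the same left-hand side, which is how [prim_vol] is
    obtained. *)
Lemma weighted_fubini :
  \int[mu]_(s in `]a, x[) \int[mu]_(xi in `]a, s[) (h xi * k (s, xi)) =
  \int[mu]_(xi in `]a, x[) (h xi * power_int g (x - xi)).
Proof.
transitivity (\int[mu]_(s in `]a, x[) \int[mu]_(xi in `]a, s[) f (s, xi)).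
  by apply: eq_Rintegral => s sax; rewrite FE.
rewrite (triangle_fubini mf weighted_tonelli_lty).
apply: eq_Rintegral => xi xiax.
transitivity (\int[mu]_(s in `]xi, x[) (h xi * k (s, xi))).
  by apply: eq_Rintegral => s _; rewrite /f /h' patchE xiax.
have xiax' : xi \in `]a, x[ by move: xiax; rewrite inE.
have ik' : mu.-integrable `]xi, x[ (fun s => (k (s, xi))%:E).
  apply/integrableP; split.
    apply/measurable_EFinP; apply: measurable_funTS;
      apply: measurableT_comp => //; exact: measurable_pair2.
  under eq_integral do rewrite gee0_abs ?lee_fin//.
  by rewrite ik// ltry.
by rewrite RintegralZl// /Rintegral ik.
Qed.

Lemma weighted_norm_le :
  (\int[mu]_(s in `]a, x[) `|\int[mu]_(xi in `]a, s[) (h xi * k (s, xi))|%:E <=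
  (power_int g (x - a))%:E * \int[mu]_(t in `]a, x[) `|h t|%:E)%E.
Proof.
apply: le_trans weighted_tonelli_le.
have mf' : measurable_fun setT (fun p => `|f p|%:E).
  by apply/measurable_EFinP; exact: measurableT_comp.
rewrite -(triangle_tonelli (f := fun p => `|f p|%:E))//.
apply: ae_ge0_le_integral => //.
- have /integrableP[m1 _] := weighted_integrable.
  have : measurable_fun `]a, x[ (abse \o (fun s =>
    (\int[mu]_(xi in `]a, s[) (h xi * k (s, xi)))%:E)) by exact: measurableT_comp.
  by [].
- by move=> s _; exact: integral_ge0.
- have : measurable_fun setT (fubini_F mu ((fun p => `|f p|%:E) \_ (triangle a x))).
    apply: measurable_fun_fubini_tonelli_F.
      apply/(measurable_restrictT _ _).1; first exact: measurable_triangle.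
      exact: measurable_funTS.
    by move=> p; exact: erestrict_ge0.
  rewrite /fubini_F; under eq_fun do rewrite triangle_xsection.
  by move=> h1; apply/(measurable_restrictT _ _).2.
(* The inner integral is known to converge absolutely for almost every [s] only, so the comparison
   of the integrands is an almost everywhere one. *)
have := triangle_integrable_xsection mf weighted_tonelli_lty.
apply: ae_impl.
move=> s + sax => /(_ sax) fi.
have sax' : s \in `]a, x[%classic by rewrite inE.
rewrite -FE// EFin_normr_Rintegral//.
by apply: le_abse_integral => //; case/integrableP: fi.
Qed.

End weighted.

Section vol.
Variables (g a x : R) (h : R -> R).
Hypothesis g01 : 0 <= g < 1.
Hypothesis ih : mu.-integrable `]a, x[ (EFin \o h).

Let k (p : R * R) := `|p.1 - p.2| `^ (- g).

Let mk : measurable_fun setT k. Proof. exact: measurable_kernel. Qed.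

Let k0 p : 0 <= k p. Proof. exact: powR_ge0. Qed.

Let ik xi : xi \in `]a, x[ ->
  (\int[mu]_(s in `]xi, x[) (k (s, xi))%:E = (power_int g (x - xi))%:E)%E.
Proof.
by rewrite in_itv/= => /andP[_ xix]; rewrite kernel_intl power_intE// subr_gt0.
Qed.

Lemma vol_integrable : mu.-integrable `]a, x[ (EFin \o vol g a h).
Proof. exact: weighted_integrable g01 ih mk k0 ik. Qed.

Lemma vol_ae_integrable : {ae mu, forall s, s \in `]a, x[ ->
  mu.-integrable `]a, s[ (fun t => (h t * `|s - t| `^ (- g))%:E)}.
Proof. exact: weighted_ae_integrable g01 ih mk k0 ik. Qed.

Lemma vol_norm_le :
  (\int[mu]_(s in `]a, x[) `|vol g a h s|%:E <=
  (power_int g (x - a))%:E * \int[mu]_(t in `]a, x[) `|h t|%:E)%E.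
Proof. exact: weighted_norm_le g01 ih mk k0 ik. Qed.

(** Both sides equal the integral of [h xi * power_int g (x - xi)]: the kernel [|s - xi| ^ - g] of
    the left side and its mirror image [|x - s| ^ - g], which produces the right side, have the same
    integral over []xi, x[]. *)
Lemma prim_vol : prim a (vol g a h) x = vol g a (prim a h) x.
Proof.
rewrite /prim [LHS](weighted_fubini g01 ih mk k0 ik).
pose k2 (p : R * R) := `|x - p.1| `^ (- g).
have mk2 : measurable_fun setT k2.
  apply: (measurableT_comp (measurable_powR (- g))).
  by apply: measurableT_comp => //; exact: measurable_funB.
have ik2 xi : xi \in `]a, x[ ->
  (\int[mu]_(s in `]xi, x[) (k2 (s, xi))%:E = (power_int g (x - xi))%:E)%E.
  by rewrite in_itv/= => /andP[_ xix]; rewrite kernel_intr power_intE// subr_gt0.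
rewrite -(weighted_fubini g01 ih mk2 (fun p => powR_ge0 _ _) ik2).
rewrite /vol; apply: eq_Rintegral => s; rewrite inE/= in_itv/= => /andP[_ sx].
rewrite -RintegralZr//; apply: integrableS ih => //.
by apply: subset_itvl; rewrite bnd_simp ltW.
Qed.

End vol.
End volterra.

(** * Primitives of integrable functions and their derivatives *)

Section prim.
Context {R : realType}.
Notation mu := (@lebesgue_measure R).
Implicit Types (a b x : R) (h : R -> R).

Lemma nbhs_oo a b x : a < x -> x < b -> \forall y \near x, a < y < b.
Proof.
move=> ax xb; near=> y; apply/andP; split; near: y; [exact: lt_nbhsr|exact: lt_nbhsl].
Unshelve. all: by end_near. Qed.

Lemma Rintegral_FTC (F f : R -> R) (s t : R) : s < t ->
  {in `[s, t], forall x : R, is_derive x 1 F (f x)} ->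
  {in `[s, t], continuous f} ->
  mu.-integrable `[s, t] (EFin \o f) /\ \int[mu]_(x in `[s, t]) f x = F t - F s.
Proof.
move=> st dF cf; have cf' : {within `[s, t], continuous f}.
  by apply: continuous_in_subspaceT => x; rewrite inE/=; exact: cf.
have cF x : x \in `[s, t] -> F @ x --> F x.
  by move=> /dF[/derivable1_diffP/differentiable_continuous h _]; exact: h.
split; first by apply: continuous_compact_integrable => //; exact: segment_compact.
have oc x : x \in `]s, t[ -> x \in `[s, t].
  by rewrite !in_itv/= => /andP[? ?]; rewrite !ltW.
rewrite /Rintegral (@continuous_FTC2 _ _ F)//.
- split => [x /oc/dF[]//||].
  + by apply: cvg_at_right_filter; apply: cF; rewrite in_itv/= lexx ltW.
  + by apply: cvg_at_left_filter; apply: cF; rewrite in_itv/= lexx ltW.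
- by move=> x /oc/dF[_]; rewrite derive1E.
Qed.

Lemma integrable_sub (i j : interval R) h : {subset i <= j} ->
  mu.-integrable [set` j] (EFin \o h) -> mu.-integrable [set` i] (EFin \o h).
Proof. by move=> ij; apply: integrableS => // x /=; exact: ij. Qed.

Lemma integrable_oo a b x h : x <= b -> mu.-integrable `]a, b[ (EFin \o h) ->
  mu.-integrable `]a, x[ (EFin \o h).
Proof.
move=> xb; apply: integrable_sub => y; rewrite !in_itv/= => /andP[-> yx].
exact: lt_le_trans xb.
Qed.

Lemma integrable_oo_cc a b h : mu.-integrable `]a, b[ (EFin \o h) ->
  mu.-integrable `[a, b] (EFin \o h).
Proof.
move=> /integrableP[mh ih]; apply/integrableP; split.
  by have := @emeasurable_fun_itv_cc _ a b false true _ mh.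
rewrite integral_itv_bndoo//.
have : measurable_fun `]a, b[ (abse \o (EFin \o h)) by exact: measurableT_comp.
by [].
Qed.

Lemma primE a b x h : x <= b -> mu.-integrable `]a, b[ (EFin \o h) ->
  prim a h x = \int[mu]_(t in `[a, x]) h t.
Proof.
move=> xb /(integrable_oo xb) ih; rewrite /prim /Rintegral; congr fine.
by rewrite -(integral_itv_bndoo true false)//; case/integrableP: ih.
Qed.

Lemma primB_itv a b s t h : a < s -> s <= t -> t < b ->
  mu.-integrable `]a, b[ (EFin \o h) ->
  prim a h t - prim a h s = \int[mu]_(r in `[s, t]) h r.
Proof.
move=> as_ st tb ih; rewrite (primE (ltW tb) ih) (primE (ltW (le_lt_trans st tb)) ih).
have ict : mu.-integrable `[a, t] (EFin \o h).
  by apply/integrable_oo_cc/(integrable_oo (ltW tb)).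
rewrite Rintegral_itvB ?bnd_simp//; last exact: ltW.
rewrite Rintegral_itv_obnd_cbnd//; apply: integrable_sub ict => y.
rewrite !in_itv/= => /andP[sy ->]; rewrite andbT.
by rewrite ltW// (lt_trans as_).
Qed.

Lemma prim_derive a b x h : a < x -> x < b -> mu.-integrable `]a, b[ (EFin \o h) ->
  {for x, continuous h} -> is_derive x 1 (prim a h) (h x).
Proof.
move=> ax xb ih ch; pose u := (x + b) / 2.
have xu : x < u by rewrite /u; lra.
have ub : u < b by rewrite /u; lra.
have [d1 d2] := continuous_FTC1_closed xu (integrable_oo_cc (integrable_oo (ltW ub) ih)) ax ch.
apply: (near_eq_is_derive (f := fun y => \int[mu]_(t in `[a, y]) h t)); last first.
  apply: DeriveDef; first exact: d1.
  by rewrite -derive1E; exact: d2.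
by near=> y; rewrite (@primE a b)//; near: y; exact: lt_le_nbhsl.
Unshelve. all: by end_near. Qed.

Lemma prim_continuous a b x h : a < x -> x < b ->
  mu.-integrable `]a, b[ (EFin \o h) -> {for x, continuous (prim a h)}.
Proof.
move=> ax xb ih.
have ab : a < b by exact: lt_trans xb.
have := parameterized_integral_continuous (ltW ab) (integrable_oo_cc ih).
move=> /(continuous_within_itvP _ ab)[/(_ x)]; rewrite in_itv/= ax xb => /(_ isT) c _ _.
rewrite /prop_for /continuous_at (primE (ltW xb) ih); apply: cvg_trans c.
apply: near_eq_cvg; near=> y; rewrite /parameterized_integral (@primE a b)//.
by near: y; exact: lt_le_nbhsl.
Unshelve. all: by end_near. Qed.

Lemma prim_cvg_left a b h : a < b ->
  mu.-integrable `]a, b[ (EFin \o h) -> prim a h x @[x --> a^'+] --> 0.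
Proof.
move=> ab ih; have := parameterized_integral_cvg_left ab (integrable_oo_cc ih).
move=> /(@cvg_at_right_filter _ _ _ _ _) c; apply: cvg_trans c.
apply: near_eq_cvg; near=> y; rewrite /parameterized_integral (@primE a b)//.
by near: y; exact: nbhs_right_le.
Unshelve. all: by end_near. Qed.

Lemma prim_norm_le a x h : mu.-integrable `]a, x[ (EFin \o h) ->
  `|prim a h x| <= \int[mu]_(t in `]a, x[) `|h t|.
Proof. by move=> ih; exact: le_normr_Rintegral. Qed.

Lemma eq_prim a x h h' : {in `]a, x[, h =1 h'} -> prim a h x = prim a h' x.
Proof. by move=> e; apply: eq_Rintegral => t; rewrite inE/=; exact: e. Qed.

Lemma eq_vol g a x h h' : {in `]a, x[, h =1 h'} -> vol g a h x = vol g a h' x.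
Proof. by move=> e; apply: eq_Rintegral => t; rewrite inE/= => tx; rewrite e. Qed.

(** Lebesgue's differentiation theorem. [G] need not be integrable up to the ends, so the theorem is
    applied on compact subintervals that exhaust []a, b[]. *)
Lemma ae_derive_of_increment a b (p G : R -> R) :
  (forall s t, a < s -> s < t -> t < b ->
     mu.-integrable `[s, t] (EFin \o G) /\ p t - p s = \int[mu]_(r in `[s, t]) G r) ->
  {ae mu, forall x, x \in `]a, b[ -> is_derive x 1 p (G x)}.
Proof.
move=> H; have [ab|ba] := ltP a b; last first.
  apply: aeW => x; rewrite in_itv/= => /andP[ax xb].
  by have := lt_trans ax xb; rewrite ltNge ba.
(* The denominator starts at 3 so that [s n < t n] already holds for [n = 0]. *)
pose e n := (b - a) / n.+3%:R; pose s n := a + e n; pose t n := b - e n.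
have HH n : {ae mu, forall x, x \in `]s n, t n[ -> is_derive x 1 p (G x)}.
  have d0 : 0 < e n by rewrite divr_gt0 ?subr_gt0.
  have d3 : e n <= (b - a) / 3.
    by rewrite ler_pM2l ?subr_gt0// lef_pV2 ?posrE// ler_nat.
  have as_ : a < s n by rewrite /s; lra.
  have tb : t n < b by rewrite /t; lra.
  have st : s n < t n by rewrite /s /t; lra.
  have [iG _] := H _ _ as_ st tb.
  pose f := G \_ `[s n, t n].
  have iF : mu.-integrable setT (EFin \o f).
    by rewrite /f -restrict_EFin; apply/integrable_restrict => //=; rewrite setTI.
  have iF' y : mu.-integrable [set` Interval (BLeft (s n)) (BRight y)] (EFin \o f).
    exact: integrableS iF.
  have := FTC1 iF' (integrable_locally (measurable_itv _) iG).
  apply: ae_impl.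
  move=> x + /[!in_itv]/= /andP[sx xt].
  move=> /(_ sx)[d1 d2].
  have -> : G x = 0 + f x.
    by rewrite /f patchE mem_set ?add0r//= in_itv/= !ltW.
  apply: (near_eq_is_derive (f := cst (p (s n)) + fun y => \int[mu]_(r in `[s n, y]) f r)).
    have := nbhs_oo sx xt; apply: filterS => y /andP[sy yt].
    rewrite fctE/= [X in _ + X](_ : _ = \int[mu]_(r in `[s n, y]) G r).
      by have [_ <-] := H _ _ as_ sy (lt_trans yt tb); rewrite addrC subrK.
    apply: eq_Rintegral => r; rewrite inE/= in_itv/= => /andP[sr ry].
    by rewrite /f patchE mem_set//= in_itv/= sr (le_trans ry)// ltW.
  apply: is_deriveD.
  apply: DeriveDef; first exact: d1.
  by rewrite -derive1E; exact: d2.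
have := ae_foralln HH; apply: ae_impl.
move=> x Hx; rewrite in_itv/= => /andP[ax xb].
have [n nP] : exists n : nat, e n < Num.min (x - a) (b - x).
  have m0 : 0 < Num.min (x - a) (b - x) by rewrite lt_min !subr_gt0 ax.
  exists (Num.truncn ((b - a) / Num.min (x - a) (b - x))).
  rewrite /e ltr_pdivrMr// mulrC -ltr_pdivrMr//.
  by rewrite (lt_trans (truncnS_gt _))// ltr_nat.
apply: (Hx n); rewrite in_itv/= /s /t; move: nP; rewrite lt_min => /andP[? ?].
by apply/andP; split; lra.
Qed.

(** The constant 0 has the integrals of [G] as its increments, hence derivative [G x] at almost
    every [x]. *)
Lemma ae_eq0_of_increment a b (G : R -> R) :
  (forall s t, a < s -> s < t -> t < b ->
     mu.-integrable `[s, t] (EFin \o G) /\ \int[mu]_(r in `[s, t]) G r = 0) ->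
  {ae mu, forall x, x \in `]a, b[ -> G x = 0}.
Proof.
move=> H; have := @ae_derive_of_increment a b (cst 0) G.
have H' s t : a < s -> s < t -> t < b -> mu.-integrable `[s, t] (EFin \o G) /\
    cst 0 t - cst 0 s = \int[mu]_(r in `[s, t]) G r.
  by move=> h1 h2 h3; have [? ->] := H _ _ h1 h2 h3; rewrite /= subrr.
move=> /(_ H'); apply: ae_impl.
by move=> x h xab; have [_ <-] := h xab; rewrite derive_cst.
Qed.

End prim.

(** * Test functions of one variable *)

Section test1.
Context {R : realType}.
Notation mu := (@lebesgue_measure R).

(** [p i] is the [i]-th derivative of a test function [p 0] on []a, b[]; carrying the whole sequence
    avoids iterated derivatives. For [b <= a] every [p i] is 0. *)
Definition test1 (a b : R) (p : nat -> R -> R) :=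
  (forall i (x : R), is_derive x 1 (p i) (p i.+1 x)) /\
  (forall i (x : R), ~~ (a < x < b) -> p i x = 0).

Variables (a b : R) (p : nat -> R -> R).
Hypothesis tp : test1 a b p.

Lemma test1_continuous i : continuous (p i).
Proof.
move=> x; have [/(_ i x)[/derivable1_diffP/differentiable_continuous h _] _] := tp.
exact: h.
Qed.

Lemma test1_integrable_cc i x y : mu.-integrable `[x, y] (EFin \o p i).
Proof.
apply: continuous_compact_integrable; first exact: segment_compact.
by apply: continuous_subspaceT => z; exact: test1_continuous.
Qed.

Lemma test1_integrable i x y : mu.-integrable `]x, y[ (EFin \o p i).
Proof.
apply: integrable_sub (test1_integrable_cc i x y) => z.
by rewrite !in_itv/= => /andP[? ?]; rewrite !ltW.
Qed.

Lemma test1_a i : p i a = 0.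
Proof. by apply: (tp.2); rewrite ltxx. Qed.

Lemma test1_b i : p i b = 0.
Proof. by apply: (tp.2); rewrite ltxx andbF. Qed.

Lemma test1_FTC i x y : x < y -> \int[mu]_(t in `[x, y]) p i.+1 t = p i y - p i x.
Proof.
move=> xy; have d : {in `[x, y], forall z : R, is_derive z 1 (p i) (p i.+1 z)}.
  by move=> z _; exact: tp.1.
have c : {in `[x, y], continuous (p i.+1)} by move=> z _; exact: test1_continuous.
by have [_ ->] := Rintegral_FTC xy d c.
Qed.

Lemma test1_prim i x : a < x -> p i x = prim a (p i.+1) x.
Proof.
move=> ax; rewrite (primE (b := x))//; last exact: test1_integrable.
by rewrite test1_FTC// test1_a subr0.
Qed.

Section vol.
Variable g : R.
Hypothesis g01 : 0 <= g < 1.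

(** From [p i = I (p i.+1)] and the commutation [prim_vol]. The Volterra integral of a test function
    can thus be differentiated without touching its singular kernel. *)
Lemma test1_vol_prim i x : a < x -> vol g a (p i) x = prim a (vol g a (p i.+1)) x.
Proof.
move=> ax; rewrite prim_vol//; last exact: test1_integrable.
by apply: eq_vol => y; rewrite in_itv/= => /andP[ay _]; exact: test1_prim.
Qed.

Lemma test1_vol_continuous i x : a < x -> {for x, continuous (vol g a (p i))}.
Proof.
move=> ax; rewrite /prop_for /continuous_at test1_vol_prim//.
have : prim a (vol g a (p i.+1)) y @[y --> x] --> prim a (vol g a (p i.+1)) x.
  apply: (@prim_continuous _ a (x + 1)) => //; first lra.
  by apply: vol_integrable => //; exact: test1_integrable.
apply: cvg_trans; apply: near_eq_cvg; near=> y; rewrite test1_vol_prim//.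
by near: y; exact: lt_nbhsr.
Unshelve. all: by end_near. Qed.

Lemma test1_vol_derive i x : a < x ->
  is_derive x 1 (vol g a (p i)) (vol g a (p i.+1) x).
Proof.
move=> ax; apply: (near_eq_is_derive (f := prim a (vol g a (p i.+1)))).
  near=> y; rewrite test1_vol_prim//.
  by near: y; exact: lt_nbhsr.
apply: (@prim_derive _ a (x + 1)) => //; first lra.
  by apply: vol_integrable => //; exact: test1_integrable.
exact: test1_vol_continuous.
Unshelve. all: by end_near. Qed.

Lemma test1_prim_prim_vol x : a < x ->
  prim a (prim a (vol g a (p 2%N))) x = vol g a (p 0%N) x.
Proof.
move=> ax; rewrite [RHS](test1_vol_prim 0 ax); apply: eq_prim => y.
by rewrite in_itv/= => /andP[ay _]; rewrite [RHS](test1_vol_prim 1 ay).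
Qed.

End vol.
End test1.

(** * Passing to the limit and identifying it on an interval *)

Section closure.
Context {R : realType}.
Notation mu := (@lebesgue_measure R).
Variables (a b : R).
Implicit Types h : R -> R.
Local Notation L1 h := (mu.-integrable `]a, b[ (EFin \o h)).
Local Notation nrm h := (\int[mu]_(x in `]a, b[) `|h x|).

(** Stands for a multiple of the Volterra operator, or for the identity when [alpha = 2]. *)
Variable A : (R -> R) -> R -> R.
Hypothesis A_integrable : forall h, L1 h -> L1 (A h).
Variable C : R.
Hypothesis C0 : 0 <= C.
Hypothesis A_norm : forall h, L1 h -> nrm (A h) <= C * nrm h.
Hypothesis A_sub : forall h1 h2, L1 h1 -> L1 h2 ->
  {ae mu, forall x, x \in `]a, b[ -> A h1 x - A h2 x = A (h1 - h2) x}.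
Hypothesis A_test : forall p, test1 a b p ->
  {in `]a, b[, prim a (prim a (A (p 2%N))) =1 A (p 0%N)}.

Lemma integrable_cst_oo (c s t : R) : mu.-integrable `]s, t[ (EFin \o cst c).
Proof.
apply: (@integrable_sub _ _ `[s, t]) => [x|].
  by rewrite !in_itv/= => /andP[? ?]; rewrite !ltW.
apply: continuous_compact_integrable; first exact: segment_compact.
by apply: continuous_subspaceT => z; exact: cst_continuous.
Qed.

Lemma Rintegral_cst_oo (c s t : R) : s <= t ->
  \int[mu]_(r in `]s, t[) (cst c r) = c * (t - s).
Proof.
move=> st; have -> : t - s = fine (@lebesgue_measure R `]s, t[).
  rewrite lebesgue_measure_itv/= lte_fin; case: ltP => [//|ts].
  by apply/eqP; rewrite subr_eq0 eq_le ts.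
exact: Rintegral_cst.
Qed.

Lemma L1B h1 h2 : L1 h1 -> L1 h2 -> L1 (h1 - h2).
Proof.
move=> i1 i2; have -> : EFin \o (h1 - h2) = ((EFin \o h1) \- (EFin \o h2))%E.
  by apply/funext => x /=; rewrite EFinB.
exact: integrableB.
Qed.

Lemma L1D h1 h2 : L1 h1 -> L1 h2 -> L1 (fun x => h1 x + h2 x).
Proof.
move=> i1 i2; have -> : EFin \o (fun x => h1 x + h2 x) = ((EFin \o h1) \+ (EFin \o h2))%E.
  by apply/funext => x /=; rewrite EFinD.
exact: integrableD.
Qed.

Lemma primB h1 h2 x : x <= b -> L1 h1 -> L1 h2 ->
  prim a (h1 - h2) x = prim a h1 x - prim a h2 x.
Proof. by move=> xb i1 i2; rewrite -RintegralB//; exact: integrable_oo i2 || exact: integrable_oo i1. Qed.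

Lemma L1_norm h : L1 h -> L1 (fun x => `|h x|).
Proof. exact: integrable_norm. Qed.

Lemma prim_bound h x : x <= b -> L1 h -> `|prim a h x| <= nrm h.
Proof.
move=> xb ih; have ix := integrable_oo xb ih.
apply: (le_trans (prim_norm_le ix)); apply: fine_le.
- by apply: integrable_fin_num => //; exact: integrable_norm.
- by apply: integrable_fin_num => //; exact: integrable_norm.
- apply: ge0_subset_integral => //.
    apply/measurable_EFinP; apply: measurableT_comp => //.
    by case/integrableP: ih => /measurable_EFinP.
  by apply: subset_itvl; rewrite bnd_simp.
Qed.

Lemma prim_integrable h : L1 h -> L1 (prim a h).
Proof.
(* The primitive is the Volterra operator with exponent 0. *)
move=> ih; have g01 : (0 : R) <= (0 : R) < 1 by apply/andP; split; [exact: lexx|exact: ltr01].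
have := vol_integrable g01 ih; rewrite (_ : vol 0 a h = prim a h)//.
by apply/funext => x; apply: eq_Rintegral => t _; rewrite oppr0 powRr0 mulr1.
Qed.

Lemma prim_prim_bound h x : a <= x <= b -> L1 h ->
  `|prim a (prim a h) x| <= (b - a) * nrm h.
Proof.
move=> /andP[ax xb] ih; have ip := integrable_oo xb (prim_integrable ih).
have n0 : 0 <= nrm h by exact: Rintegral_ge0.
apply: (le_trans (prim_norm_le ip)).
apply: (@le_trans _ _ (\int[mu]_(t in `]a, x[) (cst (nrm h) t))).
  apply: le_Rintegral => //; first exact: integrable_norm.
  - exact: integrable_cst_oo.
  - move=> t; rewrite /= in_itv/= => /andP[_ tx]; apply: prim_bound => //.
    by rewrite ltW// (lt_le_trans tx).
rewrite Rintegral_cst_oo// mulrC ler_wpM2r//; lra.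
Qed.

Lemma prim_primB h1 h2 x : x <= b -> L1 h1 -> L1 h2 ->
  prim a (prim a (h1 - h2)) x = prim a (prim a h1) x - prim a (prim a h2) x.
Proof.
move=> xb i1 i2; rewrite -primB//; try exact: prim_integrable.
apply: eq_prim => y; rewrite in_itv/= => /andP[_ yx].
by rewrite primB// ltW// (lt_le_trans yx).
Qed.

(** For a test function [p] the two sides agree, so their difference [D] is
    [prim a (prim a (w - A (p 2)))] minus [A (e - p 0)]. Both are small in L1, and the L1 norm of
    [D] is 0. *)
Lemma closure_identity (e w : R -> R) : L1 e -> L1 w ->
  (forall eps, 0 < eps -> exists p, [/\ test1 a b p,
     nrm (w - A (p 2%N)) <= eps & nrm (e - p 0%N) <= eps]) ->
  {ae mu, forall x, x \in `]a, b[ -> prim a (prim a w) x = A e x}.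
Proof.
move=> ie iw H.
have [ab|ba] := ltP a b; last first.
  apply: aeW => x; rewrite in_itv/= => /andP[ax xb].
  by have := lt_trans ax xb; rewrite ltNge ba.
pose D := prim a (prim a w) - A e.
have iD : L1 D by apply: L1B; [do 2 apply: prim_integrable|exact: A_integrable].
(* One factor [b - a] comes from the double primitive, the other from integrating its bound over
   []a, b[]; [C] is the operator bound of [A]. *)
have bound eps : 0 < eps -> nrm D <= ((b - a) * (b - a) + C) * eps.
  move=> e0; have [p [tp wp ep]] := H _ e0.
  have i0 : L1 (p 0%N) by exact: test1_integrable tp _ _ _.
  have i2 : L1 (p 2%N) by exact: test1_integrable tp _ _ _.
  have iA2 := A_integrable i2.
  have iwA := L1B iw iA2; have iep := L1B ie i0.
  have iAep := A_integrable iep.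
  have iN1 : L1 (fun x => `|prim a (prim a (w - A (p 2%N))) x|).
    by apply: L1_norm; do 2 apply: prim_integrable.
  have iN2 := L1_norm iAep.
  have iS := L1D iN1 iN2.
  apply: (@le_trans _ _ (\int[mu]_(x in `]a, b[)
     (`|prim a (prim a (w - A (p 2%N))) x| + `|A (e - p 0%N) x|))).
    apply: fine_le.
    - by apply: integrable_fin_num => //; exact: integrable_norm.
    - exact: integrable_fin_num.
    - apply: ae_ge0_le_integral => //.
      + by have /integrable_norm/integrableP[] := iD.
      + by case/integrableP : iS.
      (* Linearity of [A] is available almost everywhere only: the Volterra integral of an L1
         function is guaranteed to converge at almost every point. *)
      have := A_sub ie i0; apply: ae_impl => x + xab => /(_ xab) hx.
      rewrite lee_fin /D.
      have -> : (prim a (prim a w) - A e) x =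
         prim a (prim a (w - A (p 2%N))) x - A (e - p 0%N) x.
        move: xab; rewrite /= in_itv/= => /andP[ax xb].
        rewrite prim_primB ?(ltW xb)// -hx A_test ?in_itv/= ?ax//.
        rewrite -[LHS]/(prim a (prim a w) x - A e x); ring.
      exact: ler_normB.
  rewrite RintegralD//.
  rewrite mulrDl lerD//; last first.
    by apply: (le_trans (A_norm iep)); rewrite ler_wpM2l.
  apply: (@le_trans _ _ (\int[mu]_(t in `]a, b[) (cst ((b - a) * eps) t))).
    apply: le_Rintegral => //.
    - exact: integrable_cst_oo.
    - move=> t; rewrite /= in_itv/= => /andP[at_ tb].
      rewrite (le_trans (prim_prim_bound _ iwA))//; first by rewrite !ltW.
      by rewrite ler_wpM2l// subr_ge0 ltW.
  by rewrite Rintegral_cst_oo ?(ltW ab)// mulrAC.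
have D0 : nrm D = 0.
  apply/eqP; rewrite eq_le Rintegral_ge0// andbT.
  apply/ler_addgt0Pr => eps e0; rewrite add0r.
  have C1 : 0 < (b - a) * (b - a) + C + 1.
    by rewrite ltr_wpDl// addr_ge0// mulr_ge0// subr_ge0 ltW.
  have := bound (eps / ((b - a) * (b - a) + C + 1)) (divr_gt0 e0 C1).
  move=> /le_trans; apply; rewrite mulrA ler_pdivrMr// [leLHS]mulrC ler_pM2l//.
  by rewrite lerDl.
have : (\int[mu]_(x in `]a, b[) `|(D x)%:E| = 0)%E.
  have := D0; rewrite /Rintegral => h; rewrite -[LHS]fineK ?h//.
  by apply: integrable_fin_num => //; exact: integrable_norm.
move/(ae_eq_integral_abs mu (measurable_itv _)); case/integrableP: (iD) => mD _ /(_ mD).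
apply: ae_impl => x h xab; have := h xab => -[] /eqP; rewrite /D subr_eq0 => /eqP.
exact.
Qed.

End closure.

Section identification.
Context {R : realType}.
Notation mu := (@lebesgue_measure R).

Lemma ae_exists_oo (P : R -> Prop) (s t : R) : s < t ->
  {ae mu, forall x, P x} -> exists2 x, s < x < t & P x.
Proof.
move=> st aeP; apply: contrapT => nP.
have nst : mu.-negligible `]s, t[.
  apply: negligibleS aeP => x /=; rewrite in_itv/= => xst Px.
  by apply: nP; exists x.
have : @lebesgue_measure R `]s, t[%classic = 0%E by apply/negligibleP.
rewrite lebesgue_measure_itv/= lte_fin st => /eqP.
by rewrite -EFinB eqe subr_eq0 gt_eqF.
Qed.

Lemma ae_eq0_continuous (a b : R) (h : R -> R) :
  {in `]a, b[, continuous h} ->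
  {ae mu, forall x, x \in `]a, b[ -> h x = 0} -> {in `]a, b[, forall x, h x = 0}.
Proof.
move=> ch ae0 x xab; apply/eqP; apply: contrapT => /negP hx.
move: (xab); rewrite in_itv/= => /andP[ax xb].
have : \forall y \near x, h y != 0 /\ a < y < b.
  apply: filterI; last exact: nbhs_oo.
  by have := ch x xab; move/cvgr_neq0; exact.
move=> /nbhs_ballP[e /= e0 he].
have xe : x < x + e by rewrite ltrDl.
have [y /andP[xy yxe] Py] := ae_exists_oo xe ae0.
have [|/eqP hy yab] := he y; first by rewrite /ball/= ltr0_norm ?subr_lt0//; lra.
by apply: hy; apply: Py; rewrite in_itv.
Qed.

Lemma constant_of_derive0 (a b : R) (f : R -> R) :
  {in `]a, b[, forall x : R, is_derive x 1 f 0} ->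
  {in `]a, b[ &, forall s t, f s = f t}.
Proof.
move=> df s t; wlog st : s t / s < t.
  by move=> h hs ht; have [/h|/h h'|->//] := ltgtP s t; [exact|rewrite h'].
rewrite !in_itv/= => /andP[as_ sb] /andP[at_ tb].
have H x : x \in `[s, t] -> is_derive x 1 f 0.
  rewrite in_itv/= => /andP[sx xt]; apply: df; rewrite in_itv/=.
  by rewrite (lt_le_trans as_)//= (le_lt_trans xt).
have H' x : x \in `]s, t[ -> is_derive x 1 f (cst 0 x).
  by rewrite in_itv/= => /andP[sx xt]; apply: H; rewrite in_itv/= !ltW.
have [|c _ /eqP] := MVT st H'.
  by apply: derivable_within_continuous => x xst; have [] := H _ xst.
by rewrite mul0r subr_eq0 => /eqP.
Qed.

Lemma is_derive_unique (f : R -> R) (x u v : R) :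
  is_derive x 1 f u -> is_derive x 1 f v -> u = v.
Proof. by move=> [_ <-] [_ <-]. Qed.

Lemma is_derive_continuous (f : R -> R) (x u : R) :
  is_derive x 1 f u -> {for x, continuous f}.
Proof. by move=> [/derivable1_diffP/differentiable_continuous h _]; exact: h. Qed.

Section core.
Variables (a b : R) (w F q G : R -> R).
Hypothesis iw : mu.-integrable `]a, b[ (EFin \o w).
Hypothesis wF : {ae mu, forall x, x \in `]a, b[ -> prim a (prim a w) x = F x}.
Hypothesis dF : {in `]a, b[, forall x : R, is_derive x 1 F (q x)}.
Hypothesis qG : forall s t, a < s -> s < t -> t < b ->
  mu.-integrable `[s, t] (EFin \o G) /\ q t - q s = \int[mu]_(r in `[s, t]) G r.

(** Continuous functions equal almost everywhere are equal, so [prim a (prim a w)] and [F] share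
    their derivative, that is [prim a w = q]; then [w] and [G] have the same integral over every
    compact subinterval. *)
Lemma identification_core : {ae mu, forall x, x \in `]a, b[ -> w x = G x}.
Proof.
have ip := prim_integrable iw.
have dpp : {in `]a, b[, forall x : R, is_derive x 1 (prim a (prim a w)) (prim a w x)}.
  move=> x; rewrite in_itv/= => /andP[ax xb]; apply: (prim_derive ax xb ip).
  exact: prim_continuous iw.
have ppF : {in `]a, b[, forall x, prim a (prim a w) x = F x}.
  move=> x xab; apply/eqP; rewrite -subr_eq0; apply/eqP; move: x xab.
  apply: ae_eq0_continuous => [x xab|].
    have c1 := is_derive_continuous (dpp x xab).
    have c2 := is_derive_continuous (dF xab).
    exact: cvgB c1 c2.
  by apply: ae_impl wF => x h xab; rewrite h// subrr.
have pq : {in `]a, b[, forall x, prim a w x = q x}.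
  move=> x xab; apply: is_derive_unique (dF xab).
  apply: near_eq_is_derive (dpp x xab); move: xab; rewrite in_itv/= => /andP[ax xb].
  by have := nbhs_oo ax xb; apply: filterS => y yab; rewrite ppF// in_itv.
have H s t : a < s -> s < t -> t < b -> mu.-integrable `[s, t] (EFin \o (w - G)) /\
    \int[mu]_(r in `[s, t]) (w - G) r = 0.
  move=> as_ st tb; have [iG Ge] := qG as_ st tb.
  have iw' : mu.-integrable `[s, t] (EFin \o w).
    apply: integrable_sub iw => x; rewrite !in_itv/= => /andP[sx xt].
    by rewrite (lt_le_trans as_)//= (le_lt_trans xt).
  split.
    rewrite (_ : EFin \o (w - G) = ((EFin \o w) \- (EFin \o G))%E); first exact: integrableB.
    by apply/funext => x; rewrite /= EFinB.
  rewrite RintegralB// -Ge -(primB_itv as_ (ltW st) tb iw).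
  rewrite !pq ?subrr// in_itv/=; first by rewrite as_ (lt_trans st).
  by rewrite tb (lt_trans as_).
apply: ae_impl (ae_eq0_of_increment H) => x h xab; apply/eqP.
by rewrite -subr_eq0; apply/eqP; exact: h.
Qed.
End core.

End identification.

Section boundary.
Context {R : realType}.
Notation mu := (@lebesgue_measure R).
Variables (a b : R) (e p G : R -> R).
Hypothesis ab : a < b.
Hypothesis ep : {in `]a, b[, forall x : R, is_derive x 1 e (p x)}.
Hypothesis pG : forall s t, a < s -> s < t -> t < b ->
  p t - p s = \int[mu]_(r in `[s, t]) G r.
Hypothesis e0 : e x @[x --> a^'+] --> 0.
Hypothesis e1 : (e x / (x - a)) @[x --> a^'+] --> 0.
Hypothesis iG : forall x, a < x < b -> mu.-integrable `]a, x[ (EFin \o G).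

Let mid (x : R) : x < b -> x < (x + b) / 2 < b.
Proof. by move=> xb; apply/andP; split; lra. Qed.

Let iG' (x : R) : a < x -> x < b -> mu.-integrable `]a, (x + b) / 2[ (EFin \o G).
Proof. by move=> ax xb; apply: iG; apply/andP; split; lra. Qed.

Let p_prim : exists m, {in `]a, b[, forall x, p x = prim a G x + m}.
Proof.
have x0ab : (a + b) / 2 \in `]a, b[.
  by have h := ab; rewrite in_itv/=; apply/andP; split; lra.
have H : {in `]a, b[ &, forall s t, p s - prim a G s = p t - prim a G t}.
  move=> s t; wlog st : s t / s < t.
    by move=> h hs ht; have [/h|/h h'|->//] := ltgtP s t; [exact|rewrite h'].
  rewrite !in_itv/= => /andP[as_ sb] /andP[at_ tb].
  have /andP[tt' t'b] := mid tb.
  have := primB_itv as_ (ltW st) tt' (iG' at_ tb).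
  by rewrite -pG// => h; lra.
exists (p ((a + b) / 2) - prim a G ((a + b) / 2)) => x xab.
by rewrite -(H _ _ xab x0ab) addrC subrK.
Qed.

Let dpp : {in `]a, b[, forall x : R, is_derive x 1 (prim a (prim a G)) (prim a G x)}.
Proof.
move=> x; rewrite in_itv/= => /andP[ax xb].
have /andP[xx' x'b] := mid xb; have ix := iG' ax xb.
apply: (prim_derive ax xx'); first exact: prim_integrable.
exact: prim_continuous ix.
Qed.

(** The outer integral gains the length [x - a], which the quotient consumes; the remaining bound
    tends to 0 at [a]. *)
Let pp_small (x : R) : a < x < b ->
  `|prim a (prim a G) x / (x - a)| <= prim a (fun t => `|G t|) x.
Proof.
move=> /andP[ax xb]; have ix : mu.-integrable `]a, x[ (EFin \o G) by apply: iG; rewrite ax.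
have xa : 0 < x - a by rewrite subr_gt0.
rewrite normrM [X in _ * X]ger0_norm ?invr_ge0 ?(ltW xa)// ler_pdivrMr// mulrC.
by apply: (prim_prim_bound _ ix); rewrite lexx andbT ltW.
Qed.

(** Two integrations give [e = prim a (prim a G) + m * (x - a)] up to a constant. The limit of [e]
    at [a] removes the constant and that of [e / (x - a)] removes [m], the double primitive being
    [o(x - a)]. *)
Lemma boundary_prim :
  {in `]a, b[, forall x, p x = prim a G x} /\
  {in `]a, b[, forall x, e x = prim a (prim a G) x}.
Proof.
have [m pm] := p_prim; have h := ab.
have x0ab : (a + b) / 2 \in `]a, b[ by rewrite in_itv/=; apply/andP; split; lra.
have ax0 : a < (a + b) / 2 by lra.
have x0b : (a + b) / 2 < b by lra.
pose D x := e x - (prim a (prim a G) x + m * (x - a)).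
have dD : {in `]a, b[, forall x : R, is_derive x 1 D 0}.
  move=> x xab; have d1 := ep xab; have d2 := dpp xab.
  have d3 : is_derive x 1 (fun x => m * (x - a)) m.
    by apply: is_derive_eq; rewrite /GRing.scale/=; ring.
  by apply: is_derive_eq; rewrite pm//; ring.
have Dc := constant_of_derive0 dD.
have near_ab : \forall x \near a^'+, x \in `]a, b[.
  near=> x; rewrite in_itv/=; apply/andP; split; near: x.
    exact: nbhs_right_gt.
  exact: nbhs_right_lt.
have xa0 : (x - a) @[x --> a^'+] --> (0 : R).
  rewrite -(subrr a); apply: cvg_at_right_filter; apply: cvgB; [exact: cvg_id|exact: cvg_cst].
have pp0 : prim a (prim a G) x @[x --> a^'+] --> 0.
  apply: (prim_cvg_left ax0); apply: prim_integrable.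
  by apply: iG; rewrite ax0.
have D0 : D x @[x --> a^'+] --> 0.
  rewrite -[0](subrr 0) -{2}[0](addr0 0) -{3}[0](mulr0 m).
  apply: cvgB => //; apply: cvgD => //.
  by apply: cvgM => //; exact: cvg_cst.
have lim_uniq (f : R -> R) (u v : R) : f x @[x --> a^'+] --> u -> f x @[x --> a^'+] --> v -> u = v.
  move=> hu hv; transitivity (lim (f x @[x --> a^'+])).
    by apply/esym/cvg_lim; [exact: Rhausdorff|exact: hu].
  by apply/cvg_lim; [exact: Rhausdorff|exact: hv].
have k0 : D ((a + b) / 2) = 0.
  have : D x @[x --> a^'+] --> D ((a + b) / 2).
    apply: cvg_near_cst; near=> x.
    have xab : x \in `]a, b[ by near: x; exact: near_ab.
    exact: Dc.
  by move=> h'; exact: lim_uniq h' D0.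
have De x : x \in `]a, b[ -> e x = prim a (prim a G) x + m * (x - a).
  move=> xab; apply/eqP; rewrite -subr_eq0; apply/eqP.
  by rewrite -[LHS]/(D x) (Dc _ _ xab x0ab).
have ppa : (prim a (prim a G) x / (x - a)) @[x --> a^'+] --> 0.
  have pn0 : prim a (fun t => `|G t|) x @[x --> a^'+] --> 0.
    apply: (prim_cvg_left ax0); apply: integrable_norm => //.
    by apply: iG; rewrite ax0.
  apply/norm_cvg0P; apply: (squeeze_cvgr _ (cvg_cst 0) pn0).
  near=> x; have : x \in `]a, b[ by near: x; exact: near_ab.
  rewrite in_itv/= => xab.
  by rewrite normr_ge0/= pp_small.
have m0 : m = 0.
  have : (prim a (prim a G) x / (x - a) + m) @[x --> a^'+] --> 0.
    apply: cvg_trans e1; apply: near_eq_cvg; near=> x.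
    have xab : x \in `]a, b[ by near: x; exact: near_ab.
    rewrite De// mulrDl mulfK//; move: xab; rewrite in_itv/= subr_eq0 => /andP[ax _].
    by rewrite gt_eqF.
  have : (prim a (prim a G) x / (x - a) + m) @[x --> a^'+] --> 0 + m.
    by apply: cvgD => //; exact: cvg_cst.
  by rewrite add0r => h1 h2; exact: lim_uniq h1 h2.
split=> x xab; first by rewrite pm// m0 addr0.
by rewrite De// m0 mul0r addr0.
Unshelve. all: by end_near. Qed.
End boundary.

Section identification_vol.
Context {R : realType}.
Notation mu := (@lebesgue_measure R).
Variables (a b c g : R) (e p G w : R -> R).
Hypothesis g01 : 0 <= g < 1.
Hypothesis ep : {in `]a, b[, forall x : R, is_derive x 1 e (p x)}.
Hypothesis pG : forall s t, a < s -> s < t -> t < b ->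
  p t - p s = \int[mu]_(r in `[s, t]) G r.
Hypothesis e0 : e x @[x --> a^'+] --> 0.
Hypothesis e1 : (e x / (x - a)) @[x --> a^'+] --> 0.
Hypothesis good : {ae mu, forall x, x \in `]a, b[ ->
  mu.-integrable `]a, x[ (fun t => (G t * `|x - t| `^ (- g))%:E)}.
Hypotheses (ie : mu.-integrable `]a, b[ (EFin \o e))
  (iw : mu.-integrable `]a, b[ (EFin \o w)).
Hypothesis closure : forall eps, 0 < eps -> exists phi, [/\ test1 a b phi,
   \int[mu]_(x in `]a, b[) `|(w - (fun x => c * vol g a (phi 2%N) x)) x| <= eps &
   \int[mu]_(x in `]a, b[) `|(e - phi 0%N) x| <= eps].

(** Integrability of [G] up to the base point is extracted from a single point [y > x] at which the
    Caputo integral converges: on []a, y[] the kernel is at least [(y - a) ^ - g]. *)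
Let iG (x : R) : a < x < b -> mu.-integrable `]a, x[ (EFin \o G).
Proof.
move=> /andP[ax xb]; have [y /andP[xy yb] iy] := ae_exists_oo xb good.
have {}iy : mu.-integrable `]a, y[ (fun t => (G t * `|y - t| `^ (- g))%:E).
  by apply: iy; rewrite in_itv/= yb (lt_trans ax).
apply: integrable_oo (ltW xy) _.
have kE t : a < t < y -> G t = (G t * `|y - t| `^ (- g)) * `|y - t| `^ g.
  move=> /andP[_ ty]; rewrite powRN divfK// gt_eqF// powR_gt0// gtr0_norm subr_gt0//.
have mG : measurable_fun `]a, y[ G.
  apply: (eq_measurable_fun (fun t => (G t * `|y - t| `^ (- g)) * `|y - t| `^ g)).
    by move=> t; rewrite inE/= in_itv/= => aty; rewrite -kE.
  apply: measurable_funM.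
    by case/integrableP : iy => /measurable_EFinP.
  by have := @measurable_kernelr R (- g) y `]a, y[%classic; rewrite opprK.
have H : mu.-integrable `]a, y[ (fun t => ((y - a) `^ g * (G t * `|y - t| `^ (- g)))%:E).
  exact: integrable_scale.
apply: (le_integrable _ _ _ H) => //.
- exact/measurable_EFinP.
- move=> t; rewrite /= in_itv/= => aty; have /andP[at_ ty] := aty.
  rewrite lee_fin {1}(kE _ aty) !normrM mulrC ler_wpM2r ?mulr_ge0//.
  rewrite [leLHS]ger0_norm ?powR_ge0// [leRHS]ger0_norm ?powR_ge0//.
  apply: ge0_ler_powR; rewrite ?nnegrE//; first by case/andP: g01.
    by rewrite subr_ge0 ltW// (lt_trans at_).
  by rewrite gtr0_norm ?subr_gt0// lerD2l lerN2 ltW.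
Qed.

Lemma vol_Rnorm_le h : mu.-integrable `]a, b[ (EFin \o h) ->
  \int[mu]_(x in `]a, b[) `|vol g a h x| <=
  power_int g (b - a) * \int[mu]_(x in `]a, b[) `|h x|.
Proof.
move=> ih; have i1 := integrable_norm (vol_integrable g01 ih).
have i2 := integrable_norm ih.
have f1 : (\int[mu]_(x in `]a, b[) `|vol g a h x|%:E)%E \is a fin_num.
  exact: integrable_fin_num.
have f2 : (\int[mu]_(x in `]a, b[) `|h x|%:E)%E \is a fin_num.
  exact: integrable_fin_num.
rewrite /Rintegral -lee_fin EFinM (fineK f1) (fineK f2); exact: vol_norm_le.
Qed.

Let cap x := c * vol g a G x.

Let icap (x : R) : a < x < b -> mu.-integrable `]a, x[ (EFin \o cap).
Proof.
move=> axb; have h := vol_integrable g01 (iG axb).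
exact: integrable_scale.
Qed.

Lemma prim_scale (s : R) h x : mu.-integrable `]a, x[ (EFin \o h) ->
  prim a (fun t => s * h t) x = s * prim a h x.
Proof. by move=> ih; rewrite /prim RintegralZl. Qed.

Lemma identification_vol :
  {ae mu, forall x, x \in `]a, b[ -> w x = c * vol g a G x}.
Proof.
have [ab|ba] := ltP a b; last first.
  apply: aeW => x; rewrite in_itv/= => /andP[ax xb].
  by have := lt_trans ax xb; rewrite ltNge ba.
have [_ epp] := boundary_prim ab ep pG e0 e1 iG.
have mid (x : R) : x < b -> x < (x + b) / 2 < b.
  by move=> xb; apply/andP; split; lra.
have icap' (x : R) : a < x -> x < b -> mu.-integrable `]a, (x + b) / 2[ (EFin \o cap).
  by move=> ax xb; apply: icap; apply/andP; split; lra.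
pose A h x := c * vol g a h x.
have L1A h : mu.-integrable `]a, b[ (EFin \o h) -> mu.-integrable `]a, b[ (EFin \o A h).
  by move=> /(vol_integrable g01) ih; exact: integrable_scale.
have wc : {ae mu, forall x, x \in `]a, b[ -> prim a (prim a w) x = A e x}.
  apply: (@closure_identity _ a b A L1A (`|c| * power_int g (b - a)))=> //.
  - by rewrite mulr_ge0// power_int_ge0.
  - move=> h ih; have iv := vol_integrable g01 ih.
    rewrite /A; under eq_Rintegral do rewrite normrM.
    rewrite RintegralZl//; last exact: integrable_norm.
    by rewrite -mulrA ler_wpM2l//; exact: vol_Rnorm_le.
  - move=> h1 h2 i1 i2.
    have := ae_and (vol_ae_integrable g01 i1) (vol_ae_integrable g01 i2).
    apply: ae_impl => x [v1 v2] xab; rewrite /A -mulrBr; congr (_ * _).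
    rewrite /vol -RintegralB//; [|exact: v1|exact: v2].
    by apply: eq_Rintegral => t _; rewrite -mulrBl.
  - move=> q tq x; rewrite in_itv/= => /andP[ax xb]; rewrite /A.
    rewrite -(test1_prim_prim_vol tq g01 ax) -prim_scale.
      apply: eq_prim => y; rewrite in_itv/= => /andP[ay yx].
      by rewrite prim_scale//; apply: vol_integrable => //; exact: test1_integrable tq _ _ _.
    apply: prim_integrable; apply: vol_integrable => //.
    exact: test1_integrable tq _ _ _.
(* [cap] is known to be integrable on []a, x[] for [x < b], not up to [b]; increments over compact
   subintervals are what the core argument asks for. *)
apply: (identification_core (F := prim a (prim a cap)) (q := prim a cap)) => //.
- apply: ae_impl wc => x h xab; rewrite h// /A.
  move: xab; rewrite in_itv/= => /andP[ax xb].
  have iGx : mu.-integrable `]a, x[ (EFin \o G) by apply: iG; rewrite ax.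
  have ivx := vol_integrable g01 iGx.
  have -> : prim a (prim a cap) x = c * prim a (prim a (vol g a G)) x.
    rewrite -prim_scale; last exact: prim_integrable.
    apply: eq_prim => y; rewrite in_itv/= => /andP[ay yx].
    by rewrite /cap prim_scale//; apply: integrable_oo ivx; exact: ltW.
  congr (_ * _).
  transitivity (prim a (vol g a (prim a G)) x); last first.
    apply: eq_prim => y; rewrite in_itv/= => /andP[ay yx].
    by rewrite prim_vol//; apply: iG; rewrite ay (lt_trans yx).
  rewrite prim_vol//; last exact: prim_integrable.
  apply: eq_vol => y; rewrite in_itv/= => /andP[ay yx].
  by rewrite epp// in_itv/= ay (lt_trans yx).
- move=> x; rewrite in_itv/= => /andP[ax xb].
  have /andP[xx' x'b] := mid _ xb; have ix := icap' _ ax xb.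
  apply: (prim_derive ax xx'); first exact: prim_integrable.
  exact: prim_continuous ix.
- move=> s t as_ st tb; have at_ := lt_trans as_ st.
  have /andP[tt' t'b] := mid _ tb; have ix := icap' _ at_ tb.
  split; last exact: primB_itv (ltW st) tt' ix.
  apply: integrable_sub ix => x; rewrite !in_itv/= => /andP[sx xt].
  by rewrite (lt_le_trans as_)//= (le_lt_trans xt).
Qed.

End identification_vol.

(** * Energy of a test function on an interval *)

Section signed_reflection.
Context {R : realType}.
Notation mu := (@lebesgue_measure R).

Lemma Rintegral_reflect (c : R) (A : set R) (f : R -> R) :
  measurable A -> measurable_fun A f ->
  \int[mu]_(x in A) f x = \int[mu]_(x in [set x | A (c - x)]) f (c - x).
Proof.
move=> mA /measurable_EFinP mf; congr fine.
have H : forall F : R -> \bar R, measurable_fun A F -> (\int[mu]_(x in A) F x =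
    \int[mu]_(x in [set x | A (c - x)%R]) (F \o (fun x => c - x)%R) x)%E.
  move=> F mF; rewrite integralE [RHS]integralE.
  have mp := measurable_funepos mF; have mn := measurable_funeneg mF.
  have := ge0_integral_reflect c mA mp (fun x _ => funepos_ge0 F x).
  have := ge0_integral_reflect c mA mn (fun x _ => funeneg_ge0 F x).
  by move=> -> ->; rewrite [in RHS]funepos_comp [in RHS]funeneg_comp.
exact: H mf.
Qed.

End signed_reflection.

Section energy.
Context {R : realType}.
Notation mu := (@lebesgue_measure R).
Variables (a b : R) (p : nat -> R -> R).
Hypotheses (ab : a < b) (tp : test1 a b p).

Lemma test1_bounded i : exists2 M : R, 0 <= M & forall x, `|p i x| <= M.
Proof.
have cp : {within `[a, b], continuous (fun x => `|p i x|)}.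
  apply: continuous_subspaceT => x; apply: cvg_norm.
  exact: (test1_continuous tp).
have [c _ cM] := EVT_max (ltW ab) cp.
exists `|p i c| => // x; have [xab|xab] := boolP (x \in `[a, b]); first exact: cM.
rewrite (tp.2) ?normr0//; apply: contra xab => /andP[ax xb].
by rewrite in_itv/= !ltW.
Qed.

(** For [i = 0] the autocorrelation of [p 0]; higher indices give its derivatives in [s] up to the
    sign [(-1)^i], so that [autocorr 2] is its second derivative. *)
Definition autocorr i s := \int[mu]_(x in `[a, b]) (p 0%N x * p i (x - s)).

Lemma shift_continuous i s : continuous (fun x => p i (x - s)).
Proof.
move=> x; apply: (@cvg_comp _ _ _ (fun x => x - s) (p i) _ (nbhs (x - s))).
  by apply: cvgB; [exact: cvg_id|exact: cvg_cst].
exact: (test1_continuous tp).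
Qed.

Lemma integrable_continuous_cc (f : R -> R) s t :
  continuous f -> mu.-integrable `[s, t] (EFin \o f).
Proof.
move=> cf; apply: continuous_compact_integrable; first exact: segment_compact.
exact: continuous_subspaceT.
Qed.

Lemma shift_derive i (x s : R) : is_derive s 1 (fun s => p i (x - s)) (- p i.+1 (x - s)).
Proof.
have d1 : is_derive s 1 (fun s : R => x - s) (-1).
  by apply: is_derive_eq; rewrite /GRing.scale/=; ring.
have d2 : is_derive (x - s) 1 (p i) (p i.+1 (x - s)) by exact: tp.1.
have := @is_derive1_comp _ (p i) (fun s => x - s) s _ _ d2 d1; rewrite mulrN1; exact.
Qed.

(** Differentiation under the integral sign: the bounds of [p 0] and [p i.+1] furnish a constant
    majorant on a neighbourhood of [s]. *)
Lemma autocorr_derive i (s : R) : is_derive s 1 (autocorr i) (- autocorr i.+1 s).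
Proof.
pose f s x := p 0%N x * p i (x - s).
have [M0 M00 M0p] := test1_bounded 0; have [M1 M10 M1p] := test1_bounded i.+1.
have df (x t : R) : is_derive t 1 (f^~ x) (- (p 0%N x * p i.+1 (x - t))).
  have d := shift_derive i x t.
  have := @is_deriveM _ _ (cst (p 0%N x)) (fun s => p i (x - s)) t 1 _ _ (is_derive_cst _ _ _) d.
  by move=> h; apply: is_derive_eq h _; rewrite scaler0 addr0 /GRing.scale/= mulrN.
have intf (t : R) : `]s - 1, s + 1[%classic t -> mu.-integrable `[a, b] (EFin \o f t).
  move=> _; apply: integrable_continuous_cc => x; apply: cvgM.
    exact: (test1_continuous tp).
  exact: shift_continuous.
have derf1 (t y : R) : `]s - 1, s + 1[%classic t -> `[a, b]%classic y -> derivable (f^~ y) t 1.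
  by move=> _ _; have [] := df y t.
have intG : mu.-integrable `[a, b] (EFin \o cst (M0 * M1)).
  by apply: integrable_continuous_cc => x; exact: cvg_cst.
have dE (t y : R) : partial1of2 f t y = - (p 0%N y * p i.+1 (y - t)).
  by rewrite partial1of2E; have [] := df y t.
have G_ub (t y : R) : `]s - 1, s + 1[%classic t -> `[a, b]%classic y ->
    `|partial1of2 f t y| <= cst (M0 * M1) y.
  by move=> _ _; rewrite dE normrN normrM ler_pM.
have Is : `]s - 1, s + 1[%classic s by rewrite /= in_itv/=; apply/andP; split; lra.
have mab : measurable (`[a, b]%classic : set R) by exact: measurable_itv.
have G0 y : 0 <= cst (M0 * M1) (y : R) by exact: mulr_ge0.
apply: DeriveDef.
  exact: (@derivable_under_integral R _ _ mu f `[a, b]%classic mab s (s - 1) (s + 1) Is intf derf1 (cst (M0 * M1)) G0 intG G_ub).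
rewrite -derive1E (@differentiation_under_integral R _ _ mu f `[a, b]%classic mab s (s - 1) (s + 1) Is intf derf1 (cst (M0 * M1)) G0 intG G_ub).
transitivity (\int[mu]_(x in `[a, b]) (-1 * (p 0%N x * p i.+1 (x - s)))).
  by apply: eq_Rintegral => x _; rewrite dE mulN1r.
rewrite RintegralZl ?mulN1r//.
apply: integrable_continuous_cc => x; apply: cvgM.
  exact: (test1_continuous tp).
exact: shift_continuous.
Qed.

Lemma autocorr_far i s : b - a <= s -> autocorr i s = 0.
Proof.
move=> bas; rewrite /autocorr.
transitivity (\int[mu]_(x in `[a, b]) (cst 0 x)); last first.
  by rewrite Rintegral_cst// mul0r.
apply: eq_Rintegral => x; rewrite inE/= in_itv/= => /andP[_ xb].
by rewrite [X in _ * X](tp.2) ?mulr0//; apply/negP => /andP[ax _]; lra.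
Qed.

Lemma autocorr1_0 : autocorr 1 0 = 0.
Proof.
have d : {in `[a, b], forall x : R,
    is_derive x 1 (fun x => p 0%N x ^+ 2 / 2) (p 0%N x * p 1%N x)}.
  move=> x _; have d0 : is_derive x 1 (p 0%N) (p 1%N x) by exact: tp.1.
  by apply: is_derive_eq; rewrite /GRing.scale/=; field.
have c : {in `[a, b], continuous (fun x => p 0%N x * p 1%N x)}.
  by move=> x _; apply: cvgM; exact: (test1_continuous tp).
have [_] := Rintegral_FTC ab d c.
rewrite (test1_a tp) (test1_b tp) subrr => h; apply: etrans h.
by rewrite /autocorr; apply: eq_Rintegral => x _; rewrite subr0.
Qed.

Lemma autocorr_continuous i : continuous (autocorr i).
Proof. by move=> s; exact: (is_derive_continuous (autocorr_derive i s)). Qed.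

(** [2 u v <= u^2 + v^2] combined with translation invariance of the integral of [p 0 ^+ 2];
    restricting the translate to [[a, b]] can only lose mass. *)
Lemma autocorr_max s : autocorr 0 s <= autocorr 0 0.
Proof.
have cc t u : mu.-integrable `[a, b] (EFin \o (fun x => p 0%N (x - t) * p 0%N (x - u))).
  by apply: integrable_continuous_cc => x; apply: cvgM; exact: shift_continuous.
pose h (x : R) := (p 0%N x * p 0%N x)%:E.
have mh t D : measurable_fun D (fun x : R => h (x - t)).
  apply: measurable_funTS; apply/measurable_EFinP.
  by apply: measurable_funM; apply: continuous_measurable_fun; exact: shift_continuous.
have h0 x : (0 <= h x)%E by rewrite lee_fin -expr2 sqr_ge0.
have mhT : measurable_fun setT h.
  by have := mh 0 setT; under eq_fun do rewrite subr0.
have sq : \int[mu]_(x in `[a, b]) (p 0%N (x - s) * p 0%N (x - s)) <= autocorr 0 0.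
  rewrite /autocorr; under [leRHS]eq_Rintegral do rewrite subr0.
  apply: fine_le.
  - by apply: integrable_fin_num => //; exact: cc.
  - apply: integrable_fin_num => //.
    by apply: eq_integrable (cc 0 0) => // x _; rewrite /= !subr0.
  apply: (@le_trans _ _ (\int[mu]_x h (x - s)%R)%E).
    apply: ge0_subset_integral => //; first exact: (mh s setT).
    by move=> x _; exact: h0.
  (* The translation by [s] is composed of two reflections, about [s / 2] here and about 0 below. *)
  rewrite (ge0_integral_reflect s); [|by []|exact: (mh s setT)|by move=> x _; exact: h0].
  rewrite [leRHS](_ : _ = \int[mu]_x h x)%E; last first.
    rewrite integral_mkcond; apply: eq_integral => x _; rewrite patchE.
    case: ifPn => //; rewrite notin_setE/= in_itv/= => /negP xab.
    rewrite /h (tp.2) ?mulr0//; apply: contra xab => /andP[ax xb].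
    by rewrite !ltW.
  rewrite [leRHS](ge0_integral_reflect 0); [|by []|exact: mhT|by move=> x _; exact: h0].
  rewrite le_eqVlt; apply/orP; left; apply/eqP; apply: eq_integral => x _.
  by congr h; ring.
have sq0 : \int[mu]_(x in `[a, b]) (p 0%N (x - 0) * p 0%N (x - 0)) = autocorr 0 0.
  by apply: eq_Rintegral => x _; rewrite subr0.
apply: (@le_trans _ _ (\int[mu]_(x in `[a, b]) (2^-1 *
    (p 0%N (x - 0) * p 0%N (x - 0) + p 0%N (x - s) * p 0%N (x - s))))).
  apply: le_Rintegral => //.
  - have := cc 0 s; apply: eq_integrable => // x _; by rewrite /= subr0.
  - apply: integrable_scale => //.
    by apply: integrable_addR => //; exact: cc.
  - move=> x _; rewrite subr0 ler_pdivlMl//; set u := p 0%N x; set v := p 0%N (x - s).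
    by have := sqr_ge0 (u - v); rewrite expr2; nra.
rewrite RintegralZl//; last first.
  by apply: integrable_addR => //; exact: cc.
rewrite RintegralD// sq0; move: sq; clear.
move: (Rintegral _ _ _) (autocorr 0 0) => u v uv; lra.
Qed.

Section vol.
Variable g : R.
Hypothesis g01 : 0 < g < 1.

Let L := b - a.

Lemma powR_shift_derive (r e x : R) : 0 < x + e ->
  is_derive x 1 (fun s => (s + e) `^ r) (r * (x + e) `^ (r - 1)).
Proof.
move=> xe; have d1 : is_derive (x + e) 1 (fun s : R => s `^ r) (r * (x + e) `^ (r - 1)).
  apply: DeriveDef; first by apply: derivable_powR; rewrite in_itv/= xe.
  by rewrite -derive1E powR_derive1// in_itv/= xe.
have d2 : is_derive x 1 (fun s : R => s + e) 1.
  by apply: is_derive_eq; rewrite /GRing.scale/=; ring.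
by have := @is_derive1_comp _ (fun s => s `^ r) (fun s => s + e) x _ _ d1 d2; rewrite mulr1; exact.
Qed.

(* With [S s = autocorr 0 0 - autocorr 0 s >= 0] and the convex kernel
   [k s = (s + e)^-g], [k * autocorr 2 + k'' * S] is the derivative of
   [k' * S - k * autocorr 1], whose boundary terms have the right sign. *)
Lemma energy_shifted (e : R) : 0 < e ->
  \int[mu]_(s in `[0, L]) ((s + e) `^ (- g) * autocorr 2 s) <= 0.
Proof.
move=> e0; have L0 : 0 < L by rewrite subr_gt0.
have /andP[g0 _] := g01.
pose k (s : R) := (s + e) `^ (- g).
pose k1 (s : R) := (- g) * (s + e) `^ (- g - 1).
pose k2 (s : R) := (- g) * ((- g - 1) * (s + e) `^ (- g - 1 - 1)).
pose S s := autocorr 0 0 - autocorr 0 s.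
pose P s := k1 s * S s - k s * autocorr 1 s.
have pos s : s \in `[0, L] -> 0 < s + e.
  by rewrite in_itv/= => /andP[s0 _]; lra.
have dk s : s \in `[0, L] -> is_derive s 1 k (k1 s).
  by move=> /pos se; exact: powR_shift_derive.
have dk1 s : s \in `[0, L] -> is_derive s 1 k1 (k2 s).
  move=> /pos se; have d := powR_shift_derive (- g - 1) se.
  by apply: is_derive_eq; rewrite /GRing.scale/= /k2; ring.
have dk2 s : s \in `[0, L] -> {for s, continuous k2}.
  move=> /pos se; have d := powR_shift_derive (- g - 1 - 1) se.
  have := is_derive_continuous d => c.
  by apply: cvgM; [exact: cvg_cst|apply: cvgM; [exact: cvg_cst|exact: c]].
have dP : {in `[0, L], forall s : R, is_derive s 1 P (k s * autocorr 2 s + k2 s * S s)}.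
  move=> s sL; have d0 := dk s sL; have d1 := dk1 s sL.
  have c0 := autocorr_derive 0 s; have c1 := autocorr_derive 1 s.
  by apply: is_derive_eq; rewrite /GRing.scale/= /S; ring.
have ck s : s \in `[0, L] -> {for s, continuous k}.
  by move=> sL; exact: is_derive_continuous (dk s sL).
have c1 : {in `[0, L], continuous (fun s => k s * autocorr 2 s)}.
  by move=> s sL; apply: cvgM; [exact: ck|exact: autocorr_continuous].
have c2 : {in `[0, L], continuous (fun s => k s * autocorr 2 s + k2 s * S s)}.
  move=> s sL; apply: cvgD; first exact: c1.
  apply: cvgM; first exact: dk2.
  by apply: cvgB; [exact: cvg_cst|exact: autocorr_continuous].
have [i2 E] := Rintegral_FTC L0 dP c2.
have i1 : mu.-integrable `[0, L] (EFin \o (fun s => k s * autocorr 2 s)).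
  apply: continuous_compact_integrable; first exact: segment_compact.
  by apply: continuous_in_subspaceT => x; rewrite inE/=; exact: c1.
apply: (@le_trans _ _ (P L - P 0)).
  rewrite -E; apply: le_Rintegral => // s sL.
  rewrite lerDl mulr_ge0//; last by rewrite subr_ge0 autocorr_max.
  rewrite /k2 mulrA mulr_ge0 ?powR_ge0//; nra.
(* At [L] only [k1 L * autocorr 0 0] survives, which is nonpositive; at 0 both [S] and [autocorr 1]
   vanish. *)
rewrite /P /S (autocorr_far 0 (lexx L)) (autocorr_far 1 (lexx L)) autocorr1_0 subrr.
rewrite !mulr0 !subr0.
rewrite mulr_le0_ge0//; first by rewrite /k1 mulNr oppr_le0 mulr_ge0 ?powR_ge0// ltW.
by rewrite /autocorr; apply: Rintegral_ge0 => x _; rewrite subr0 -expr2 sqr_ge0.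
Qed.


Lemma autocorr_bounded i : exists2 K : R, 0 <= K & forall s, s \in `[0, L] -> `|autocorr i s| <= K.
Proof.
have L0 : 0 <= L by rewrite subr_ge0 ltW.
have cp : {within `[0, L], continuous (fun s => `|autocorr i s|)}.
  by apply: continuous_subspaceT => x; apply: cvg_norm; exact: autocorr_continuous.
by have [c _ cM] := EVT_max L0 cp; exists `|autocorr i c|.
Qed.

Lemma measurable_autocorr i D : measurable_fun D (autocorr i).
Proof. by apply: measurable_funTS; apply: continuous_measurable_fun; exact: autocorr_continuous. Qed.

Lemma power_integrable : mu.-integrable `]0, L[ (fun s => (s `^ (- g))%:E).
Proof.
have /andP[g0 g1] := g01; apply/integrableP; split.
  by apply/measurable_EFinP; apply: measurable_funTS; exact: measurable_powR.
under eq_integral do rewrite gee0_abs ?lee_fin ?powR_ge0//.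
by apply: integral_power_lty; rewrite ?subr_gt0// ltW.
Qed.

(** Dominated convergence as the shift [e n] tends to 0. Since [(s + e) ^ - g] decreases in [e], the
    unshifted kernel times a bound of [autocorr 2] is a majorant. *)
Lemma energy_power :
  mu.-integrable `]0, L[ (EFin \o (fun s => s `^ (- g) * autocorr 2 s)) /\
  \int[mu]_(s in `]0, L[) (s `^ (- g) * autocorr 2 s) <= 0.
Proof.
have /andP[g0 g1] := g01.
have g01' : 0 <= g < 1 by rewrite ltW.
have L0 : 0 < L by rewrite subr_gt0.
have [K K0 KP] := autocorr_bounded 2.
pose e (n : nat) : R := n.+1%:R^-1.
have e_gt0 n : 0 < e n by rewrite invr_gt0.
pose f_ n (s : R) := ((s + e n) `^ (- g) * autocorr 2 s)%:E.
pose f (s : R) := (s `^ (- g) * autocorr 2 s)%:E.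
pose G (s : R) := (K * s `^ (- g))%:E.
have in_oc s : `]0, L[%classic s -> s \in `[0, L].
  by rewrite /= !in_itv/= => /andP[? ?]; rewrite !ltW.
have mf_ n D : measurable_fun D (f_ n).
  apply/measurable_EFinP; apply: measurable_funM; last exact: measurable_autocorr.
  apply: measurable_funTS; apply: (measurableT_comp (measurable_powR (- g))).
  exact: measurable_funD.
have mf D : measurable_fun D f.
  apply/measurable_EFinP; apply: measurable_funM; last exact: measurable_autocorr.
  by apply: measurable_funTS; exact: measurable_powR.
have f_f : {ae mu, forall s, `]0, L[%classic s -> f_ ^~ s @ \oo --> f s}.
  apply: aeW => s; rewrite /= in_itv/= => /andP[s0 _].
  apply: cvg_EFin; first by near=> n.
  apply: cvgM; last exact: cvg_cst.
  have c0 : {for s, continuous (fun t : R => t `^ (- g))}.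
    have d : derivable (fun t : R => t `^ (- g)) s 1.
      by apply: derivable_powR; rewrite in_itv/= s0.
    by move/derivable1_diffP/differentiable_continuous : d => h; exact: h.
  apply: (@cvg_comp _ _ _ (fun n => s + e n) (fun t => t `^ (- g)) _ (nbhs s)); last exact: c0.
  have cs : s + e n @[n --> \oo] --> s + 0.
    by apply: cvgD; [exact: cvg_cst|exact: cvg_harmonic].
  by rewrite addr0 in cs; exact: cs.
have iG : mu.-integrable `]0, L[ G.
  by apply: integrable_scale => //; exact: power_integrable.
have f_G : {ae mu, forall s n, `]0, L[%classic s -> (`|f_ n s| <= G s)%E}.
  apply: aeW => s n sL; have sL' := in_oc s sL.
  rewrite lee_fin normrM mulrC ler_pM ?KP//.
  move: sL; rewrite /= in_itv/= => /andP[s0 _].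
  rewrite ger0_norm ?powR_ge0// !powRN lef_pV2 ?posrE ?powR_gt0// ?addr_gt0//.
  apply: ge0_ler_powR; [exact: ltW|by rewrite nnegrE ltW| |by rewrite lerDl ltW].
  by rewrite nnegrE ltW ?addr_gt0.
have mD : measurable (`]0, L[%classic : set R) by [].
have [if_ _ lf] := @dominated_convergence _ _ R mu `]0, L[%classic mD f_ f G (fun n => mf_ n _) (mf _) f_f iG f_G.
split; first exact: if_.
suff : (\int[mu]_(s in `]0%R, L[) f s <= 0)%E.
  have fn : (\int[mu]_(s in `]0%R, L[) f s)%E \is a fin_num.
    exact: integrable_fin_num.
  by rewrite /Rintegral -lee_fin fineK.
rewrite -(cvg_lim _ lf)//; apply: lime_le; first by apply/cvg_ex; eexists; exact: lf.
near=> n.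
have := energy_shifted (e_gt0 n); rewrite /Rintegral.
rewrite (integral_itv_bndoo true false); last exact: mf_.
have fin : (\int[mu]_(s in `]0%R, L[) f_ n s)%E \is a fin_num.
  apply: integrable_fin_num => //; apply: (le_integrable _ _ _ iG) => //.
    exact: mf_.
  move=> s sL; rewrite [leRHS]gee0_abs ?lee_fin ?mulr_ge0 ?powR_ge0//.
  have sL' := in_oc s sL.
  rewrite normrM mulrC ler_pM ?KP//.
  move: sL; rewrite /= in_itv/= => /andP[s0 _].
  rewrite ger0_norm ?powR_ge0// !powRN lef_pV2 ?posrE ?powR_gt0// ?addr_gt0//.
  apply: ge0_ler_powR; [exact: ltW|by rewrite nnegrE ltW| |by rewrite lerDl ltW].
  by rewrite nnegrE ltW ?addr_gt0.
by rewrite -lee_fin fineK.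
Unshelve. all: by end_near. Qed.

(** Substitution [s = x - t]. Enlarging the range []0, x - a[] to the fixed []0, L[] costs nothing
    because [p i] vanishes to the left of [a]; the energy becomes a double integral over a
    rectangle. *)
Lemma vol_shift (i : nat) x : x \in `]a, b[ ->
  vol g a (p i) x = \int[mu]_(s in `]0, L[) (p i (x - s) * s `^ (- g)).
Proof.
rewrite in_itv/= => /andP[ax xb].
rewrite [RHS](Rintegral_reflect x); last 2 first.
- by [].
- apply: measurable_funM; last by apply: measurable_funTS; exact: measurable_powR.
  apply: measurable_funTS; apply: (measurableT_comp (f := p i)).
    by apply: continuous_measurable_fun; exact: (test1_continuous tp).
  exact: measurable_reflect.
rewrite /vol Rintegral_mkcond [RHS]Rintegral_mkcond; apply: eq_Rintegral => t _.
rewrite !patchE (_ : x - (x - t) = t); last by ring.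
case: ifPn => t1; case: ifPn => t2 //.
- move: t1; rewrite inE/= in_itv/= => /andP[at_ tx].
  by rewrite gtr0_norm ?subr_gt0.
- move: t1 t2; rewrite inE notin_setE/= !in_itv/= => /andP[at_ tx] /negP.
  by rewrite negb_and -!leNgt /L => /orP[|]; lra.
- move: t1 t2; rewrite inE notin_setE/= !in_itv/= => /negP + /andP[t0 tL].
  rewrite negb_and -!leNgt => t1.
  rewrite (tp.2) ?mul0r//; apply/negP => /andP[at_ _].
  by case/orP : t1; lra.
Qed.

(** After [vol_shift], Fubini on the rectangle integrates in [x] first and leaves the integral of
    [s ^ - g * autocorr 2 s]. *)
Lemma energy_vol : \int[mu]_(x in `]a, b[) (p 0%N x * vol g a (p 2%N) x) <= 0.
Proof.
have /andP[g0 g1] := g01; have g01' : 0 <= g < 1 by rewrite ltW.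
have L0 : 0 < L by rewrite subr_gt0.
have [M0 M00 M0p] := test1_bounded 0; have [M2 M20 M2p] := test1_bounded 2.
pose f (z : R * R) := p 0%N z.1 * (p 2%N (z.1 - z.2) * z.2 `^ (- g)).
pose E : set (R * R) := `]a, b[%classic `*` `]0, L[%classic.
have mE : measurable E by exact: measurableX.
have mp i : measurable_fun setT (p i).
  by apply: continuous_measurable_fun; exact: (test1_continuous tp).
have mf : measurable_fun setT f.
  apply: measurable_funM; first exact: measurableT_comp.
  apply: measurable_funM.
    by apply: (measurableT_comp (mp 2%N)); exact: measurable_funB.
  by apply: (measurableT_comp (measurable_powR (- g))).
have mfs s : measurable_fun setT (fun x => f (x, s)).
  by apply: (measurableT_comp mf); exact: measurable_pair2.
pose F := (EFin \o f) \_ E.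
have mF : measurable_fun setT F.
  apply/(measurable_restrictT _ _).1 => //.
  by apply: measurable_funTS; exact/measurable_EFinP.
pose Hx x := if x \in `]a, b[ then (fun s => (f (x, s))%:E) \_ `]0, L[ else cst 0%E.
have Fx x : (fun s => F (x, s)) = Hx x; rewrite ?/Hx.
  apply/funext => s; rewrite /F patchE; have [xab|xab] := boolP (x \in _).
    rewrite patchE; congr (if _ then _ else _).
    by apply/idP/idP; rewrite !inE/=; [case|split].
  by rewrite memNset//= => -[/= h _]; move/negP: xab; exact.
pose Hs s := if s \in `]0, L[ then (fun x => (f (x, s))%:E) \_ `]a, b[ else cst 0%E.
have Fs s : (fun x => F (x, s)) = Hs s; rewrite ?/Hs.
  apply/funext => x; rewrite /F patchE; have [xab|xab] := boolP (s \in _).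
    rewrite patchE; congr (if _ then _ else _).
    by apply/idP/idP; rewrite !inE/=; [case|split].
  by rewrite memNset//= => -[/= _ h]; move/negP: xab; exact.
have iF : (mu \x mu)%E.-integrable setT F.
  apply/integrable21ltyP => //.
  (* Up to the factor [s ^ - g], a bound of the integral in [x]: the suprema of [p 0] and [p 2]
     times the length of the interval. *)
  pose C := M0 * M2 * (b - a).
  have C0 : 0 <= C by rewrite !mulr_ge0// subr_ge0 ltW.
  apply: (@le_lt_trans _ _ (\int[mu]_(s in `]0%R, L[) (C * s `^ (- g))%:E)%E); last first.
    have iC : mu.-integrable `]0, L[ (fun s => (C * s `^ (- g))%:E).
      by apply: integrable_scale => //; exact: power_integrable.
    rewrite [ltLHS](_ : _ = \int[mu]_(s in `]0%R, L[) `|(C * s `^ (- g))%:E|)%E.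
      by case/integrableP : iC.
    by apply: eq_integral => s _; rewrite gee0_abs// lee_fin mulr_ge0// powR_ge0.
  have mH : measurable_fun setT (fubini_G mu (abse \o F)).
    apply: measurable_fun_fubini_tonelli_G; first exact: measurableT_comp.
    by move=> z; exact: abse_ge0.
  rewrite [leRHS]integral_mkcond; apply: ge0_le_integral => //.
  - by move=> s _; exact: integral_ge0.
  - apply/(measurable_restrictT _ _).1 => //; apply/measurable_EFinP.
    by apply: measurable_funM => //; apply: measurable_funTS; exact: measurable_powR.
  - move=> s _; rewrite [leLHS](_ : _ = \int[mu]_x `|Hs s x|)%E; last by rewrite -Fs.
    rewrite /Hs [leRHS]patchE; case: ifPn => sL; last first.
      rewrite memNset; last by move: sL => /negP.
      by rewrite integral0_eq// => x _; rewrite /= normr0.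
    rewrite mem_set//; have {sL} : 0 < s by move: sL; rewrite in_itv/= => /andP[].
    move=> s0.
    apply: (@le_trans _ _ (\int[mu]_(x in `]a, b[) (cst (M0 * M2 * s `^ (- g))%:E x))%E).
      rewrite [leRHS]integral_mkcond; apply: ge0_le_integral => //.
      + apply: measurableT_comp => //; apply/(measurable_restrictT _ _).1 => //.
        by apply: measurable_funTS; apply/measurable_EFinP; exact: mfs.
      + exact/(measurable_restrictT _ _).1.
      + move=> x _; rewrite !patchE; case: ifPn => _; last by rewrite abse0.
        rewrite /= lee_fin /f/= !normrM (ger0_norm (powR_ge0 _ _)) mulrA.
        by rewrite ler_wpM2r ?powR_ge0// ler_pM.
    have muab : @lebesgue_measure R `]a, b[ = (b - a)%:E.
      by rewrite lebesgue_measure_itv/= lte_fin ab EFinB.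
    rewrite [leLHS](_ : _ = (M0 * M2 * s `^ (- g) * (b - a))%:E).
      by rewrite lee_fin /C mulrAC.
    by rewrite integral_cst// [RHS]EFinM -muab.
have if1 x : mu.-integrable `]0, L[ (fun s => (p 2%N (x - s) * s `^ (- g))%:E).
  have iM : mu.-integrable `]0, L[ (fun s => (M2 * s `^ (- g))%:E).
    by apply: integrable_scale => //; exact: power_integrable.
  apply: (le_integrable _ _ _ iM) => //.
    apply/measurable_EFinP; apply: measurable_funTS; apply: measurable_funM => //.
    by apply: (measurableT_comp (mp 2%N)); exact: measurable_reflect.
  move=> s _; rewrite lee_fin !normrM [in leRHS]ger0_norm//.
  by rewrite ler_wpM2r.
have E1 : (\int[mu]_(x in `]a, b[) (p 0%N x * vol g a (p 2%N) x)%:E =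
    \int[mu]_x \int[mu]_s F (x, s))%E.
  rewrite integral_mkcond; apply: eq_integral => x _.
  rewrite [RHS](_ : _ = \int[mu]_s Hx x s)%E; last by rewrite -Fx.
  rewrite /Hx patchE; case: ifPn => xab.
    have xab' : x \in `]a, b[ by move: xab; rewrite inE.
    rewrite xab' -integral_mkcond vol_shift// -RintegralZl//; last exact: if1.
    rewrite /Rintegral fineK//; apply: integrable_fin_num => //.
    by apply: integrable_scale => //; exact: if1.
  rewrite ifN; last by move: xab; rewrite notin_setE/= => /negP.
  by rewrite integral0_eq.
have E2 : (\int[mu]_(s in `]0%R, L[) (s `^ (- g) * autocorr 2 s)%:E =
    \int[mu]_s \int[mu]_x F (x, s))%E.
  rewrite integral_mkcond; apply: eq_integral => s _.
  rewrite [RHS](_ : _ = \int[mu]_x Hs s x)%E; last by rewrite -Fs.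
  rewrite /Hs patchE; case: ifPn => sL.
    have sL' : s \in `]0, L[ by move: sL; rewrite inE.
    have ic : mu.-integrable `[a, b] (fun x => (p 0%N x * p 2%N (x - s))%:E).
      apply: integrable_continuous_cc => x; apply: cvgM.
        exact: (test1_continuous tp).
      exact: shift_continuous.
    rewrite sL' -integral_mkcond /autocorr -RintegralZl//.
    rewrite /Rintegral fineK; last first.
      by apply: integrable_fin_num => //; exact: integrable_scale.
    rewrite (integral_itv_bndoo true false); last first.
      have /integrableP[m1 _] : mu.-integrable `[a, b]
          (fun x => (s `^ (- g) * (p 0%N x * p 2%N (x - s)))%:E).
        exact: integrable_scale.
      apply: measurable_funS m1 => // x; rewrite /= !in_itv/= => /andP[? ?].
      by rewrite !ltW.
    by apply: eq_integral => x _; congr _%:E; rewrite /f/=; ring.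
  rewrite ifN; last by move: sL; rewrite notin_setE/= => /negP.
  by rewrite integral0_eq.
by rewrite /Rintegral E1 (Fubini iF) -E2; have [_] := energy_power.
Qed.
End vol.

(** The case [alpha = 2]: integration by parts gives minus the integral of the square of [p 1]. *)
Lemma energy_id : \int[mu]_(x in `]a, b[) (p 0%N x * p 2%N x) <= 0.
Proof.
have cM i j : continuous (fun x => p i x * p j x).
  by move=> x; apply: cvgM; exact: (test1_continuous tp).
have d : {in `[a, b], forall x : R,
    is_derive x 1 (fun x => p 0%N x * p 1%N x) (p 0%N x * p 2%N x + p 1%N x * p 1%N x)}.
  move=> x _; have d0 : is_derive x 1 (p 0%N) (p 1%N x) by exact: tp.1.
  have d1 : is_derive x 1 (p 1%N) (p 2%N x) by exact: tp.1.
  by apply: is_derive_eq; rewrite /GRing.scale/=; ring.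
have c : {in `[a, b], continuous (fun x => p 0%N x * p 2%N x + p 1%N x * p 1%N x)}.
  by move=> x _; apply: cvgD; exact: cM.
have [i1] := Rintegral_FTC ab d c.
rewrite (test1_a tp) (test1_b tp) !mul0r subrr => E.
have i02 := @integrable_continuous_cc _ a b (cM 0%N 2%N).
have i11 := @integrable_continuous_cc _ a b (cM 1%N 1%N).
move: E; rewrite RintegralD// => /eqP; rewrite addr_eq0 => /eqP E.
rewrite [leLHS](_ : _ = \int[mu]_(x in `[a, b]) (p 0%N x * p 2%N x)).
  by rewrite E oppr_le0; apply: Rintegral_ge0 => x _; rewrite -expr2 sqr_ge0.
congr fine; rewrite (integral_itv_bndoo true false)//.
by apply/measurable_EFinP; apply: measurable_funTS; exact: continuous_measurable_fun.
Qed.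
End energy.

(** * Lines parallel to an axis *)

Section chart.
Context {R : realType}.
Notation mu := (@lebesgue_measure R).
Notation leb n := (lebesgue_rV R n).

(* The chart sending (t, y) to the point with l-th coordinate [s * t] and other
   coordinates [y]; [s = -1] turns the operators based at the right end of a line
   into operators based at its left end. *)
Definition ins n (l : 'I_n.+1) (s : R) (p : R * 'rV[R]_n) : 'rV[R]_n.+1 :=
  \row_j (if unlift l j is Some k then p.2 0 k else s * p.1).

Definition del n (l : 'I_n.+1) (x : 'rV[R]_n.+1) : 'rV[R]_n :=
  \row_k x 0 (lift l k).

Lemma ins_l n (l : 'I_n.+1) s p : ins l s p 0 l = s * p.1.
Proof. by rewrite mxE unlift_none. Qed.

Lemma ins_lift n (l : 'I_n.+1) s p k : ins l s p 0 (lift l k) = p.2 0 k.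
Proof. by rewrite mxE liftK. Qed.

Lemma ins_del n (l : 'I_n.+1) s (x : 'rV[R]_n.+1) : s * s = 1 ->
  ins l s (s * x 0 l, del l x) = x.
Proof.
move=> ss; apply/rowP => j; rewrite mxE /=; case: unliftP => [k ->|->].
  by rewrite mxE.
by rewrite mulrA ss mul1r.
Qed.

Lemma rV_cons0 n (p : R * 'rV[R]_n) : rV_cons p 0 0 = p.1.
Proof.
have -> : (0 : 'I_n.+1) = lshift n (0 : 'I_1) by exact/val_inj.
by apply: etrans (row_mxEl _ _ 0 0) _; rewrite mxE.
Qed.

Lemma rV_consS n (p : R * 'rV[R]_n) k : rV_cons p 0 (lift 0 k) = p.2 0 k.
Proof.
have -> : lift (0 : 'I_n.+1) k = rshift 1 k by exact/val_inj.
exact: row_mxEr.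
Qed.

Lemma ins0 n (p : R * 'rV[R]_n) : ins 0 1 p = rV_cons p.
Proof.
apply/rowP => j; case: (unliftP 0 j) => [k ->|->].
  by rewrite ins_lift rV_consS.
by rewrite ins_l rV_cons0 mul1r.
Qed.

Lemma insS n (l : 'I_n.+1) (x t : R) (z : 'rV[R]_n) :
  ins (lift 0 l) 1 (t, rV_cons (x, z)) = rV_cons (x, ins l 1 (t, z)).
Proof.
apply/rowP => j; case: (unliftP (lift 0 l) j) => [k ->|->].
  rewrite ins_lift /=; case: (unliftP 0 k) => [k' ->|->].
    rewrite rV_consS /= (_ : lift _ (lift _ _) = lift 0 (lift l k')).
      by rewrite rV_consS /= ins_lift.
    by apply: val_inj; rewrite /= /bump !leq0n !add1n ltnS addnS.
  by rewrite rV_cons0 (_ : lift _ _ = 0) ?rV_cons0//; exact: val_inj.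
by rewrite ins_l /= rV_consS /= ins_l.
Qed.

Lemma measurable_ins n (l : 'I_n.+1) s : measurable_fun setT (ins l s).
Proof.
apply: measurable_fun_rV => j; case: (unliftP l j) => [k ->|->].
  under eq_fun do rewrite ins_lift.
  exact: (measurableT_comp (measurable_rV_coord k) measurable_snd).
under eq_fun do rewrite ins_l.
by apply: measurable_funM => //; exact: measurable_fst.
Qed.

Lemma integral_rV_cons n (f : 'rV[R]_n.+1 -> \bar R) : measurable_fun setT f ->
  (forall x, 0 <= f x)%E ->
  (\int[leb n.+1]_x f x = \int[mu \x leb n]_p (f \o @rV_cons R n) p)%E.
Proof.
move=> mf f0; transitivity (\int[pushforward (mu \x leb n)%E (@rV_cons R n)]_x f x)%E.
  by [].
rewrite ge0_integral_pushforward//; exact: measurable_rV_cons.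
Qed.

(** [lebesgue_rV] is built by prepending coordinates, so coordinate 0 splits off directly. For
    [l = lift 0 l'] the first coordinate is frozen, the induction hypothesis treats the others, and
    [insS] puts the first one back. *)
Lemma integral_ins1 n (l : 'I_n.+1) (f : 'rV[R]_n.+1 -> \bar R) :
  measurable_fun setT f -> (forall x, 0 <= f x)%E ->
  (\int[leb n.+1]_x f x = \int[leb n]_y \int[mu]_t f (ins l 1 (t, y)))%E.
Proof.
elim: n l f => [|n IH] l f mf f0.
  rewrite (integral_rV_cons mf f0).
  transitivity (\int[leb 0]_y \int[mu]_t (f \o @rV_cons R 0) (t, y))%E.
    apply: fubini_tonelli2; last by move=> x; exact: f0.
    by apply: measurableT_comp => //; exact: measurable_rV_cons.
  apply: eq_integral => y _; apply: eq_integral => t _.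
  by rewrite (_ : l = 0) ?ins0//; exact: ord1.
rewrite (integral_rV_cons mf f0).
have fc0 p : (0 <= (f \o @rV_cons R n.+1) p)%E by exact: f0.
have mfc : measurable_fun setT (f \o @rV_cons R n.+1).
  by apply: measurableT_comp => //; exact: measurable_rV_cons.
case: (unliftP 0 l) => [l' ->|->]; last first.
  transitivity (\int[leb n.+1]_y \int[mu]_t (f \o @rV_cons R n.+1) (t, y))%E.
    exact: fubini_tonelli2.
  by apply: eq_integral => y _; apply: eq_integral => t _; rewrite ins0.
transitivity (\int[mu]_x \int[leb n.+1]_y (f \o @rV_cons R n.+1) (x, y))%E.
  exact: fubini_tonelli1.
pose g (y : 'rV[R]_n.+1) := (\int[mu]_t f (ins (lift 0%R l') 1 (t, y)))%E.
have g0 y : (0 <= g y)%E by exact: integral_ge0.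
have mg : measurable_fun setT g.
  have : measurable_fun setT (fubini_G mu (f \o ins (lift 0%R l') 1)).
    apply: measurable_fun_fubini_tonelli_G; last by move=> p; exact: f0.
    by apply: measurableT_comp => //; exact: measurable_ins.
  exact.
have mgc : measurable_fun setT (g \o @rV_cons R n).
  by apply: measurableT_comp => //; exact: measurable_rV_cons.
have gc0 p : (0 <= (g \o @rV_cons R n) p)%E by exact: g0.
rewrite [RHS](integral_rV_cons mg g0).
transitivity (\int[mu]_x \int[leb n]_z (g \o @rV_cons R n) (x, z))%E; last first.
  exact/esym/fubini_tonelli1.
apply: eq_integral => x _.
transitivity (\int[leb n]_z \int[mu]_t f (rV_cons (x, ins l' 1 (t, z))))%E.
  apply: (IH l' (fun y => f (rV_cons (x, y)))) => //.
  by apply: (measurableT_comp mfc); exact: measurable_pair1.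
apply: eq_integral => z _; apply: eq_integral => t _.
by rewrite insS.
Qed.

Lemma integral_ins n (l : 'I_n.+1) (s : R) (f : 'rV[R]_n.+1 -> \bar R) :
  s = 1 \/ s = -1 -> measurable_fun setT f -> (forall x, 0 <= f x)%E ->
  (\int[leb n.+1]_x f x = \int[mu \x leb n]_p (f \o ins l s) p)%E.
Proof.
move=> s1 mf f0.
have mfi : measurable_fun setT (f \o ins l s).
  by apply: measurableT_comp => //; exact: measurable_ins.
have fi0 p : (0 <= (f \o ins l s) p)%E by exact: f0.
transitivity (\int[leb n]_y \int[mu]_t (f \o ins l s) (t, y))%E; last first.
  exact/esym/fubini_tonelli2.
rewrite (integral_ins1 l mf f0); apply: eq_integral => y _.
case: s1 => ->; first by [].
rewrite (ge0_integral_reflect 0)//.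
  apply: eq_integral => t _; congr f; apply/rowP => j; rewrite !mxE /=.
  by case: unlift => //; rewrite sub0r !mulN1r mul1r.
apply: measurableT_comp => //.
apply: (measurableT_comp (measurable_ins l 1)); exact: measurable_pair2.
Qed.

Lemma lebesgue_rV_ins n (l : 'I_n.+1) (s : R) (A : set 'rV[R]_n.+1) :
  s = 1 \/ s = -1 -> measurable A -> leb n.+1 A = (mu \x leb n)%E (ins l s @^-1` A).
Proof.
move=> s1 mA.
have mA' : measurable (ins l s @^-1` A).
  by rewrite -[X in measurable X]setTI; exact: measurable_ins.
transitivity (\int[leb n.+1]_x (\1_A x)%:E)%E; first by rewrite integral_indic// setIT.
rewrite (integral_ins l s1)//; last by apply/measurable_EFinP; exact: measurable_indic.
transitivity (\int[mu \x leb n]_p (\1_(ins l s @^-1` A) p)%:E)%E.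
  by apply: eq_integral => p _; rewrite /= !indicE.
by rewrite integral_indic// setIT.
Qed.

End chart.

Section transfer.
Context {R : realType}.
Notation mu := (@lebesgue_measure R).
Notation leb n := (lebesgue_rV R n).
Variables (n : nat) (l : 'I_n.+1) (s : R).
Hypothesis s1 : s = 1 \/ s = -1.

Lemma integrable_ins (f : 'rV[R]_n.+1 -> \bar R) :
  (leb n.+1).-integrable setT f -> (mu \x leb n)%E.-integrable setT (f \o ins l s).
Proof.
move=> /integrableP[mf fi]; apply/integrableP; split.
  by apply: measurableT_comp => //; exact: measurable_ins.
move: fi; rewrite (integral_ins l s1)//; exact: measurableT_comp.
Qed.

Lemma integral_lines (f : 'rV[R]_n.+1 -> \bar R) : (leb n.+1).-integrable setT f ->
  (\int[leb n.+1]_x f x = \int[leb n]_y \int[mu]_t f (ins l s (t, y)))%E.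
Proof.
move=> fi; have mf : measurable_fun setT f by case/integrableP: fi.
transitivity (\int[mu \x leb n]_p (f \o ins l s) p)%E.
  rewrite integralE [RHS]integralE.
  rewrite (integral_ins l s1)//; last exact: measurable_funepos.
  rewrite (integral_ins l s1)//; last exact: measurable_funeneg.
  by rewrite [in RHS]funepos_comp [in RHS]funeneg_comp.
by rewrite -integral21_prod_meas1//; exact: integrable_ins.
Qed.

Lemma ge0_integral_lines (f : 'rV[R]_n.+1 -> \bar R) : measurable_fun setT f ->
  (forall x, 0 <= f x)%E ->
  (\int[leb n.+1]_x f x = \int[leb n]_y \int[mu]_t f (ins l s (t, y)))%E.
Proof.
move=> mf f0; rewrite (integral_ins l s1 mf f0); apply: fubini_tonelli2.
  by apply: measurableT_comp => //; exact: measurable_ins.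
by move=> p; exact: f0.
Qed.

Lemma measurable_integral_line (f : 'rV[R]_n.+1 -> \bar R) : measurable_fun setT f ->
  (forall x, 0 <= f x)%E ->
  measurable_fun setT (fun y => \int[mu]_t f (ins l s (t, y)))%E.
Proof.
move=> mf f0; have : measurable_fun setT (fubini_G mu (f \o ins l s)).
  apply: measurable_fun_fubini_tonelli_G; last by move=> p; exact: f0.
  by apply: measurableT_comp => //; exact: measurable_ins.
exact.
Qed.

Lemma ae_integrable_line (f : 'rV[R]_n.+1 -> \bar R) :
  (leb n.+1).-integrable setT f ->
  {ae leb n, forall y, mu.-integrable setT (fun t => f (ins l s (t, y)))}.
Proof. by move=> /integrable_ins/ae_integrable2. Qed.

Lemma measure_lines (A : set 'rV[R]_n.+1) : measurable A ->
  (leb n.+1 A = \int[leb n]_y mu [set t | A (ins l s (t, y))])%E.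
Proof.
move=> mA; transitivity (\int[leb n.+1]_x (\1_A x)%:E)%E; first by rewrite integral_indic// setIT.
rewrite ge0_integral_lines//; last first.
  by apply/measurable_EFinP; exact: measurable_indic.
apply: eq_integral => y _.
transitivity (\int[mu]_t (\1_[set t | A (ins l s (t, y))] t)%:E)%E.
  by apply: eq_integral => t _; rewrite !indicE.
rewrite integral_indic ?setIT//.
have : measurable_fun setT (fun t : R => ins l s (t, y)).
  by apply: (measurableT_comp (measurable_ins l s)); exact: measurable_pair2.
by move=> /(_ measurableT A mA); rewrite setTI.
Qed.

Lemma measurable_measure_line (A : set 'rV[R]_n.+1) : measurable A ->
  measurable_fun setT (fun y => mu [set t | A (ins l s (t, y))]).
Proof.
move=> mA; have : measurable_fun setT (fun y => \int[mu]_t (\1_A (ins l s (t, y)))%:E)%E.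
  apply: (@measurable_integral_line (fun x => (\1_A x)%:E)) => //.
  by apply/measurable_EFinP; exact: measurable_indic.
rewrite (_ : (fun y => _) = (fun y => mu [set t | A (ins l s (t, y))]))//.
apply/funext => y.
transitivity (\int[mu]_t (\1_[set t | A (ins l s (t, y))] t)%:E)%E.
  by apply: eq_integral => t _; rewrite !indicE.
rewrite integral_indic ?setIT//.
have : measurable_fun setT (fun t : R => ins l s (t, y)).
  by apply: (measurableT_comp (measurable_ins l s)); exact: measurable_pair2.
by move=> /(_ measurableT A mA); rewrite setTI.
Qed.

Lemma ae_lines (Q : 'rV[R]_n.+1 -> Prop) : {ae leb n.+1, forall x, Q x} ->
  {ae leb n, forall y, {ae mu, forall t, Q (ins l s (t, y))}}.
Proof.
move=> [N [mN N0 QN]].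
have /(ae_eq_integral_abs _ measurableT) : (\int[leb n]_y `|mu [set t | N (ins l s (t, y))]| = 0)%E.
  by under eq_integral do rewrite gee0_abs//; rewrite -measure_lines.
move=> /(_ (measurable_measure_line mN)); apply: ae_impl => y /(_ I) /= h.
exists [set t | N (ins l s (t, y))]; split => //.
  have : measurable_fun setT (fun t : R => ins l s (t, y)).
    by apply: (measurableT_comp (measurable_ins l s)); exact: measurable_pair2.
  by move=> /(_ measurableT N mN); rewrite setTI.
by move=> t /= h'; apply: QN.
Qed.

(** Unlike in [ae_lines], the measurability of the exceptional set has to be given: Tonelli is what
    turns null sections into a null set. *)
Lemma lines_ae (Q : 'rV[R]_n.+1 -> Prop) : measurable [set x | ~ Q x] ->
  {ae leb n, forall y, {ae mu, forall t, Q (ins l s (t, y))}} ->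
  {ae leb n.+1, forall x, Q x}.
Proof.
move=> mQ h; exists [set x | ~ Q x]; split => //.
rewrite measure_lines//.
transitivity (\int[leb n]_y cst 0 y)%E; last by rewrite integral0.
apply: ae_eq_integral => //; first exact: measurable_measure_line.
apply: ae_impl h => y hy _; apply: measure_negligible; last exact: hy.
have : measurable_fun setT (fun t : R => ins l s (t, y)).
  by apply: (measurableT_comp (measurable_ins l s)); exact: measurable_pair2.
by move=> /(_ measurableT _ mQ); rewrite setTI.
Qed.

End transfer.

(** * Measurability and finite measure of bounded convex domains *)

Section open_rV.
Context {R : realType}.
Notation mu := (@lebesgue_measure R).
Notation leb n := (lebesgue_rV R n).

(** For [r > 0] this is the ball of the maximum norm, written as finitely many conditions on the
    coordinates, which generate the sigma-algebra. *)
Definition box n (c : 'rV[R]_n) (r : R) : set 'rV[R]_n :=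
  [set x | forall j, `|c 0 j - x 0 j| < r].

Lemma measurable_box n (c : 'rV[R]_n) r : measurable (box c r).
Proof.
rewrite (_ : box c r = \bigcap_(j in [set: 'I_n]) [set x | `|c 0 j - x 0 j| < r]); last first.
  by apply/seteqP; split=> x /= h j; [move=> _|]; exact: h.
apply: fin_bigcap_measurable => // j _.
have m : measurable_fun setT (fun x : 'rV[R]_n => `|c 0 j - x 0 j|).
  apply: measurableT_comp => //; apply: measurable_funB => //.
  exact: measurable_rV_coord.
have := measurable_fun_ltr m (measurable_cst r) => /(_ measurableT [set true]).
by rewrite setTI; exact.
Qed.

Lemma box_ball n (c : 'rV[R]_n) r : 0 < r -> ball c r = box c r.
Proof.
move=> r0; apply/seteqP; split=> x; first by move=> [_ h] j; exact: h.
by move=> h; split => // i j; rewrite (ord1 i); exact: h.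
Qed.

(** The sigma-algebra is defined from the coordinates and not from the topology: an open set is
    exhibited as a countable union of cubes with rational centres and radii [1 / (k + 1)]. *)
Lemma open_measurable_rV n (U : set 'rV[R]_n) : open U -> measurable U.
Proof.
move=> oU.
pose c (q : 'rV[rat]_n) : 'rV[R]_n := \row_j ratr (q 0 j).
pose B (qk : 'rV[rat]_n * nat) := ball (c qk.1) (qk.2.+1%:R^-1 : R).
pose F (i : nat) := if unpickle i is Some qk then
  (if `[< B qk `<=` U >] then B qk else set0) else set0.
rewrite (_ : U = \bigcup_i F i).
  apply: bigcupT_measurable => i; rewrite /F.
  case: unpickle => [qk|//]; case: ifPn => // _.
  by rewrite /B box_ball//; exact: measurable_box.
apply/seteqP; split=> x; last first.
  move=> [i _]; rewrite /F; case: unpickle => [qk|//].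
  by case: ifPn => // /asboolP BU /BU.
move=> Ux; have [e /= e0 xeU] := (nbhs_ballP _ _).1 (open_nbhs_nbhs (conj oU Ux)).
(* A cube of radius [1 / (k + 1)] whose centre is that close to [x] stays within [2 / (k + 1)] of
   [x]. *)
have [k ke] : exists k : nat, 2 * k.+1%:R^-1 < e.
  exists (Num.truncn (2 / e)); rewrite ltr_pdivrMr// mulrC -ltr_pdivrMr//.
  exact: truncnS_gt.
have k0 : 0 < k.+1%:R^-1 :> R by rewrite invr_gt0.
have hq j : exists q : rat, `|x 0 j - ratr q| < k.+1%:R^-1.
  have /rat_in_itvoo[q] : x 0 j - k.+1%:R^-1 < x 0 j by rewrite ltrBlDr ltrDl.
  rewrite in_itv/= => /andP[q1 q2]; exists q.
  by rewrite gtr0_norm ?subr_gt0// ltrBlDr addrC -ltrBlDr.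
have [q qP] := choice hq.
pose q' : 'rV[rat]_n := \row_j q j.
have xB : B (q', k) x.
  rewrite /B box_ball//= => j; rewrite !mxE distrC; exact: qP.
exists (pickle (q', k)) => //; rewrite /F pickleK ifT//.
apply/asboolP => y; rewrite {1}/B box_ball//= => By.
apply: xeU; rewrite box_ball// => j.
apply: lt_trans ke; rewrite (le_lt_trans (ler_distD (c q' 0 j) _ _))//.
rewrite [ltRHS]mulr_natl mulr2n ltrD//.
by rewrite !mxE; exact: qP.
Qed.

Lemma continuous_measurable_rV n (f : 'rV[R]_n -> R) : continuous f ->
  measurable_fun setT f.
Proof.
move=> /continuousP cf; apply: (measurability _ (RGenOpens.measurableE R)).
move=> _ [_ [a [b ->] <-]]; rewrite setTI; apply: open_measurable_rV.
exact/cf/interval_open.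
Qed.

Lemma leb_box_lty n (M : R) : (leb n (box 0 M) < +oo)%E.
Proof.
elim: n => [|n IH].
  (* In dimension 0 the measure is the Dirac mass at the only point. *)
  rewrite -[ltLHS]/(\d_(0 : 'rV[R]_0) (box 0 M)) diracE.
  exact: ltry.
have [M0|M0] := leP M 0.
  rewrite (_ : box 0 M = set0) ?measure0//.
  apply/seteqP; split=> x // /(_ 0) /(le_lt_trans (normr_ge0 _)).
  by rewrite ltNge M0.
rewrite (lebesgue_rV_ins (0 : 'I_n.+1) (or_introl erefl)); last exact: measurable_box.
rewrite (_ : _ @^-1` _ = `]-M, M[%classic `*` box 0 M).
  rewrite product_measure1E//; last exact: measurable_box.
  have muM : @lebesgue_measure R `]-M, M[ = (M + M)%:E.
    by rewrite lebesgue_measure_itv/= lte_fin gtrN// -EFinB opprK.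
  suff : ((M + M)%:E * leb n (box 0 M) < +oo)%E by rewrite -muM.
  by apply: lte_mul_pinfty => //; rewrite lee_fin addr_ge0 ?ltW.
apply/seteqP; split=> [[t y]|[t y]] /=; rewrite /box /=.
  move=> h; split.
    have := h 0; rewrite ins_l /= mul1r mxE sub0r normrN.
    by rewrite in_itv/= ltr_norml.
  by move=> j; have := h (lift 0 j); rewrite ins_lift !mxE.
move=> [ht hy] j; case: (unliftP 0 j) => [k ->|->].
  by rewrite ins_lift/=; have := hy k; rewrite !mxE.
by rewrite ins_l/= mul1r mxE sub0r normrN; move: ht; rewrite in_itv/= ltr_norml.
Qed.

Lemma leb_bounded_lty n (A : set 'rV[R]_n) : measurable A -> bounded_set A ->
  (leb n A < +oo)%E.
Proof.
move=> mA [M [Mr AM]]; apply: (le_lt_trans _ (leb_box_lty n (`|M| + 2))).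
apply: le_measure; rewrite ?inE//; first exact: measurable_box.
move=> x Ax; have : `|x| < `|M| + 2.
  apply: (@le_lt_trans _ _ (`|M| + 1)); last by rewrite ltrD2l ltr1n.
  by apply: AM => //; rewrite (le_lt_trans (ler_norm _))// ltrDl.
move=> xM; have : ball (0 : 'rV[R]_n) (`|M| + 2) x.
  by rewrite -ball_normE /ball_/= sub0r normrN.
by rewrite box_ball//; rewrite ltr_wpDl.
Qed.

End open_rV.

Section convex.
Context {R : realType} (n : nat) (Om : set 'rV[R]_n).
Hypothesis hOm : bounded_convex_domain Om.

Lemma domain_open : open Om. Proof. by case: hOm. Qed.

Lemma domain_measurable : measurable Om.
Proof. apply: open_measurable_rV; exact: domain_open. Qed.

Lemma domain_lty : (lebesgue_rV R n Om < +oo)%E.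
Proof. by apply: leb_bounded_lty; [exact: domain_measurable|case: hOm]. Qed.

Lemma domain_conv x z (k : R) : Om x -> Om z -> 0 <= k <= 1 ->
  Om (k *: x + (1 - k) *: z).
Proof.
move=> Ox Oz /andP[k0 k1]; case: hOm => _ _ _ cv.
have := cv x z (Itv01 k0 k1); rewrite !inE => /(_ Ox Oz).
by rewrite /conv.
Qed.

(** A point [z'] of [Om] near [z] takes its place; the error [z - z'] is moved onto [x] with the
    factor [(1 - k) / k] and absorbed by the ball of radius [r] around [x], since
    [|z - z'| < r * k]. *)
Lemma domain_segment x z (k : R) : Om x -> closure Om z -> 0 < k <= 1 ->
  Om (k *: x + (1 - k) *: z).
Proof.
move=> Ox cz /andP[k0 k1].
have [r /= r0 xr] := (nbhs_ballP _ _).1 (open_nbhs_nbhs (conj domain_open Ox)).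
have [z' [Oz']] := cz _ (nbhsx_ballx z (r * k) (mulr_gt0 r0 k0)).
rewrite -ball_normE /ball_/= => zz'.
have -> : k *: x + (1 - k) *: z =
    k *: (x + ((1 - k) / k) *: (z - z')) + (1 - k) *: z'.
  rewrite scalerDr scalerA mulrCA divff ?gt_eqF// mulr1 -addrA -scalerDr.
  by rewrite subrK.
apply: domain_conv => //; last by rewrite ltW.
apply: xr; rewrite -ball_normE /ball_/= opprD addNKr normrN normrZ.
rewrite ger0_norm ?divr_ge0 ?subr_ge0// ?ltW//.
rewrite mulrAC ltr_pdivrMr//; apply: le_lt_trans zz'.
by rewrite -[leRHS]mul1r ler_wpM2r// gerBl ltW.
Qed.

End convex.

(** * Sections of a convex domain *)

Section line.
Context {R : realType} (n : nat) (l : 'I_n.+1) (s : R).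
Hypothesis s1 : s = 1 \/ s = -1.
Implicit Types (y : 'rV[R]_n).

Lemma sign_sq : s * s = 1.
Proof. by case: s1 => ->; rewrite ?mulr1// mulrNN mulr1. Qed.

Definition line y t := ins l s (t, y).

Lemma line_move y (t t' : R) : line y t' = line y t + (s * (t' - t)) *: basis_vec R l.
Proof.
apply/rowP => j; rewrite /line !mxE eqxx /=.
case: unliftP => [k ->|->].
  by rewrite eq_sym (negbTE (neq_lift _ _)) mulr0 addr0.
by rewrite eqxx mulr1; ring.
Qed.

Lemma line_continuous y : continuous (line y).
Proof.
move=> t; rewrite (_ : line y = fun t' => line y t + (s * (t' - t)) *: basis_vec R l).
  apply: cvgD; first exact: cvg_cst.
  apply: cvgZr_tmp; apply: cvgMl_tmp; apply: cvgB; [exact: cvg_id|exact: cvg_cst].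
by apply/funext => t'; exact: line_move.
Qed.

Lemma line_conv y (k t t' : R) :
  line y (k * t + (1 - k) * t') = k *: line y t + (1 - k) *: line y t'.
Proof. by apply/rowP => j; rewrite /line !mxE; case: unlift => [i|]/=; ring. Qed.

Lemma set_coord_line y (t x : R) : set_coord l (line y t) x = line y (s * x).
Proof.
apply/rowP => j; rewrite /line !mxE; case: unliftP => [k ->|->].
  by rewrite eq_sym (negbTE (neq_lift _ _)).
by rewrite eqxx/= mulrA sign_sq mul1r.
Qed.

Lemma line_coord y (t : R) : line y t 0 l = s * t.
Proof. exact: ins_l. Qed.

Lemma del_line y t : del l (line y t) = y.
Proof. by apply/rowP => j; rewrite mxE ins_lift. Qed.

Lemma lineK (x : 'rV[R]_n.+1) : line (del l x) (s * x 0 l) = x.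
Proof. exact/ins_del/sign_sq. Qed.

Variable Om : set 'rV[R]_n.+1.
Hypothesis hOm : bounded_convex_domain Om.

Definition sec y : set R := [set t | Om (line y t)].
(* [inf] and [sup] of the empty set are 0, so that `]lo y, hi y[ is also correct
   for the lines that miss the domain. *)
Definition lo y := inf (sec y).
Definition hi y := sup (sec y).

Lemma sec_bounded : exists M : R, forall y t, sec y t -> `|t| <= M.
Proof.
case: hOm => _ _ [M [Mr OM]] _; exists (M + 1) => y t Ot.
have := OM (M + 1); rewrite ltrDl ltr01 => /(_ isT _ Ot) /=; apply: le_trans.
have -> : `|t| = `|line y t 0 l|.
  by rewrite line_coord normrM; case: s1 => ->; rewrite ?normrN normr1 mul1r.
rewrite /Num.norm/= mx_normrE.
by apply/bigmax_geP; right; exists (0, l).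
Qed.

Lemma sec_has_lbound y : has_lbound (sec y).
Proof.
have [M hM] := sec_bounded; exists (- M) => t /hM.
by rewrite ler_norml => /andP[].
Qed.

Lemma sec_has_ubound y : has_ubound (sec y).
Proof.
have [M hM] := sec_bounded; exists M => t /hM.
by rewrite ler_norml => /andP[].
Qed.

Lemma sec_interval y : is_interval (sec y).
Proof.
move=> u v Ou Ov z /andP[uz zv].
have [uv|uv] := eqVneq u v; first by have -> : z = u by lra.
have uv0 : 0 < v - u by rewrite subr_gt0 lt_neqAle uv (le_trans uz).
have -> : z = (v - z) / (v - u) * u + (1 - (v - z) / (v - u)) * v.
  by field; rewrite gt_eqF.
rewrite /sec/= line_conv; apply: domain_conv => //.
apply/andP; split; first by apply: divr_ge0; [rewrite subr_ge0|exact: ltW].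
by rewrite ler_pdivrMr// mul1r lerB.
Qed.

Lemma secE y : sec y = `]lo y, hi y[%classic.
Proof.
have osec : open (sec y).
  have /continuousP := @line_continuous y; apply; exact: domain_open hOm.
have -> : sec y = (sec y)^° by apply/esym; move: osec; rewrite interior_id.
rewrite (interval_bounded_interior (@sec_interval y) (@sec_has_lbound y) (@sec_has_ubound y)).
by apply/seteqP; split => t /=; rewrite in_itv.
Qed.

End line.

Section reflect.
Context {R : realType}.
Notation mu := (@lebesgue_measure R).

Lemma integrable_reflect (c : R) (A : set R) (f : R -> R) : measurable A ->
  mu.-integrable A (EFin \o f) ->
  mu.-integrable [set x | A (c - x)] (EFin \o (fun x => f (c - x))).
Proof.
move=> mA /integrableP[mf fi].
have mA' : measurable [set x | A (c - x)].
  by have := measurable_reflect c measurableT mA; rewrite setTI.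
apply/integrableP; split.
  apply: (@measurable_comp _ _ _ _ _ _ A) mf _ => //; first by move=> _ [x Ax <-].
  apply: (measurable_funS measurableT) => //; exact: measurable_reflect.
move: fi; rewrite (@ge0_integral_reflect _ c)//; exact: measurableT_comp.
Qed.

Lemma integrable_sign (s : R) (A : set R) (f : R -> R) : s = 1 \/ s = -1 ->
  measurable A -> mu.-integrable A (EFin \o f) ->
  mu.-integrable [set t | A (s * t)] (EFin \o (fun t => f (s * t))).
Proof.
case=> -> mA fi.
  have -> : [set t | A (1 * t)] = A by under eq_set do rewrite mul1r.
  by rewrite (_ : (fun t => f (1 * t)) = f)//; apply/funext => t; rewrite mul1r.
have := integrable_reflect 0 mA fi.
rewrite (_ : (fun x => f (0 - x)) = (fun t => f (-1 * t))); last first.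
  by apply/funext => t; rewrite mulN1r sub0r.
by under eq_set do rewrite sub0r -mulN1r.
Qed.

Lemma Rintegral_sign (s : R) (A : set R) (f : R -> R) : s = 1 \/ s = -1 ->
  measurable A -> measurable_fun A f ->
  \int[mu]_(t in A) f t = \int[mu]_(t in [set t | A (s * t)]) f (s * t).
Proof.
case=> -> mA mf.
  have -> : [set t | A (1 * t)] = A by under eq_set do rewrite mul1r.
  by apply: eq_Rintegral => t _; rewrite mul1r.
rewrite (Rintegral_reflect 0)//.
have -> : [set x | A (0 - x)] = [set t | A (-1 * t)].
  by under eq_set do rewrite sub0r -mulN1r.
by apply: eq_Rintegral => t _; rewrite mulN1r sub0r.
Qed.

End reflect.

Section ray.
Context {R : realType} (n : nat) (l : 'I_n.+1) (sg : side).

Definition sgn : R := if sg is Plus then 1 else -1.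

Lemma sgnP : sgn = 1 \/ sgn = -1.
Proof. by rewrite /sgn; case: sg; [left|right]. Qed.

Variable Om : set 'rV[R]_n.+1.
Hypothesis hOm : bounded_convex_domain Om.
Let s1 := sgnP.
Notation lin := (line l sgn).
Notation sc := (sec l sgn Om).
Notation lw := (lo l sgn Om).

(** [XL] is an infimum over the closure of [Om], [lo] one over [Om]. A closure point below [lo]
    would, by [domain_segment], put [lo] itself into the section, which is an open interval. *)
Lemma line_closure_lo y t t' : sc y t -> closure Om (lin y t') -> lw y <= t'.
Proof.
move=> Ot ct; rewrite leNgt; apply/negP => lt'.
have tlo : lw y < t by move: Ot; rewrite secE// => /= /itvP ->.
pose k := (lw y - t') / (t - t').
have tt0 : 0 < t - t' by lra.
have k01 : 0 < k <= 1.
  apply/andP; split; first by apply: divr_gt0 => //; lra.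
  by rewrite /k ler_pdivrMr// mul1r; lra.
have := domain_segment hOm Ot ct k01; rewrite -line_conv.
have -> : k * t + (1 - k) * t' = lw y by rewrite /k; field; rewrite gt_eqF.
move=> O; have : sc y (lw y) by [].
by rewrite secE//= in_itv/= ltxx.
Qed.

Lemma inf_closure y t : sc y t -> inf [set t' | closure Om (lin y t')] = lw y.
Proof.
move=> Ot; have lb : lbound [set t' | closure Om (lin y t')] (lw y).
  by move=> t'; exact: line_closure_lo Ot.
have sub t' : sc y t' -> closure Om (lin y t') by move=> ?; exact: subset_closure.
apply/eqP; rewrite eq_le; apply/andP; split.
  apply: lb_le_inf; first by exists t.
  by move=> t' /sub ct'; apply: (ge_inf _ ct'); exists (lw y).
by apply: lb_le_inf => //; exists t; exact: sub.
Qed.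

(** The two kinds of operators merge here: in the chart coordinate both rays are the part of the
    section that precedes [t]. *)
Lemma rayE y t : sc y t ->
  [set t' | ray Om sg l (lin y t) (sgn * t')] = `]lw y, t[%classic.
Proof.
move=> Ot; have := inf_closure Ot.
have lcE : line_coords Om l (lin y t) = [set x | closure Om (lin y (sgn * x))].
  by rewrite /line_coords; apply/seteqP; split=> x /=; rewrite (set_coord_line _ s1).
rewrite /ray /XL /XR lcE line_coord /sgn; case: sg => /=.
  move=> infE; have -> : [set x | closure Om (line l 1 y (1 * x))] =
      [set t' | closure Om (line l 1 y t')].
    by apply/seteqP; split=> x /=; rewrite mul1r.
  by rewrite infE mul1r; under eq_set do rewrite mul1r; apply/seteqP; split.
(* By definition [inf] is the opposite of the [sup] of the opposite set, which identifies the
   supremum in [XR] with [- lo]. *)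
rewrite /inf => infE; have -> : [set x | closure Om (line l (-1) y (-1 * x))] =
    [set - x | x in [set t' | closure Om (line l (-1) y t')]].
  apply/seteqP; split => x /=.
    by rewrite mulN1r => h; exists (- x); [exact: h|exact: opprK].
  by move=> [x' h <-]; rewrite mulN1r opprK.
rewrite (_ : sup _ = - lo l (-1) Om y); last by rewrite -infE opprK.
by apply/seteqP; split => x /=; rewrite !in_itv/= !mulN1r !ltrN2 andbC.
Qed.

Lemma measurable_ray x : measurable (ray Om sg l x).
Proof. by rewrite /ray; case: sg. Qed.

Lemma frac_integrand_line (alpha : R) v y t t' :
  frac_integrand l alpha v (lin y t) (sgn * t') =
  v (lin y t') * `|t - t'| `^ (- (alpha - 1)).
Proof.
rewrite /frac_integrand (set_coord_line _ s1) mulrA sign_sq// mul1r line_coord.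
rewrite -mulrBr normrM powRN (_ : `|sgn| = 1) ?mul1r//.
by case: s1 => ->; rewrite ?normrN normr1.
Qed.

Lemma frac_integral_line (alpha : R) v y t : sc y t ->
  measurable_fun (ray Om sg l (lin y t)) (frac_integrand l alpha v (lin y t)) ->
  frac_integral Om sg l alpha v (lin y t) =
  (Gamma (2 - alpha))^-1 * vol (alpha - 1) (lw y) (fun t' => v (lin y t')) t.
Proof.
move=> Ot mf; congr (_ * _).
rewrite (Rintegral_sign s1 (measurable_ray _) mf) (rayE Ot).
by apply: eq_Rintegral => t' _; rewrite frac_integrand_line.
Qed.

Lemma frac_integrable_line (alpha : R) v y t : sc y t ->
  lebesgue_measure.-integrable (ray Om sg l (lin y t))
    (fun xi => (frac_integrand l alpha v (lin y t) xi)%:E) ->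
  lebesgue_measure.-integrable `]lw y, t[%classic
    (fun t' => (v (lin y t') * `|t - t'| `^ (- (alpha - 1)))%:E).
Proof.
move=> Ot /(integrable_sign s1 (measurable_ray _)); rewrite (rayE Ot).
by apply: eq_integrable => // t' _ /=; rewrite frac_integrand_line.
Qed.

End ray.

(** * Derivatives and boundary values along lines *)

Section directional.
Context {R : realType}.

Lemma is_derive_along n (v : 'rV[R]_n -> R) (x e : 'rV[R]_n) d :
  is_derive x e v d <-> is_derive (0 : R) 1 (fun r : R => v (r *: e + x)) d.
Proof.
have E : (fun h : R => h^-1 *: ((v \o shift x) (h *: e) - v x)) =
    (fun h : R => h^-1 *: (((fun r : R => v (r *: e + x)) \o shift 0) (h *: 1) -
      v (0 *: e + x))).
  apply/funext => h /=; rewrite scale0r add0r addr0.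
  by rewrite /GRing.scale/= mulr1.
by split=> -[]; rewrite /derivable /derive => h1 h2; split;
  rewrite /derivable /derive; move: h1 h2; rewrite E.
Qed.

Variables (n : nat) (l : 'I_n.+1) (s : R).
Hypothesis s1 : s = 1 \/ s = -1.
Implicit Types (v : 'rV[R]_n.+1 -> R) (y : 'rV[R]_n).

Lemma is_derive_line v y (t d : R) :
  is_derive (line l s y t) (basis_vec R l) v d ->
  is_derive t 1 (fun t' => v (line l s y t')) (s * d).
Proof.
move=> /is_derive_along vd.
pose f (r : R) := v (r *: basis_vec R l + line l s y t).
have dg : is_derive t 1 (fun t' : R => s * (t' - t)) s.
  by apply: is_derive_eq; rewrite /GRing.scale/=; ring.
have df : is_derive (s * (t - t)) 1 f d by rewrite subrr mulr0.
have := @is_derive1_comp R f (fun t' => s * (t' - t)) t d s df dg.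
rewrite mulrC (_ : f \o _ = (fun t' => v (line l s y t')))//.
by apply/funext => t' /=; rewrite /f (line_move _ _ _ t t') addrC.
Qed.

Lemma line_is_derive v y (t d : R) :
  is_derive t 1 (fun t' => v (line l s y t')) d ->
  is_derive (line l s y t) (basis_vec R l) v (s * d).
Proof.
move=> vd; apply/is_derive_along.
have dg : is_derive (0 : R) 1 (fun r : R => t + s * r) s.
  by apply: is_derive_eq; rewrite /GRing.scale/=; ring.
have df : is_derive (t + s * 0) 1 (fun t' => v (line l s y t')) d.
  by rewrite mulr0 addr0.
have := @is_derive1_comp R (fun t' => v (line l s y t')) (fun r => t + s * r) 0 d s df dg.
rewrite mulrC (_ : _ \o _ = (fun r => v (r *: basis_vec R l + line l s y t)))//.
apply/funext => r /=; congr v.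
by rewrite (line_move _ _ _ t) addrC [t + _]addrC addrK mulrA sign_sq// mul1r.
Qed.

Lemma partial_line v y (t d : R) :
  is_derive t 1 (fun t' => v (line l s y t')) d -> partial l v (line l s y t) = s * d.
Proof. by move=> /line_is_derive dv; rewrite /partial derive_val. Qed.

Lemma derivable_line v y (t : R) : derivable v (line l s y t) (basis_vec R l) ->
  is_derive t 1 (fun t' => v (line l s y t')) (s * partial l v (line l s y t)).
Proof. by move=> vd; apply: is_derive_line; apply: DeriveDef. Qed.

Variable Om : set 'rV[R]_n.+1.

(** A first derivative along the chart carries the factor [s], a second one [s * s = 1]. For
    [s = -1] the chart runs backwards and [t2] becomes the starting point. *)
Lemma twice_diff_line v y (t1 t2 : R) : twice_diff_along Om l v ->
  sec l s Om y t1 -> sec l s Om y t2 -> t1 <= t2 ->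
  lebesgue_measure.-integrable `[t1, t2]%classic
    (EFin \o (fun t => partial2 l v (line l s y t))) /\
  s * partial l v (line l s y t2) - s * partial l v (line l s y t1) =
  \int[lebesgue_measure]_(t in `[t1, t2]) partial2 l v (line l s y t).
Proof.
move=> [_ tv] O1 O2 t12; move: tv.
move: (partial2 l v) (partial l v) => G p tv.
have refl c : [set x | `[0, t2 - t1]%classic (c - x)] = `[c - (t2 - t1), c]%classic.
  by apply/seteqP; split=> x /=; rewrite !in_itv/=; lra.
case: s1 => se; last first.
  have h0 : 0 <= t2 - t1 by lra.
  have e21 : line l s y t1 = line l s y t2 + (t2 - t1) *: basis_vec R l.
    by rewrite (line_move _ _ _ t2) se; congr (_ + _ *: _); ring.
  have := tv (line l s y t2) (t2 - t1) h0 O2; rewrite -e21 => /(_ O1)[iG eG].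
  have E : (fun x => G (line l s y t2 + (t2 - x) *: basis_vec R l)) =
      (fun t => G (line l s y t)).
    by apply/funext => t; rewrite (line_move _ _ _ t2 t) se mulN1r opprB.
  have mc : measurable `[0, t2 - t1]%classic by exact: measurable_itv.
  have := integrable_reflect t2 mc iG; rewrite refl E subKr => iG'; split => //.
  have -> (i j : R) : s * i - s * j = j - i by rewrite se; ring.
  rewrite eG (Rintegral_reflect t2)//; last first.
    by apply/measurable_EFinP; case/integrableP: iG.
  by rewrite refl E subKr.
have h0 : 0 <= t2 - t1 by lra.
have e21 : line l s y t2 = line l s y t1 + (t2 - t1) *: basis_vec R l.
  by rewrite (line_move _ _ _ t1) se; congr (_ + _ *: _); ring.
have := tv (line l s y t1) (t2 - t1) h0 O1; rewrite -e21 => /(_ O2)[iG eG].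
have mc : measurable `[0, t2 - t1]%classic by exact: measurable_itv.
(* The translation by [t1] is obtained from two successive reflections. *)
have := integrable_reflect (t2 - t1) mc iG; rewrite refl subrr => iG1.
have := integrable_reflect t2 mc iG1; rewrite refl subKr.
have E : (fun x => G (line l s y t1 + (t2 - t1 - (t2 - x)) *: basis_vec R l)) =
    (fun t => G (line l s y t)).
  apply/funext => t; rewrite (line_move _ _ _ t1 t) se mul1r.
  by rewrite (_ : t2 - t1 - (t2 - t) = t - t1); last by ring.
rewrite E => iG'; split => //.
have -> (i j : R) : s * i - s * j = i - j by rewrite se; ring.
rewrite eG (Rintegral_reflect (t2 - t1))//; last first.
  by apply/measurable_EFinP; case/integrableP: iG.
rewrite refl subrr (Rintegral_reflect t2)//; last first.
  by apply/measurable_EFinP; case/integrableP: iG1.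
by rewrite refl subKr E.
Qed.

Hypothesis hOm : bounded_convex_domain Om.

Lemma frontier_lo y : lo l s Om y < hi l s Om y ->
  frontier Om (line l s y (lo l s Om y)).
Proof.
move=> ab; split.
  move=> B /(@line_continuous _ _ l s y) /= nB.
  have [t [Bt /= tab]] : exists t, B (line l s y t) /\ lo l s Om y < t < hi l s Om y.
    have : \forall t \near (lo l s Om y)^'+, B (line l s y t) /\ lo l s Om y < t < hi l s Om y.
      near=> t; split; first by near: t; apply: cvg_at_right_filter nB; exact: cvg_id.
      by apply/andP; split => //; near: t; exact: nbhs_right_lt.
    exact: (@filter_ex _ _ (at_right_proper_filter _)).
  exists (line l s y t); split => //.
  by have : sec l s Om y t by rewrite secE//= in_itv.
move=> /interior_subset O; have : sec l s Om y (lo l s Om y) by [].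
by rewrite secE//= in_itv/= ltxx.
Unshelve. all: by end_near. Qed.

(** On the line the distance to the end point is [t - a] times the norm of [basis_vec], so the
    gradient condition there yields the second limit; multiplication by [t - a] then yields the
    first. *)
Lemma boundary_line (e : 'rV[R]_n.+1 -> R) y :
  (forall x, frontier Om x -> e x = 0) -> zero_gradient_on_frontier Om e ->
  lo l s Om y < hi l s Om y ->
  e (line l s y t) @[t --> (lo l s Om y)^'+] --> 0 /\
  (e (line l s y t) / (t - lo l s Om y)) @[t --> (lo l s Om y)^'+] --> 0.
Proof.
move=> e0 ze ab; set a := lo l s Om y; set b := hi l s Om y.
have fz := frontier_lo ab; have := ze _ fz; rewrite (e0 _ fz).
set z := line l s y _ => /cvgrPdist_lt hz.
have c0 : 0 < `|basis_vec R l|.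
  rewrite normr_gt0; apply/eqP => /rowP /(_ l); rewrite !mxE !eqxx => /eqP.
  by rewrite oner_eq0.
have e1 : (e (line l s y t) / (t - a)) @[t --> a^'+] --> 0.
  apply/cvgrPdist_lt => eps eps0.
  have := hz (eps / `|basis_vec R l|); rewrite divr_gt0// => /(_ isT) /= nB.
  have nB' : \forall t \near a, line l s y t != z -> closure Om (line l s y t) ->
     `|0 - (e (line l s y t) - 0) / `|line l s y t - z| | < eps / `|basis_vec R l|.
    have nB2 : nbhs z (fun x => x != z -> closure Om x ->
        `|0 - (e x - 0) / `|x - z| | < eps / `|basis_vec R l|) by exact: nB.
    exact: (@line_continuous _ _ l s y a _ nB2).
  near=> t.
  have ta : a < t by [].
  have Ot : Om (line l s y t).
    have : sec l s Om y t.
      by rewrite secE//= in_itv/= ta/=; near: t; exact: nbhs_right_lt.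
    by [].
  have dz : line l s y t - z = (s * (t - a)) *: basis_vec R l.
    by rewrite (line_move _ _ _ a) addrC addKr.
  have ns : `|s| = 1 by case: s1 => ->; rewrite ?normrN normr1.
  have ta0 : 0 < t - a by rewrite subr_gt0.
  have tz : line l s y t != z.
    rewrite -subr_eq0 dz scaler_eq0 negb_or -normr_gt0 normrM ns mul1r.
    by rewrite (gtr0_norm ta0) ta0/= -normr_gt0.
  have : line l s y t != z -> closure Om (line l s y t) ->
     `|0 - (e (line l s y t) - 0) / `|line l s y t - z| | < eps / `|basis_vec R l|.
    by near: t; apply: cvg_at_right_filter nB'; exact: cvg_id.
  move=> /(_ tz (subset_closure Ot)).
  rewrite dz normrZ normrM ns mul1r (gtr0_norm ta0) subr0 !sub0r !normrN.
  rewrite invfM mulrA normrM [X in _ * X](gtr0_norm _) ?invr_gt0//.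
  by rewrite ltr_pdivlMr// mulfVK ?gt_eqF.
split => //.
have : (e (line l s y t) / (t - a) * (t - a)) @[t --> a^'+] --> 0 * (a - a).
  apply: cvgM => //; apply: cvg_at_right_filter.
  by apply: cvgB; [exact: cvg_id|exact: cvg_cst].
rewrite mul0r; apply: cvg_trans; apply: near_eq_cvg; near=> t.
by rewrite divfK// subr_eq0 gt_eqF.
Unshelve. all: by end_near. Qed.

End directional.

(** * Square integrable functions and test functions *)

Section L2.
Context d (T : measurableType d) (R : realType) (m : {measure set T -> \bar R}).
Variable D : set T.
Hypothesis mD : measurable D.
Implicit Types u v : T -> R.

(** [L2 Om] is by conversion the instance at [lebesgue_rV] and [Om], so the results of this section
    apply to it directly. *)
Definition sq_integrable u :=
  measurable_fun D u /\ m.-integrable D (fun x => (u x ^+ 2)%:E).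

Lemma young (k a b : R) : 0 < k -> `|a * b| <= (k * a ^+ 2 + k^-1 * b ^+ 2) / 2.
Proof.
move=> k0; have kV : 0 < k^-1 by rewrite invr_gt0.
have kk : k * k^-1 = 1 by rewrite divff// gt_eqF.
have sq := sqr_ge0 (k * `|a| - `|b|).
have -> : k * a ^+ 2 + k^-1 * b ^+ 2 = k^-1 * (k * `|a| - `|b|) ^+ 2 + 2 * `|a * b|.
  rewrite normrM -[a ^+ 2]real_normK ?num_real// -[b ^+ 2]real_normK ?num_real//.
  by field; rewrite gt_eqF.
by have := mulr_ge0 (ltW kV) sq; lra.
Qed.

Lemma sq_integrableM u v : sq_integrable u -> sq_integrable v ->
  m.-integrable D (fun x => (u x * v x)%:E).
Proof.
move=> [mu iu] [mv iv].
apply: (le_integrable mD _ _ (integrable_addR mD iu iv)).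
  by apply/measurable_EFinP; exact: measurable_funM.
move=> x _ /=; rewrite lee_fin (le_trans (young _ _ ltr01))// invr1 !mul1r.
rewrite [leRHS]ger0_norm ?addr_ge0 ?sqr_ge0//.
have := sqr_ge0 (u x); have := sqr_ge0 (v x); lra.
Qed.

Lemma sq_integrableZ c u : sq_integrable u -> sq_integrable (fun x => c * u x).
Proof.
move=> [mu iu]; split; first exact: measurable_funM.
have := integrable_scale (c ^+ 2) mD iu.
by apply: eq_integrable => // x _ /=; rewrite exprMn.
Qed.

Lemma sq_integrableD u v : sq_integrable u -> sq_integrable v ->
  sq_integrable (fun x => u x + v x).
Proof.
move=> hu hv; have [mu iu] := hu; have [mv iv] := hv.
split; first exact: measurable_funD.
have i1 := integrable_addR mD iu iv.
have i2 := integrable_scale 2 mD (sq_integrableM hu hv).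
have := integrable_addR mD i1 i2.
by apply: eq_integrable => // x _ /=; congr EFin; ring.
Qed.

Lemma sq_integrableB u v : sq_integrable u -> sq_integrable v ->
  sq_integrable (fun x => u x - v x).
Proof.
move=> hu /(sq_integrableZ (-1)) hv; have := sq_integrableD hu hv.
by under eq_fun do rewrite mulN1r.
Qed.

(** Takes the place of the Cauchy-Schwarz inequality: with [k] of the order of the norm of [v], a
    small [v] makes the bound small. *)
Lemma Rintegral_young (k : R) u v : 0 < k -> sq_integrable u -> sq_integrable v ->
  `|\int[m]_(x in D) (u x * v x)| <=
  (k * \int[m]_(x in D) (u x * u x) + k^-1 * \int[m]_(x in D) (v x * v x)) / 2.
Proof.
move=> k0 hu hv; have iuv := sq_integrableM hu hv.
have iuu := sq_integrableM hu hu; have ivv := sq_integrableM hv hv.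
have i1 := integrable_scale (k / 2) mD iuu.
have i2 := integrable_scale (k^-1 / 2) mD ivv.
apply: (le_trans (le_normr_Rintegral mD iuv)).
apply: (@le_trans _ _ (\int[m]_(x in D) (k / 2 * (u x * u x) + k^-1 / 2 * (v x * v x)))).
  apply: le_Rintegral => //.
  - have := integrable_abse iuv; exact.
  - exact: integrable_addR.
  - by move=> x _; rewrite (le_trans (young _ _ k0))// !expr2 le_eqVlt; apply/orP; left; apply/eqP; ring.
rewrite RintegralD// !RintegralZl//.
by rewrite le_eqVlt; apply/orP; left; apply/eqP; ring.
Qed.

Lemma sq_integrable1 : (m D < +oo)%E -> sq_integrable (fun=> 1).
Proof.
move=> Doo; split => //; apply/integrableP; split; first exact: measurable_cst.
under eq_integral do rewrite expr1n /= normr1.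
by rewrite integral_cst// mul1e.
Qed.

Lemma sq_integrable_integrable u : (m D < +oo)%E -> sq_integrable u ->
  m.-integrable D (EFin \o u).
Proof.
move=> /sq_integrable1 L1 hu; have := sq_integrableM hu L1.
by apply: eq_integrable => // x _ /=; rewrite mulr1.
Qed.

Lemma Rintegral_norm_le (k : R) u : (m D < +oo)%E -> 0 < k -> sq_integrable u ->
  \int[m]_(x in D) `|u x| <= (k * fine (m D) + k^-1 * \int[m]_(x in D) (u x * u x)) / 2.
Proof.
move=> Doo k0 hu.
have i1 := sq_integrable1 Doo.
have hn : sq_integrable (fun x => `|u x|).
  case: hu => mu iu; split; first exact: measurableT_comp.
  by apply: eq_integrable iu => // x _; rewrite real_normK// num_real.
have := Rintegral_young k0 i1 hn; rewrite /= => h.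
have E1 : \int[m]_(x in D) (1 * `|u x|) = \int[m]_(x in D) `|u x|.
  by apply: eq_Rintegral => x _; rewrite mul1r.
have E2 : \int[m]_(x in D) (1 * 1) = fine (m D).
  by under eq_Rintegral do rewrite mulr1; rewrite Rintegral_cst// mul1r.
have E3 : \int[m]_(x in D) (`|u x| * `|u x|) = \int[m]_(x in D) (u x * u x).
  by apply: eq_Rintegral => x _; rewrite -normrM ger0_norm// -expr2 sqr_ge0.
by move: h; rewrite E1 E2 E3; apply: le_trans; exact: ler_norm.
Qed.

End L2.

Section nonpositive.
Context d (T : measurableType d) (R : realType) (m : {measure set T -> \bar R}).

Lemma ae_le0_integral (F : T -> \bar R) : m.-integrable setT F ->
  {ae m, forall y, F y <= 0}%E -> (\int[m]_y F y <= 0)%E.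
Proof.
move=> iF F0; rewrite integralE.
have -> : (\int[m]_y (F^\+)%E y = 0)%E.
  rewrite (ae_eq_integral (cst 0%E)) ?integral0//.
    by apply: measurable_funepos; case/integrableP: iF.
  by apply: ae_impl F0 => y F0 _; rewrite funeposE; exact/max_idPr.
by rewrite sub0e oppe_le0; exact: integral_ge0.
Qed.

End nonpositive.

Section test_function.
Context {R : realType} (n : nat) (l : 'I_n.+1) (sg : side).
Variable Om : set 'rV[R]_n.+1.
Hypothesis hOm : bounded_convex_domain Om.
Notation mu := (@lebesgue_measure R).
Notation leb n := (lebesgue_rV R n).
Let s : R := sgn sg.
Let s1 : s = 1 \/ s = -1 := sgnP sg.
Notation lw := (lo l s Om).
Notation hg := (hi l s Om).
Variable phi : 'rV[R]_n.+1 -> R.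
Hypothesis tphi : test_function Om phi.

Notation dphi i := (iter i (partial l) phi).

Lemma iter_partial_foldr i : dphi i = foldr (@partial R n.+1) phi (nseq i l).
Proof. by elim: i => //= i ->. Qed.

Lemma test_function_continuous i : continuous (dphi i).
Proof. by rewrite iter_partial_foldr; case: tphi => /(_ (nseq i l))[]. Qed.

Lemma test_function_derivable i x : derivable (dphi i) x (basis_vec R l).
Proof. by rewrite iter_partial_foldr; case: tphi => /(_ (nseq i l))[]. Qed.

(** One compact set serves all derivatives: its complement is open, so a function that vanishes
    there has zero derivative there. *)
Lemma test_function_support : exists2 K : set 'rV[R]_n.+1, compact K /\ K `<=` Om &
  forall i x, ~ K x -> dphi i x = 0.
Proof.
case: tphi => _ [K [cK KO] phi0]; exists K => // i x Kx.
have oK : open (~` K).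
  by apply: closed_openC; apply: compact_closed => //; exact: norm_hausdorff.
elim: i x Kx => [|i IH] x Kx /=; first exact: phi0.
have : is_derive x (basis_vec R l) (dphi i) 0.
  apply: (near_eq_is_derive _ (is_derive_cst (0 : R) x _)).
  have : nbhs x (~` K) by exact: open_nbhs_nbhs.
  by apply: filterS => z /IH ->.
by move=> h; rewrite /partial derive_val.
Qed.

Lemma test_function_vanish i x : ~ Om x -> dphi i x = 0.
Proof.
have [K [_ KO] K0] := test_function_support.
by move=> O; apply: K0 => /KO.
Qed.

Lemma test_function_bounded i : exists M : R, forall x, `|dphi i x| <= M.
Proof.
have [K [cK _] K0] := test_function_support.
have /compact_bounded[M [Mr hM]] : compact (dphi i @` K).
  apply: continuous_compact => //; apply: continuous_subspaceT.
  exact: test_function_continuous.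
have M1 : M < `|M| + 1 by rewrite (le_lt_trans (ler_norm _))// ltrDl.
exists (`|M| + 1) => x; have [Kx|/(K0 i) ->] := pselect (K x).
  by apply: (hM _ M1) => /=; exists x.
by rewrite normr0 addr_ge0.
Qed.

Lemma test_function_L2 i : L2 Om (dphi i).
Proof.
have mO := domain_measurable hOm.
have mphi : measurable_fun Om (dphi i).
  apply: (measurable_funS measurableT) => //; apply: continuous_measurable_rV.
  exact: test_function_continuous.
split => //; have [M hM] := test_function_bounded i.
have iM : (leb n.+1).-integrable Om (EFin \o cst (M ^+ 2)).
  apply/integrableP; split; first exact/measurable_EFinP/measurable_cst.
  under eq_integral do rewrite /= ger0_norm ?sqr_ge0//.
  rewrite integral_cst//; apply: lte_mul_pinfty => //.
    by rewrite lee_fin sqr_ge0.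
  exact: domain_lty hOm.
apply: (le_integrable mO _ _ iM) => //.
  by apply/measurable_EFinP; exact: measurable_funX.
move=> x _ /=; rewrite lee_fin !normrX lerXn2r ?nnegrE//.
exact: le_trans (hM x) (ler_norm _).
Qed.

(** [s ^+ i] is the chain rule factor that makes the sequence along the line satisfy [test1]. *)
Definition test_line y i t := s ^+ i * dphi i (line l s y t).

Lemma test_line_test1 y : test1 (lw y) (hg y) (test_line y).
Proof.
split=> i t; last first.
  move=> tab; rewrite /test_line test_function_vanish ?mulr0//.
  move=> O; move: tab; have : sec l s Om y t by [].
  by rewrite secE//= in_itv/= => ->.
have d := derivable_line (@test_function_derivable i (line l s y t)).
have E : test_line y i.+1 t = s ^+ i * (s * partial l (dphi i) (line l s y t)).
  by rewrite /test_line exprSr -mulrA.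
by rewrite E; apply: is_deriveZ.
Qed.

Variable alpha : R.
Hypothesis alpha12 : 1 < alpha <= 2.
Let c := (Gamma (2 - alpha))^-1.

(** The two derivatives are placed under the Volterra integral, as in the Caputo form; for test
    functions this agrees with differentiating outside. *)
Definition RL1 a (p : nat -> R -> R) t :=
  if alpha == 2 then p 2%N t else c * vol (alpha - 1) a (p 2%N) t.

Let g01 : alpha != 2 -> 0 < alpha - 1 < 1.
Proof.
move=> a2; have /andP[h1 h2] := alpha12; have : alpha < 2 by rewrite lt_neqAle a2.
lra.
Qed.

Let frac_phi y t : sec l s Om y t ->
  frac_integral Om sg l alpha phi (line l s y t) =
  c * vol (alpha - 1) (lw y) (test_line y 0%N) t.
Proof.
move=> Ot; rewrite frac_integral_line//.
  congr (_ * _); apply: eq_vol => t' _.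
  by rewrite /test_line expr0 mul1r.
apply: (measurable_funS measurableT) => //; rewrite /frac_integrand.
apply: measurable_funM.
  have cphi := @test_function_continuous 0%N.
  have -> : (fun x => phi (set_coord l (line l s y t) x)) =
      (fun x => phi (line l s y (s * x))).
    by apply/funext => x; rewrite set_coord_line.
  apply: continuous_measurable_fun => x.
  apply: (@continuous_comp _ _ _ (fun x => line l s y (s * x)) phi); last exact: cphi.
  apply: (@continuous_comp _ _ _ (fun x : R => s * x) (line l s y)).
    by apply: cvgMl_tmp; exact: cvg_id.
  exact: line_continuous.
under eq_fun do rewrite -powRN.
exact: measurable_kernelr.
Qed.

(** On the line the fractional integral is [c] times a Volterra integral, which [test1_vol_derive]
    differentiates twice; the two factors [s] cancel. *)
Lemma riemann_liouville_line y t : sec l s Om y t ->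
  riemann_liouville Om sg l alpha phi (line l s y t) = RL1 (lw y) (test_line y) t.
Proof.
move=> Ot; rewrite /riemann_liouville /RL1; case: ifPn => [_|a2].
  by rewrite /test_line expr2 sign_sq// mul1r.
have /andP[g0 g1] := g01 a2; have g01' : 0 <= alpha - 1 < 1 by rewrite g1 ltW.
have tp := test_line_test1 y.
have near_sec u : sec l s Om y u -> \forall z \near u, sec l s Om y z.
  by rewrite secE//= in_itv/= => /andP[u1 u2]; apply: filterS (nbhs_oo u1 u2) => z /=; rewrite in_itv.
have dF u : sec l s Om y u -> forall i,
    is_derive u 1 (fun z => c * vol (alpha - 1) (lw y) (test_line y i) z)
      (c * vol (alpha - 1) (lw y) (test_line y i.+1) u).
  move=> Ou i; have au : lw y < u by move: Ou; rewrite secE// => /= /itvP ->.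
  have := test1_vol_derive tp g01' i au => d.
  by apply: is_derive_eq; rewrite /GRing.scale/=.
have P1 u : sec l s Om y u -> partial l (frac_integral Om sg l alpha phi) (line l s y u) =
    s * (c * vol (alpha - 1) (lw y) (test_line y 1%N) u).
  move=> Ou.
  have h : is_derive u 1 (fun z => frac_integral Om sg l alpha phi (line l s y z))
      (c * vol (alpha - 1) (lw y) (test_line y 1%N) u).
    have e : \forall z \near u, c * vol (alpha - 1) (lw y) (test_line y 0%N) z =
        frac_integral Om sg l alpha phi (line l s y z).
      by apply: filterS (near_sec u Ou) => z Oz; rewrite -frac_phi.
    exact: (near_eq_is_derive e (dF u Ou 0%N)).
  exact: (partial_line s1 h).
transitivity (s * (s * (c * vol (alpha - 1) (lw y) (test_line y 2%N) t))); last first.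
  by rewrite mulrA sign_sq// mul1r.
have d2 := dF t Ot 1%N.
have d2' : is_derive t 1 (fun z => s * (c * vol (alpha - 1) (lw y) (test_line y 1%N) z))
    (s * (c * vol (alpha - 1) (lw y) (test_line y 2%N) t)).
  exact: is_deriveZ.
have e : \forall z \near t, s * (c * vol (alpha - 1) (lw y) (test_line y 1%N) z) =
    partial l (frac_integral Om sg l alpha phi) (line l s y z).
  by apply: filterS (near_sec t Ot) => z Oz; rewrite P1.
exact: (partial_line s1 (near_eq_is_derive e d2')).
Qed.

Hypothesis L2RL : L2 Om (riemann_liouville Om sg l alpha phi).

Lemma integrable_test_energy : (leb n.+1).-integrable Om
  (fun x => (phi x * riemann_liouville Om sg l alpha phi x)%:E).
Proof.
by apply: sq_integrableM; [exact: domain_measurable|exact: (test_function_L2 0%N)|exact: L2RL].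
Qed.

Lemma restrict_line (f : 'rV[R]_n.+1 -> \bar R) y :
  (\int[mu]_t (f \_ Om) (line l s y t) = \int[mu]_(t in `]lw y, hg y[) f (line l s y t))%E.
Proof.
rewrite [RHS]integral_mkcond; apply: eq_integral => t _; rewrite !patchE.
suff -> : (line l s y t \in Om) = (t \in `]lw y, hg y[%classic) by [].
by rewrite -secE//; apply/idP/idP; rewrite !inE.
Qed.

(** Fubini over the lines reduces to [energy_id] or [energy_vol] on each section; the constant [c]
    is nonnegative because the integrand of [Gamma] is. *)
Lemma test_energy :
  \int[leb n.+1]_(x in Om) (phi x * riemann_liouville Om sg l alpha phi x) <= 0.
Proof.
have mO := domain_measurable hOm.
pose f x := (phi x * riemann_liouville Om sg l alpha phi x)%:E.
have := integrable_test_energy; rewrite integrable_mkcond// -/f => ifO.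
rewrite /Rintegral; apply: fine_le0; rewrite -/f; rewrite integral_mkcond (integral_lines l s1 ifO).
have iF : (leb n).-integrable setT (fun y => \int[mu]_t (f \_ Om) (line l s y t))%E.
  exact: (integrable_fubini_G (integrable_ins l s1 ifO)).
apply: (ae_le0_integral iF); apply: ae_impl (ae_integrable_line l s1 ifO) => y iy.
rewrite restrict_line.
have [ab|ab] := ltP (lw y) (hg y); last first.
  by rewrite set_itv_ge ?integral_set0// bnd_simp -leNgt.
have iy' : mu.-integrable `]lw y, hg y[ (fun t => f (line l s y t)).
  rewrite integrable_mkcond//; apply: eq_integrable iy => // t _; rewrite !patchE.
  suff -> : (line l s y t \in Om) = (t \in `]lw y, hg y[%classic) by [].
  by rewrite -secE//; apply/idP/idP; rewrite !inE.
have fn : (\int[mu]_(t in `]lw y, hg y[) f (line l s y t))%E \is a fin_num.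
  exact: integrable_fin_num iy'.
rewrite -(fineK fn) lee_fin.
have -> : fine (\int[mu]_(t in `]lw y, hg y[) f (line l s y t)) =
    \int[mu]_(t in `]lw y, hg y[) (test_line y 0%N t * RL1 (lw y) (test_line y) t).
  apply: eq_Rintegral => t; rewrite inE -secE// => Ot.
  by rewrite riemann_liouville_line// /test_line expr0 mul1r.
have tp := test_line_test1 y; rewrite /RL1; have [a2|a2] := boolP (alpha == 2).
  exact: (energy_id ab tp).
have -> : \int[mu]_(t in `]lw y, hg y[) (test_line y 0%N t *
     (c * vol (alpha - 1) (lw y) (test_line y 2%N) t)) =
    \int[mu]_(t in `]lw y, hg y[) (c * (test_line y 0%N t *
      vol (alpha - 1) (lw y) (test_line y 2%N) t)).
  by apply: eq_Rintegral => t _; rewrite mulrCA.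
have g01' : 0 <= alpha - 1 < 1 by have := g01 a2; lra.
have [M M0 hM] := test1_bounded ab tp 0%N.
have iv := vol_integrable g01' (test1_integrable tp 2%N (lw y) (hg y)).
have ipv : mu.-integrable `]lw y, hg y[
    (EFin \o (fun t => test_line y 0%N t * vol (alpha - 1) (lw y) (test_line y 2%N) t)).
  have iMv : mu.-integrable `]lw y, hg y[
      (fun t => (M * vol (alpha - 1) (lw y) (test_line y 2%N) t)%:E).
    by apply: integrable_scale.
  apply: (le_integrable _ _ _ iMv) => //.
    apply/measurable_EFinP; apply: measurable_funM.
      apply: (measurable_funS measurableT) => //; apply: continuous_measurable_fun.
      exact: (test1_continuous tp).
    by apply/measurable_EFinP; case/integrableP: iv.
  move=> t _ /=; rewrite lee_fin normrM [leRHS]normrM; apply: ler_wpM2r => //.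
  exact: le_trans (hM t) (ler_norm _).
have -> : \int[mu]_(t in `]lw y, hg y[) (c * (test_line y 0%N t *
      vol (alpha - 1) (lw y) (test_line y 2%N) t)) =
    c * \int[mu]_(t in `]lw y, hg y[) (test_line y 0%N t *
      vol (alpha - 1) (lw y) (test_line y 2%N) t).
  exact: (prim_scale c ipv).
apply: mulr_ge0_le0; last exact: (energy_vol ab tp (g01 a2)).
rewrite invr_ge0; apply: Rintegral_ge0 => t _.
by rewrite mulr_ge0// ?powR_ge0// expR_ge0.
Qed.

End test_function.

(** * Elements of the closure of the test functions *)

Section closure.
Context {R : realType} (n : nat) (l : 'I_n.+1) (sg : side).
Variable Om : set 'rV[R]_n.+1.
Hypothesis hOm : bounded_convex_domain Om.
Notation mu := (@lebesgue_measure R).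
Notation leb n := (lebesgue_rV R n).
Let s : R := sgn sg.
Let s1 : s = 1 \/ s = -1 := sgnP sg.
Notation lw := (lo l s Om).
Notation hg := (hi l s Om).
Variable alpha : R.
Hypothesis alpha12 : 1 < alpha <= 2.
Variables v w : 'rV[R]_n.+1 -> R.
Hypothesis hJ : J0_with_derivative Om sg l alpha v w.
Let mO : measurable Om := domain_measurable hOm.
Notation RL := (riemann_liouville Om sg l alpha).

Lemma L2norm_sq u : L2norm Om u ^+ 2 = inner Om u u.
Proof.
by rewrite sqr_sqrtr//; apply: Rintegral_ge0 => x _; rewrite -expr2 sqr_ge0.
Qed.

Lemma inner_ge0 u : 0 <= inner Om u u.
Proof. by rewrite -L2norm_sq sqr_ge0. Qed.

Lemma J0_approx (eps : R) : 0 < eps -> exists phi, [/\ test_function Om phi,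
  L2 Om (RL phi), inner Om (v - phi) (v - phi) <= eps ^+ 2 &
  inner Om (w - RL phi) (w - RL phi) <= eps ^+ 2].
Proof.
move=> e0; case: hJ => _ _ /(_ _ e0)[phi [tphi LRL]].
rewrite !L2norm_sq => h; exists phi.
have h1 := inner_ge0 (v - phi); have h2 := inner_ge0 (w - RL phi).
move: h; rewrite -[X in _ < X]gtr0_norm// -sqrtr_sqr ltr_sqrt ?exprn_gt0// => h.
by split => //; apply: ltW; apply: le_lt_trans h; rewrite ?lerDl ?lerDr.
Qed.

(** [(w, v)] splits into [(phi, D phi)], nonpositive by [test_energy], and three terms that contain
    [w - D phi] or [v - phi] and are small by Young's inequality. *)
Lemma inner_derivative_le0 : inner Om w v <= 0.
Proof.
have [Lv Lw _] := hJ.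
(* With errors of norm at most [del <= 1], Young's inequality with parameter [del] bounds the first
   two small terms by [del / 2] times [1 + (v, v)] and [1 + (w, w)]; the third is at most
   [del ^+ 2 <= del]. *)
pose K := 2^-1 * (1 + inner Om v v) + 2^-1 * (1 + inner Om w w) + 1.
have K0 : 0 < K.
  by rewrite ltr_wpDl// addr_ge0// mulr_ge0 ?invr_ge0// addr_ge0// inner_ge0.
apply/ler_addgt0Pr => eps eps0; rewrite add0r.
pose del := Num.min 1 (eps / K).
have del0 : 0 < del by rewrite lt_min ltr01 divr_gt0.
have del1 : del <= 1 by rewrite ge_min lexx.
have delK : del * K <= eps by rewrite -ler_pdivlMr// ge_min lexx orbT.
have [phi [tphi LRL hv hw]] := J0_approx del0.
have Lphi : L2 Om phi := test_function_L2 l hOm tphi 0%N.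
have Lvp : L2 Om (v - phi) := sq_integrableB mO Lv Lphi.
have Lwp : L2 Om (w - RL phi) := sq_integrableB mO Lw LRL.
have E : inner Om w v = inner Om (w - RL phi) v + inner Om w (v - phi) -
    inner Om (w - RL phi) (v - phi) + inner Om phi (RL phi).
  have i1 := sq_integrableM mO Lwp Lv; have i2 := sq_integrableM mO Lw Lvp.
  have i3 := sq_integrableM mO Lwp Lvp; have i4 := sq_integrableM mO Lphi LRL.
  rewrite /inner -RintegralD// -RintegralB//; last exact: integrable_addR.
  rewrite -RintegralD//; last by apply: integrable_subR => //; exact: integrable_addR.
  apply: eq_Rintegral => x _; rewrite !fctE; ring.
have y1 := Rintegral_young mO del0 Lv Lwp; have y2 := Rintegral_young mO del0 Lw Lvp.
have y3 := Rintegral_young mO ltr01 Lwp Lvp.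
have y4 := test_energy hOm tphi alpha12 LRL.
have dV : del^-1 * del ^+ 2 = del by rewrite expr2 mulKf// gt_eqF.
have dV0 : 0 <= del^-1 by rewrite invr_ge0 ltW.
have hv' := ler_wpM2l dV0 hv; have hw' := ler_wpM2l dV0 hw.
rewrite dV in hv' hw'.
have del2 : del ^+ 2 <= del by rewrite expr2 ger_pMl.
have cm : \int[leb n.+1]_(x in Om) (v x * (w - RL phi) x) = inner Om (w - RL phi) v.
  by apply: eq_Rintegral => x _; rewrite mulrC.
rewrite cm in y1; move: y1 y2 y3; rewrite !ler_norml !invr1 !mul1r.
rewrite -!/(inner Om _ _).
move=> /andP[_ y1] /andP[_ y2] /andP[y3 _].
rewrite E; apply: le_trans delK; rewrite /K.
move: y1 y2 y3 y4 hv' hw' hv hw del2; rewrite -!/(inner Om _ _).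
set a := inner Om v v; set b := inner Om w w.
set c := inner Om (v - phi) (v - phi); set d := inner Om (w - RL phi) (w - RL phi).
set p1 := inner Om _ v; set p2 := inner Om w _; set p3 := inner Om _ (v - phi).
set p4 := inner Om phi _.
set q1 := del^-1 * c; set q2 := del^-1 * d; set dd := del ^+ 2.
move=> *; rewrite !mulrDr; lra.
Qed.

Let u phi x := (`|w x - RL phi x| + `|v x - phi x|)%:E.

Lemma J0_approx_L1 (eps : R) : 0 < eps -> exists phi, [/\ test_function Om phi,
  L2 Om (RL phi) & (\int[leb n.+1]_(x in Om) u phi x <= eps%:E)%E].
Proof.
move=> eps0; have [Lv Lw _] := hJ.
pose m := fine (leb n.+1 Om).
have m0 : 0 <= m by exact: fine_ge0.
(* Each of the two L1 norms will be at most [(del * m + del) / 2], half of [eps]. *)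
pose del := eps / (m + 1).
have del0 : 0 < del by rewrite divr_gt0// ltr_wpDl.
have [phi [tphi LRL hv hw]] := J0_approx del0.
exists phi; split => //.
have Lphi : L2 Om phi := test_function_L2 l hOm tphi 0%N.
have Lvp : L2 Om (v - phi) := sq_integrableB mO Lv Lphi.
have Lwp : L2 Om (w - RL phi) := sq_integrableB mO Lw LRL.
have Ooo := domain_lty hOm.
have iv := sq_integrable_integrable mO Ooo Lvp.
have iw := sq_integrable_integrable mO Ooo Lwp.
have nv := integrable_norm iv; have nw := integrable_norm iw.
have iu : (leb n.+1).-integrable Om (u phi) by exact: integrable_addR.
have fn : (\int[leb n.+1]_(x in Om) u phi x)%E \is a fin_num.
  exact: integrable_fin_num iu.
rewrite -(fineK fn) lee_fin.
have -> : fine (\int[leb n.+1]_(x in Om) u phi x) =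
    \int[leb n.+1]_(x in Om) `|(w - RL phi) x| + \int[leb n.+1]_(x in Om) `|(v - phi) x|.
  by rewrite -RintegralD.
have y1 := Rintegral_norm_le mO Ooo del0 Lvp; have y2 := Rintegral_norm_le mO Ooo del0 Lwp.
have dV : del^-1 * del ^+ 2 = del by rewrite expr2 mulKf// gt_eqF.
have dV0 : 0 <= del^-1 by rewrite invr_ge0 ltW.
have hv' := ler_wpM2l dV0 hv; have hw' := ler_wpM2l dV0 hw.
rewrite dV /inner in hv' hw'.
have dm : del * m + del = eps by rewrite /del; field; rewrite gt_eqF// ltr_wpDl.
rewrite -/m in y1 y2; move: y1 y2 hv' hw'; rewrite -dm.
set q1 := del^-1 * _; set q2 := del^-1 * _; set r := del * m.
move=> *; lra.
Qed.

Lemma measurable_line_sec (f : 'rV[R]_n.+1 -> R) y : measurable_fun Om f ->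
  measurable_fun `]lw y, hg y[ (fun t => f (line l s y t)).
Proof.
move=> mf; apply: (@measurable_comp _ _ _ _ _ _ Om) mf _ => //.
  by move=> _ [t /= ht <-]; have : sec l s Om y t by rewrite secE.
apply: (measurable_funS measurableT) => //.
by apply: (measurableT_comp (measurable_ins l s)); exact: measurable_pair2.
Qed.

(** On a given line and for a given [eps] a single good approximant suffices, so no subsequence
    converging on almost every line has to be extracted. The two errors are added in [u] so that the
    same approximant serves both. *)
Lemma J0_ae_lines : {ae leb n, forall y, forall eps : R, 0 < eps -> exists p,
  [/\ test1 (lw y) (hg y) p,
   \int[mu]_(t in `]lw y, hg y[) `|((fun t => w (line l s y t)) - RL1 alpha (lw y) p) t| <= eps &
   \int[mu]_(t in `]lw y, hg y[) `|((fun t => v (line l s y t)) - p 0%N) t| <= eps]}.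
Proof.
have hex (k : nat) : exists phi, [/\ test_function Om phi,
    L2 Om (RL phi) & (\int[leb n.+1]_(x in Om) u phi x <= (k.+1%:R^-1)%:E)%E].
  by apply: J0_approx_L1; rewrite invr_gt0.
have [phi hphi] := choice hex.
have [[mv _] [mw _] _] := hJ.
have mu_ k : measurable_fun Om (u (phi k)).
  have [tphi [mRL _] _] := hphi k.
  have [mphi _] : L2 Om (phi k) := test_function_L2 l hOm tphi 0%N.
  apply/measurable_EFinP; apply: measurable_funD; apply: measurableT_comp => //;
    exact: measurable_funB.
pose F k := u (phi k) \_ Om.
have mF k : measurable_fun setT (F k) by exact/(measurable_restrictT _ mO).
have u0 k x : (0 <= u (phi k) x)%E by rewrite lee_fin addr_ge0.
have F0 k x : (0 <= F k x)%E by rewrite /F patchE; case: ifPn.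
pose h k y := (\int[mu]_t F k (line l s y t))%E.
have mh k : measurable_fun setT (h k) by exact: measurable_integral_line.
have h0 k y : (0 <= h k y)%E by exact: integral_ge0.
(* The [h k] are nonnegative with integrals tending to 0, so that their infimum
   over [k] vanishes almost everywhere. *)
pose I y := einfs (h^~ y) 0%N.
have mI : measurable_fun setT I by exact: measurable_fun_einfs.
have I0 y : (0 <= I y)%E by apply/ereal_infP => _ [k _ <-]; exact: h0.
have Ih k y : (I y <= h k y)%E by apply: ereal_inf_lbound; exists k.
have iI : (\int[leb n]_y `|I y| = 0)%E.
  apply/eqP; rewrite eq_le integral_ge0 ?andbT//.
  apply/lee_addgt0Pr => eps eps0; rewrite add0e.
  have [k hk] : exists k : nat, k.+1%:R^-1 <= eps.
    exists (Num.truncn (eps^-1)); rewrite -[leRHS]invrK lef_pV2 ?posrE ?invr_gt0//.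
    exact/ltW/truncnS_gt.
  apply: (@le_trans _ _ (\int[leb n]_y h k y)%E).
    by apply: ge0_le_integral => //; [exact: measurableT_comp|move=> y _; rewrite gee0_abs].
  rewrite -(ge0_integral_lines l s1 (mF k) (F0 k)) -integral_mkcond.
  by have [_ _] := hphi k; move=> /le_trans; apply; rewrite lee_fin.
have := (ae_eq_integral_abs _ measurableT mI).1 iI; apply: ae_impl => y /(_ Logic.I) /= Iy.
move=> eps eps0.
have [_ [k _ <-] hk] : exists2 z, [set h j y | j in [set i | (0 <= i)%N]] z & (z < eps%:E)%E.
  apply: ereal_inf_lt; have Iy' : I y = 0%E by exact: Iy.
  have : (I y < eps%:E)%E by rewrite Iy' lte_fin.
  exact.
have [tphi [mRL _] _] := hphi k.
have [mphi _] : L2 Om (phi k) := test_function_L2 l hOm tphi 0%N.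
exists (test_line l sg (phi k) y).
have hkE : h k y = (\int[mu]_(t in `]lw y, hg y[) u (phi k) (line l s y t))%E.
  exact: restrict_line.
have small (f : R -> R) : measurable_fun `]lw y, hg y[ f ->
    (forall t, sec l s Om y t -> (`|f t|%:E <= u (phi k) (line l s y t))%E) ->
    \int[mu]_(t in `]lw y, hg y[) `|f t| <= eps.
  move=> mf hf.
  have le : (\int[mu]_(t in `]lw y, hg y[) `|f t|%:E <= eps%:E)%E.
    apply: (le_trans _ (ltW hk)); rewrite hkE; apply: ge0_le_integral => //.
    - by apply/measurable_EFinP; exact: measurableT_comp.
    - have mul : measurable_fun Om (fun x => `|w x - RL (phi k) x| + `|v x - phi k x|).
        by apply/measurable_EFinP; exact: mu_.
      by apply/measurable_EFinP; exact: (measurable_line_sec mul).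
    - by move=> t ht; apply: hf; rewrite secE//.
  rewrite /Rintegral; move: le; set X := (\int[mu]_(t in _) _)%E.
  have : (0 <= X)%E by exact: integral_ge0.
  by case: X => //= r _; rewrite lee_fin.
split; first exact: test_line_test1.
  have -> : \int[mu]_(t in `]lw y, hg y[)
      `|((fun t => w (line l s y t)) - RL1 alpha (lw y) (test_line l sg (phi k) y)) t| =
    \int[mu]_(t in `]lw y, hg y[) `|(w - RL (phi k)) (line l s y t)|.
    apply: eq_Rintegral => t; rewrite inE -(secE _ s1 hOm) => Ot.
    by rewrite !fctE riemann_liouville_line.
  apply: small; first by apply: measurable_line_sec; exact: measurable_funB.
  by move=> t _; rewrite lee_fin lerDl.
have -> : \int[mu]_(t in `]lw y, hg y[)
    `|((fun t => v (line l s y t)) - test_line l sg (phi k) y 0%N) t| =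
  \int[mu]_(t in `]lw y, hg y[) `|(v - phi k) (line l s y t)|.
  by apply: eq_Rintegral => t _; rewrite !fctE /test_line expr0 mul1r.
apply: small; first by apply: measurable_line_sec; exact: measurable_funB.
by move=> t _; rewrite lee_fin lerDr.
Qed.

End closure.

(** * Identification with the Caputo derivatives *)

Section signed_fubini.
Context d1 d2 (T1 : measurableType d1) (T2 : measurableType d2) (R : realType).
Variable m2 : {sigma_finite_measure set T2 -> \bar R}.

Lemma measurable_integral_snd (F : T1 * T2 -> \bar R) : measurable_fun setT F ->
  measurable_fun setT (fun x => \int[m2]_t F (x, t))%E.
Proof.
move=> mF; have -> : (fun x => \int[m2]_t F (x, t))%E =
    (fun x => fubini_F m2 F^\+ x - fubini_F m2 F^\- x)%E.
  apply/funext => x; rewrite integralE /fubini_F; congr (_ - _)%E.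
    by apply: eq_integral => t _; rewrite !funeposE.
  by apply: eq_integral => t _; rewrite !funenegE.
apply: emeasurable_funB; apply: measurable_fun_fubini_tonelli_F => //.
  exact: measurable_funepos.
exact: measurable_funeneg.
Qed.

End signed_fubini.

Section measurable_derivative.
Context {R : realType} (n : nat) (l : 'I_n.+1).
Variable Om : set 'rV[R]_n.+1.
Hypothesis oOm : open Om.
Implicit Types f : 'rV[R]_n.+1 -> R.

(** [f] is controlled on [Om] only: the extension by 0 makes the quotient measurable everywhere and
    does not affect its limit inside the open set [Om]. *)
Definition quotient_seq f x (m : nat) : R :=
  m.+1%:R * ((f \_ Om) (x + m.+1%:R^-1 *: basis_vec R l) - (f \_ Om) x).

(* A measurable substitute for [partial l f]: the second derivatives of the
   solutions are only controlled on each line, almost everywhere, so that their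
   joint measurability is not available. *)
Definition dmeas f x : R := fine (limn_esup (EFin \o quotient_seq f x)).

Lemma measurable_dmeas f : measurable_fun Om f -> measurable_fun setT (dmeas f).
Proof.
move=> mf; have mO := open_measurable_rV oOm.
have mf' : measurable_fun setT (f \_ Om) by exact/(measurable_restrictT _ mO).
apply: (measurableT_comp (@fine_measurable R setT measurableT)).
apply: (@measurable_fun_limn_esup _ _ _ _ (fun m x => (quotient_seq f x m)%:E)) => m.
apply/measurable_EFinP; apply: measurable_funM => //; apply: measurable_funB => //.
apply: (measurableT_comp mf'); apply: measurable_fun_rV => i.
under eq_fun do rewrite !mxE; apply: measurable_funD => //.
exact: measurable_rV_coord.
Qed.

Lemma harmonic_dnbhs : (m.+1%:R^-1 : R) @[m --> \oo] --> 0^'.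
Proof.
move=> B /= hB.
have h : \forall m \near \oo, (m.+1%:R^-1 : R) != 0 -> B (m.+1%:R^-1 : R).
  exact: (@cvg_harmonic R _ hB).
suff : \forall m \near \oo, B (m.+1%:R^-1 : R) by [].
by apply: filterS h => m; apply; rewrite invr_neq0// pnatr_eq0.
Qed.

Lemma dmeasE f x (d : R) : Om x -> is_derive x (basis_vec R l) f d -> dmeas f x = d.
Proof.
move=> Ox fd.
have fcvg : (h^-1 *: ((f \o shift x) (h *: basis_vec R l) - f x)) @[h --> 0^'] --> d.
  by case: fd => dvf <-; exact: dvf.
have qd : quotient_seq f x m @[m --> \oo] --> d.
  have := cvg_comp _ _ harmonic_dnbhs fcvg; apply: cvg_trans; apply: near_eq_cvg.
  have nO : \forall h \near (0 : R), Om (x + h *: basis_vec R l).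
    have c : (x + h *: basis_vec R l) @[h --> (0 : R)] --> x + 0 *: basis_vec R l.
      by apply: cvgD; [exact: cvg_cst|apply: cvgZr_tmp; exact: cvg_id].
    by apply: c; rewrite scale0r addr0; exact: open_nbhs_nbhs.
  have h : \forall m \near \oo, Om (x + (m.+1%:R^-1 : R) *: basis_vec R l).
    exact: (@cvg_harmonic R _ nO).
  apply: filterS h => m /= Om1.
  rewrite /quotient_seq !patchE !mem_set// invrK /GRing.scale/=.
  by rewrite [X in f X]addrC.
rewrite /dmeas is_cvg_limn_esupE; last first.
  by apply/cvg_ex; exists d%:E; apply/cvg_EFin => //; exact: nearW.
have -> : limn (EFin \o quotient_seq f x) = d%:E.
  by apply/cvg_lim => //; apply/cvg_EFin => //; exact: nearW.
by [].
Qed.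

End measurable_derivative.

Section fractional_field.
Context {R : realType} (n : nat) (l : 'I_n.+1) (s g : R).
Hypothesis s1 : s = 1 \/ s = -1.
Variable Om : set 'rV[R]_n.+1.
Hypothesis hOm : bounded_convex_domain Om.
Variable G : 'rV[R]_n.+1 -> R.
Hypothesis mG : measurable_fun setT G.
Notation mu := (@lebesgue_measure R).

(** The moving range []lo, t[] is encoded as an indicator, so that the Volterra integrals on all
    lines form one integral with a parameter, whose measurability follows from Tonelli. *)
Let S : set ((R * 'rV[R]_n) * R) := [set p | Om (line l s p.1.2 p.2) /\ p.2 < p.1.1].
Let pt (p : (R * 'rV[R]_n) * R) := line l s p.1.2 p.2.
Let K p := \1_S p * (G (pt p) * `|p.1.1 - p.2| `^ (- g)).

Definition vol_field (x : 'rV[R]_n.+1) : R :=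
  fine (\int[mu]_t' (K ((s * x 0 l, del l x), t'))%:E)%E.

Let mpt : measurable_fun setT pt.
Proof.
apply: (measurableT_comp (measurable_ins l s)).
apply/measurable_fun_pairP; split; first exact: measurable_snd.
exact: (measurableT_comp measurable_snd measurable_fst).
Qed.

Let mK : measurable_fun setT K.
Proof.
have m11 : measurable_fun setT (fun p : (R * 'rV[R]_n) * R => p.1.1).
  exact: (measurableT_comp measurable_fst measurable_fst).
have m2 : measurable_fun setT (fun p : (R * 'rV[R]_n) * R => p.2).
  exact: measurable_snd.
apply: measurable_funM; last first.
  apply: measurable_funM; first exact: measurableT_comp.
  have : measurable_fun setT (fun p : (R * 'rV[R]_n) * R => (p.1.1, p.2)).
    by apply/measurable_fun_pairP.
  exact: (measurableT_comp (measurable_kernel g)).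
apply: measurable_indic.
have -> : S = (pt @^-1` Om) `&` [set p | p.2 < p.1.1] by [].
apply: measurableI.
  by have := mpt measurableT (domain_measurable hOm); rewrite setTI.
have := measurable_fun_ltr m2 m11 => /(_ measurableT [set true]).
by rewrite setTI; exact.
Qed.

Lemma measurable_vol_field : measurable_fun setT vol_field.
Proof.
have mdel : measurable_fun setT (fun x : 'rV[R]_n.+1 => (s * x 0 l, del l x)).
  apply/measurable_fun_pairP; split.
    by apply: measurable_funM => //; exact: measurable_rV_coord.
  apply: measurable_fun_rV => i; under eq_fun do rewrite mxE.
  exact: measurable_rV_coord.
have mI : measurable_fun setT (fun q : R * 'rV[R]_n => \int[mu]_t' (K (q, t'))%:E)%E.
  by apply: (@measurable_integral_snd _ _ _ _ _ mu (EFin \o K)); exact/measurable_EFinP.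
apply: (measurableT_comp (@fine_measurable R setT measurableT)).
exact: (measurableT_comp mI mdel).
Qed.

Lemma vol_field_line y t : sec l s Om y t ->
  vol_field (line l s y t) = vol g (lo l s Om y) (fun t' => G (line l s y t')) t.
Proof.
move=> Ot; rewrite /vol_field del_line line_coord mulrA sign_sq// mul1r /vol /Rintegral.
congr fine; rewrite [RHS]integral_mkcond; apply: eq_integral => t' _.
have thi : lo l s Om y < t < hi l s Om y by move: Ot; rewrite secE.
have E : ((t, y), t') \in S = (t' \in `]lo l s Om y, t[%classic).
  apply/idP/idP; rewrite !inE /S /=.
    move=> [Ot1 tt']; have : sec l s Om y t' by [].
    by rewrite secE//= !in_itv/= => /andP[-> _].
  rewrite in_itv/= => /andP[lt tt']; split => //.
  have : sec l s Om y t' by rewrite secE//= in_itv/= lt; case/andP: thi => _; exact: lt_trans.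
  by [].
by rewrite /K indicE E patchE; case: ifPn => _; rewrite ?mul1r ?mul0r.
Qed.

End fractional_field.

Section identification_id.
Context {R : realType}.
Notation mu := (@lebesgue_measure R).

Lemma closure_identity_id (a b : R) (e w : R -> R) :
  mu.-integrable `]a, b[ (EFin \o e) -> mu.-integrable `]a, b[ (EFin \o w) ->
  (forall eps, 0 < eps -> exists p, [/\ test1 a b p,
     \int[mu]_(x in `]a, b[) `|(w - p 2%N) x| <= eps &
     \int[mu]_(x in `]a, b[) `|(e - p 0%N) x| <= eps]) ->
  {ae mu, forall x, x \in `]a, b[ -> prim a (prim a w) x = e x}.
Proof.
move=> ie iw h.
have A1 (g : R -> R) : mu.-integrable `]a, b[ (EFin \o g) -> mu.-integrable `]a, b[ (EFin \o id g) by [].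
have A2 (g : R -> R) : mu.-integrable `]a, b[ (EFin \o g) ->
  \int[mu]_(x in `]a, b[) `|id g x| <= 1 * \int[mu]_(x in `]a, b[) `|g x|.
  by rewrite mul1r.
apply: (closure_identity A1 ler01 A2 _ _ ie iw h).
  by move=> h1 h2 _ _; apply: aeW => x _; rewrite !fctE.
move=> p tp x; rewrite in_itv/= => /andP[ax xb].
rewrite (test1_prim tp 0%N ax); apply: eq_prim => t; rewrite in_itv/= => /andP[at_ _].
by rewrite (test1_prim tp 1%N at_).
Qed.

End identification_id.

Section identification.
Context {R : realType} (n : nat) (l : 'I_n.+1) (sg : side).
Variable Om : set 'rV[R]_n.+1.
Hypothesis hOm : bounded_convex_domain Om.
Notation mu := (@lebesgue_measure R).
Notation leb n := (lebesgue_rV R n).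
Let s : R := sgn sg.
Let s1 : s = 1 \/ s = -1 := sgnP sg.
Notation lw := (lo l s Om).
Notation hg := (hi l s Om).
Let mO : measurable Om := domain_measurable hOm.

Lemma ae_integrable_sec (f : 'rV[R]_n.+1 -> R) :
  (leb n.+1).-integrable Om (EFin \o f) ->
  {ae leb n, forall y, mu.-integrable `]lw y, hg y[ (EFin \o (fun t => f (line l s y t)))}.
Proof.
rewrite integrable_mkcond// => /(ae_integrable_line l s1); apply: ae_impl => y iy.
rewrite integrable_mkcond//; apply: eq_integrable iy => // t _; rewrite !patchE.
suff -> : (line l s y t \in Om) = (t \in `]lw y, hg y[%classic) by [].
by rewrite -(secE _ s1 hOm); apply/idP/idP; rewrite !inE.
Qed.

Variable alpha : R.
Hypothesis alpha12 : 1 < alpha <= 2.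
Let c := (Gamma (2 - alpha))^-1.
Variables U V w : 'rV[R]_n.+1 -> R.
Hypotheses (tU : twice_diff_along Om l U) (tV : twice_diff_along Om l V).
Hypothesis cU : {ae leb n.+1, forall x, Om x -> caputo_defined Om sg l alpha U x}.
Hypothesis cV : {ae leb n.+1, forall x, Om x -> caputo_defined Om sg l alpha V x}.
Hypothesis UV : forall x, frontier Om x -> U x = V x.
Hypothesis zUV : zero_gradient_on_frontier Om (U - V).
Hypothesis hJ : J0_with_derivative Om sg l alpha (U - V) w.

Let e := U - V.
Let p x := partial l U x - partial l V x.
Let G x := partial2 l U x - partial2 l V x.

Let de x : Om x -> is_derive x (basis_vec R l) e (p x).
Proof.
move=> Ox; have [dU _] := tU; have [dV _] := tV.
have h1 : is_derive x (basis_vec R l) U (partial l U x) by apply: DeriveDef => //; exact: dU.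
have h2 : is_derive x (basis_vec R l) V (partial l V x) by apply: DeriveDef => //; exact: dV.
exact: is_deriveB.
Qed.

(** [dmeas] is used twice: [p] agrees on [Om] with the measurable [dmeas l Om e], and [dmeas] of the
    latter returns the derivative of [p] wherever it exists. *)
Lemma measurable_derivative_of_partial : exists2 Gm : 'rV[R]_n.+1 -> R,
  measurable_fun setT Gm &
  forall x d, Om x -> is_derive x (basis_vec R l) p d -> Gm x = d.
Proof.
have [[me _] _ _] := hJ; have oOm := domain_open hOm.
pose P := dmeas l Om e.
have Pp x : Om x -> P x = p x by move=> Ox; apply: (dmeasE oOm Ox); exact: de.
exists (dmeas l Om P).
  apply: (measurable_dmeas l oOm); apply: (measurable_funS measurableT) => //.
  exact: (measurable_dmeas l oOm me).
move=> x d Ox dp; apply: (dmeasE oOm Ox).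
have h : \forall z \near x, p z = P z.
  have : nbhs x Om by exact: open_nbhs_nbhs.
  by apply: filterS => z /Pp ->.
exact: (near_eq_is_derive h dp).
Qed.

Variable Gm : 'rV[R]_n.+1 -> R.
Hypothesis mGm : measurable_fun setT Gm.
Hypothesis GmE : forall x d, Om x -> is_derive x (basis_vec R l) p d -> Gm x = d.

Let increment y (t1 t2 : R) : lw y < t1 -> t1 < t2 -> t2 < hg y ->
  mu.-integrable `[t1, t2] (EFin \o (fun t => G (line l s y t))) /\
  s * p (line l s y t2) - s * p (line l s y t1) =
  \int[mu]_(r in `[t1, t2]) G (line l s y r).
Proof.
move=> h1 h12 h2.
have O1 : sec l s Om y t1 by rewrite secE//= in_itv/= h1 (lt_trans h12).
have O2 : sec l s Om y t2 by rewrite secE//= in_itv/= h2 (lt_trans h1).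
have [iU eU] := twice_diff_line s1 tU O1 O2 (ltW h12).
have [iV eV] := twice_diff_line s1 tV O1 O2 (ltW h12).
have sub (f1 f2 : R -> R) : mu.-integrable `[t1, t2] (EFin \o f1) ->
    mu.-integrable `[t1, t2] (EFin \o f2) ->
    mu.-integrable `[t1, t2] (EFin \o (fun t => f1 t - f2 t)) /\
    \int[mu]_(t in `[t1, t2]) (f1 t - f2 t) =
    \int[mu]_(t in `[t1, t2]) f1 t - \int[mu]_(t in `[t1, t2]) f2 t.
  by move=> i1 i2; split; [exact: integrable_subR|rewrite RintegralB].
have [iUV eUV] := sub _ _ iU iV.
have lin (u1 u2 v1 v2 i j : R) : s * u2 - s * u1 = i -> s * v2 - s * v1 = j ->
    s * (u2 - v2) - s * (u1 - v1) = i - j by move=> <- <-; ring.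
split; first exact: iUV.
by rewrite (lin _ _ _ _ _ _ eU eV) -eUV.
Qed.

(** Along the line, [s * p] is a primitive of [G], so at almost every point its derivative exists
    and equals [G]; there [GmE] applies. *)
Let Gm_line y : {ae mu, forall t, t \in `]lw y, hg y[ -> Gm (line l s y t) = G (line l s y t)}.
Proof.
have := ae_derive_of_increment (@increment y); apply: ae_impl => t h tI.
have Ot : Om (line l s y t) by have : sec l s Om y t by rewrite secE.
have d := h tI.
have d2 : is_derive t 1 (fun t' => p (line l s y t')) (s * G (line l s y t)).
  have -> : (fun t' => p (line l s y t')) = (fun t' => s * (s * p (line l s y t'))).
    by apply/funext => t'; rewrite mulrA sign_sq// mul1r.
  exact: is_deriveZ.
have := line_is_derive s1 d2; rewrite mulrA sign_sq// mul1r.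
exact: (GmE Ot).
Qed.

Let e_line y : {in `]lw y, hg y[, forall t : R,
  is_derive t 1 (fun t' => e (line l s y t')) (s * p (line l s y t))}.
Proof.
move=> t tI; apply: is_derive_line; apply: de.
by have : sec l s Om y t by rewrite secE.
Qed.

Let defined_line :
  {ae leb n, forall y, {ae mu, forall t, Om (line l s y t) ->
    caputo_defined Om sg l alpha U (line l s y t) /\
    caputo_defined Om sg l alpha V (line l s y t)}}.
Proof.
apply: (@ae_lines _ _ l s s1 (fun x => Om x -> caputo_defined Om sg l alpha U x /\
  caputo_defined Om sg l alpha V x)).
by apply: ae_impl (ae_and cU cV) => x [h1 h2] Ox; split; [exact: h1|exact: h2].
Qed.

Let frac_defined v x : alpha != 2 -> caputo_defined Om sg l alpha v x ->
  mu.-integrable (ray Om sg l x) (fun xi => (frac_integrand l alpha (partial2 l v) x xi)%:E).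
Proof. by rewrite /caputo_defined => /negbTE ->. Qed.

Let g01 : alpha != 2 -> 0 <= alpha - 1 < 1.
Proof.
move=> a2; have /andP[h1 h2] := alpha12; have : alpha < 2 by rewrite lt_neqAle a2.
lra.
Qed.

Let frac_sub (gU gV : 'rV[R]_n.+1 -> R) y t : sec l s Om y t ->
  mu.-integrable (ray Om sg l (line l s y t))
    (fun xi => (frac_integrand l alpha gU (line l s y t) xi)%:E) ->
  mu.-integrable (ray Om sg l (line l s y t))
    (fun xi => (frac_integrand l alpha gV (line l s y t) xi)%:E) ->
  mu.-integrable `]lw y, t[
     (fun t' => ((gU (line l s y t') - gV (line l s y t')) * `|t - t'| `^ (- (alpha - 1)))%:E) /\
  frac_integral Om sg l alpha gU (line l s y t) - frac_integral Om sg l alpha gV (line l s y t) =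
  c * vol (alpha - 1) (lw y) (fun t' => gU (line l s y t') - gV (line l s y t')) t.
Proof.
move=> Ot dU dV.
have iU := frac_integrable_line hOm Ot dU; have iV := frac_integrable_line hOm Ot dV.
have mU : measurable_fun (ray Om sg l (line l s y t))
    (frac_integrand l alpha gU (line l s y t)).
  by apply/measurable_EFinP; case/integrableP: dU.
have mV : measurable_fun (ray Om sg l (line l s y t))
    (frac_integrand l alpha gV (line l s y t)).
  by apply/measurable_EFinP; case/integrableP: dV.
split.
  have := integrable_subR _ iU iV => /(_ (measurable_itv _)).
  by apply: eq_integrable => // t' _; rewrite mulrBl.
rewrite (frac_integral_line hOm Ot mU) (frac_integral_line hOm Ot mV).
rewrite -mulrBr; congr (_ * _); rewrite /vol.
transitivity (\int[mu]_(t' in `]lw y, t[) (gU (line l s y t') * `|t - t'| `^ (- (alpha - 1)) -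
    gV (line l s y t') * `|t - t'| `^ (- (alpha - 1)))); first by rewrite RintegralB.
by apply: eq_Rintegral => t' _; rewrite mulrBl.
Qed.

Let kernel_line y t : alpha != 2 -> sec l s Om y t ->
  caputo_defined Om sg l alpha U (line l s y t) ->
  caputo_defined Om sg l alpha V (line l s y t) ->
  mu.-integrable `]lw y, t[
     (fun t' => (G (line l s y t') * `|t - t'| `^ (- (alpha - 1)))%:E) /\
  caputo Om sg l alpha U (line l s y t) - caputo Om sg l alpha V (line l s y t) =
  c * vol (alpha - 1) (lw y) (fun t' => G (line l s y t')) t.
Proof.
move=> a2 Ot /(frac_defined a2) dU /(frac_defined a2) dV.
have [h1 h2] := frac_sub Ot dU dV; split; first exact: h1.
by rewrite /caputo (negbTE a2) h2.
Qed.

(** Built from [Gm] rather than from [G], and therefore measurable on the whole space, as the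
    passage from the lines to [Om] requires. *)
Let field x := if alpha == 2 then Gm x
  else c * vol_field l s (alpha - 1) Om Gm x.

Let mfield : measurable_fun setT field.
Proof.
rewrite /field; case: (alpha == 2) => //.
by apply: measurable_funM => //; exact: measurable_vol_field.
Qed.

Let vol_Gm y t : sec l s Om y t ->
  mu.-integrable `]lw y, t[
     (fun t' => (G (line l s y t') * `|t - t'| `^ (- (alpha - 1)))%:E) ->
  vol (alpha - 1) (lw y) (fun t' => Gm (line l s y t')) t =
  vol (alpha - 1) (lw y) (fun t' => G (line l s y t')) t.
Proof.
rewrite secE//= in_itv/= => /andP[_ th] iG; rewrite /vol /Rintegral; congr fine.
apply: ae_eq_integral => //.
- apply/measurable_EFinP; apply: measurable_funM; last exact: measurable_kernelr.
  have ml : measurable_fun setT (fun t' : R => line l s y t').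
    by apply: (measurableT_comp (measurable_ins l s)); exact: measurable_pair2.
  exact: (measurable_funS measurableT (@subsetT _ _) (measurableT_comp mGm ml)).
- by case/integrableP: iG.
apply: ae_impl (Gm_line y) => t' h /= ; rewrite in_itv/= => /andP[at_ tt].
by rewrite h// in_itv/= at_ (lt_trans tt).
Qed.

Let field_caputo : {ae leb n.+1, forall x, Om x ->
  field x = caputo Om sg l alpha U x - caputo Om sg l alpha V x}.
Proof.
apply: ae_impl (ae_and cU cV) => x [hU hV] Ox; have dU := hU Ox; have dV := hV Ox.
have [a2|a2] := boolP (alpha == 2).
  rewrite /field a2; move: dU dV; rewrite /caputo_defined /caputo a2 => dU dV.
  apply: (GmE Ox).
  have h1 : is_derive x (basis_vec R l) (partial l U) (partial2 l U x) by apply: DeriveDef.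
  have h2 : is_derive x (basis_vec R l) (partial l V) (partial2 l V x) by apply: DeriveDef.
  exact: is_deriveB.
move: Ox dU dV; rewrite -(lineK l s1 x) => Ox dU dV.
have Ot : sec l s Om (del l x) (s * x 0 l) by [].
have [iG ->] := kernel_line a2 Ot dU dV.
by rewrite /field (negbTE a2) vol_field_line// vol_Gm.
Qed.

Let line_field : {ae leb n, forall y, {ae mu, forall t, Om (line l s y t) ->
  w (line l s y t) = field (line l s y t)}}.
Proof.
have [Le Lw _] := hJ; have Ooo := domain_lty hOm.
have ie := ae_integrable_sec (sq_integrable_integrable mO Ooo Le).
have iw := ae_integrable_sec (sq_integrable_integrable mO Ooo Lw).
apply: ae_impl (ae_and (ae_and ie iw) (ae_and defined_line (J0_ae_lines hOm alpha12 hJ))).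
move=> y [[iey iwy] [dy cl]].
(* A line with an empty section: the claim is vacuous there. *)
have [hab|ab] := leP (hg y) (lw y).
  apply: aeW => t Ot; have : sec l s Om y t by [].
  by rewrite secE//= in_itv/= => /andP[h1 h2]; have := lt_trans h1 h2; rewrite ltNge hab.
have Osec t : Om (line l s y t) -> t \in `]lw y, hg y[.
  by move=> Ot; have : sec l s Om y t by []; rewrite secE.
have secO t : t \in `]lw y, hg y[ -> sec l s Om y t by rewrite secE.
have eF x : frontier Om x -> e x = 0 by move=> /UV h; rewrite /e !fctE h subrr.
have [b0 b1] := boundary_line s1 hOm eF zUV ab.
have [a2|a2] := boolP (alpha == 2).
  have h : {ae mu, forall t, t \in `]lw y, hg y[ -> w (line l s y t) = G (line l s y t)}.
    apply: (identification_core iwy _ (@e_line y) (@increment y)).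
    apply: closure_identity_id => // eps /cl[q [tq q1 q2]]; exists q; split => //.
    by move: q1; rewrite /RL1 a2.
  apply: ae_impl (ae_and h (Gm_line y)) => t [h1 h2] Ot.
  by rewrite /field a2 h2 ?Osec// h1 ?Osec.
have h : {ae mu, forall t, t \in `]lw y, hg y[ -> w (line l s y t) =
    c * vol (alpha - 1) (lw y) (fun t' => G (line l s y t')) t}.
  apply: (identification_vol (g01 a2) (@e_line y) _ b0 b1 _ iey iwy).
  - by move=> t1 t2 h1 h2 h3; have [] := increment h1 h2 h3.
  - apply: ae_impl dy => t dt tI; have Ot := secO _ tI.
    by have [d1 d2] := dt Ot; have [] := kernel_line a2 Ot d1 d2.
  move=> eps /cl[q [tq q1 q2]]; exists q; split => //.
  by move: q1; rewrite /RL1 (negbTE a2).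
apply: ae_impl (ae_and h dy) => t [h1 dt] Ot; have [d1 d2] := dt Ot.
have [iG _] := kernel_line a2 Ot d1 d2.
by rewrite /field (negbTE a2) vol_field_line// vol_Gm// h1 ?Osec.
Qed.

Lemma derivative_eq_caputo_aux : {ae leb n.+1, forall x, Om x ->
  w x = caputo Om sg l alpha U x - caputo Om sg l alpha V x}.
Proof.
have [_ [mw _] _] := hJ.
have h : {ae leb n.+1, forall x, Om x -> w x = field x}.
  (* Both [w] and [field] are measurable on [Om], so the set where they differ is measurable, as
     [lines_ae] demands. *)
  apply: (@lines_ae _ _ l s s1 (fun x => Om x -> w x = field x)); last exact: line_field.
  have mwf : measurable_fun Om (fun x => w x - field x).
    by apply: measurable_funB => //; exact: (measurable_funS measurableT).
  have := mwf mO (~` [set 0]) (measurableC (measurable_set1 0)).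
  congr measurable; apply/seteqP; split => x /=.
    by move=> [Ox h1] /(_ Ox) h2; apply: h1; rewrite h2 subrr.
  move=> h1; have Ox : Om x by apply: contrapT => nO; apply: h1.
  by split => // /eqP; rewrite subr_eq0 => /eqP h2; apply: h1.
by apply: ae_impl (ae_and h field_caputo) => x [h1 h2] Ox; rewrite h1// h2.
Qed.

End identification.

Lemma derivative_eq_caputo {R : realType} (n : nat) (l : 'I_n.+1) (sg : side)
    (Om : set 'rV[R]_n.+1) (alpha : R) (U V w : 'rV[R]_n.+1 -> R) :
  bounded_convex_domain Om -> 1 < alpha <= 2 ->
  twice_diff_along Om l U -> twice_diff_along Om l V ->
  {ae lebesgue_rV R n.+1, forall x, Om x -> caputo_defined Om sg l alpha U x} ->
  {ae lebesgue_rV R n.+1, forall x, Om x -> caputo_defined Om sg l alpha V x} ->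
  (forall x, frontier Om x -> U x = V x) ->
  zero_gradient_on_frontier Om (U - V) ->
  J0_with_derivative Om sg l alpha (U - V) w ->
  {ae lebesgue_rV R n.+1, forall x, Om x ->
    w x = caputo Om sg l alpha U x - caputo Om sg l alpha V x}.
Proof.
move=> hOm a12 tU tV cU cV UV zUV hJ.
have [Gm mGm GmE] := measurable_derivative_of_partial hOm tU tV hJ.
exact: (derivative_eq_caputo_aux hOm a12 tU tV cU cV UV zUV hJ mGm GmE).
Qed.

(** * The scheme *)

Section omega.
Context {R : realType}.

(** The weight of index 1 is [- theta]; from index 2 on, the factor [1 - (theta + 1) / k] is
    nonnegative because [theta + 1 <= 2 <= k]. *)
Lemma omegaS_le0 (theta : R) k : 0 < theta <= 1 -> omega theta k.+1 <= 0.
Proof.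
move=> /andP[t0 t1]; elim: k => [|k IH]; first by rewrite /= divr1; lra.
rewrite -[omega _ _]/((1 - (theta + 1) / k.+2%:R) * omega theta k.+1).
apply: mulr_ge0_le0 => //; rewrite subr_ge0 ler_pdivrMr// mul1r.
have : 2 <= k.+2%:R :> R by rewrite ler_nat.
lra.
Qed.

(** Coefficient form of the derivative of [(1 - z)^theta], which is [- theta (1 - z)^(theta - 1)]:
    the partial sums are the coefficients of the latter power. It transfers the sign of a weight to
    the partial sum before it. *)
Lemma omegaS_sum (theta : R) m :
  m.+1%:R * omega theta m.+1 = - theta * \sum_(0 <= k < m.+1) omega theta k.
Proof.
elim: m => [|m IH]; first by rewrite big_nat1 /=; field.
have E : omega theta m.+2 = (1 - (theta + 1) / m.+2%:R) * omega theta m.+1 by [].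
rewrite E big_nat_recr// [in RHS]mulrDr -IH; clear E IH.
have m0 : m.+2%:R != 0 :> R by rewrite pnatr_eq0.
move: m0; have -> : m.+2%:R = m.+1%:R + 1 :> R by rewrite -natr1.
by set w := omega _ _; set k := m.+1%:R => k0; field.
Qed.

Lemma omega_sum_ge0 (theta : R) m : 0 < theta <= 1 ->
  0 <= \sum_(0 <= k < m) omega theta k.
Proof.
case: m => [|m] t01; first by rewrite big_nil.
have /andP[t0 _] := t01; have := omegaS_le0 m t01; have := omegaS_sum theta m => h1 h2.
have h3 : m.+1%:R * omega theta m.+1 <= 0 by rewrite mulr_ge0_le0.
by move: h3; rewrite h1 mulNr oppr_le0 pmulr_rge0.
Qed.

End omega.

Section inner_sum.
Context d (T : measurableType d) (R : realType) (m : {measure set T -> \bar R}).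
Variable D : set T.
Hypothesis mD : measurable D.

(** Serves with [B = 0] for the fractional derivatives and with the Young bound for the history
    terms; the integrability is proved along with the bound because splitting off a term uses it. *)
Lemma inner_sum_le (I : eqType) (r : seq I) (c : I -> R) (f : I -> T -> R) e (B : R) :
  sq_integrable m D e ->
  (forall i, i \in r -> [/\ 0 <= c i, sq_integrable m D (f i) &
     \int[m]_(x in D) (f i x * e x) <= B]) ->
  sq_integrable m D (fun x => \sum_(i <- r) c i * f i x) /\
  \int[m]_(x in D) ((\sum_(i <- r) c i * f i x) * e x) <= (\sum_(i <- r) c i) * B.
Proof.
move=> he; elim: r => [|i r IH] h.
  split.
    split; first by under eq_fun do rewrite big_nil; exact: measurable_cst.
    by under eq_fun do rewrite big_nil expr0n; exact: integrable0.
  rewrite big_nil mul0r.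
  by under eq_Rintegral do rewrite big_nil mul0r; rewrite Rintegral_cst// mul0r.
have [ci0 fi fB] := h i (mem_head _ _).
have [|hr hB] := IH; first by move=> j jr; apply: h; rewrite inE jr orbT.
under eq_fun do rewrite big_cons.
have hci := sq_integrableZ mD (c i) fi; split; first exact: sq_integrableD.
have E : \int[m]_(x in D) ((\sum_(j <- i :: r) c j * f j x) * e x) =
    c i * \int[m]_(x in D) (f i x * e x) +
    \int[m]_(x in D) ((\sum_(j <- r) c j * f j x) * e x).
  rewrite -RintegralZl//; last exact: sq_integrableM.
  rewrite -RintegralD//; first last.
  - exact: sq_integrableM.
  - by apply: integrable_scale => //; exact: sq_integrableM.
  by apply: eq_Rintegral => x _; rewrite big_cons mulrDl mulrA.
by rewrite E big_cons mulrDl lerD// ler_wpM2l.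
Qed.

Lemma ae_forall_ord k (P : 'I_k -> T -> Prop) :
  (forall i, {ae m, forall x, P i x}) -> {ae m, forall x, forall i, P i x}.
Proof.
move=> h; have : {ae m, forall x, forall j : nat, forall i : 'I_k, i = j :> nat -> P i x}.
  apply/ae_foralln => j; have [jk|jk] := ltnP j k.
    by apply: ae_impl (h (Ordinal jk)) => x Px i ij; rewrite (_ : i = Ordinal jk)//; exact: val_inj.
  by apply: aeW => x i ij; move: jk; rewrite leqNgt -ij ltn_ord.
by apply: ae_impl => x hx i; exact: hx.
Qed.

End inner_sum.

Section scheme.
Context {R : realType} (d : nat).
Variables (s : nat) (a theta : nat -> R) (tau : R).

(** All time orders are gathered into one sequence of weights, which inherits the signs common to
    the [omega (theta r)]; the scheme then reads as one with a single time derivative. *)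
Definition weight k := \sum_(1 <= r < s.+1) a r / tau `^ theta r * omega (theta r) k.

Lemma scheme_lhsE (Om : set 'rV[R]_d) alpha epsp epsm v x :
  scheme_lhs Om s a theta alpha epsp epsm tau v x =
  weight 0%N * v x - \sum_(l < d) epsp l * caputo Om Plus l (alpha l) v x
  - \sum_(l < d) epsm l * caputo Om Minus l (alpha l) v x.
Proof.
by rewrite /scheme_lhs; do 3 congr (_ + _) || congr (_ * _); apply: eq_bigr => r _; rewrite mulrAC.
Qed.

Lemma scheme_rhsE f (U : nat -> 'rV[R]_d -> R) n x :
  scheme_rhs s a theta tau f U n x =
  f x (n%:R * tau) - \sum_(1 <= k < n) weight k * U (n - k)%N x
  + (\sum_(0 <= k < n) weight k) * U 0%N x.
Proof.
have ex j (u : nat -> R) : \sum_(1 <= r < s.+1) a r / tau `^ theta r *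
    \sum_(j <= k < n) omega (theta r) k * u k = \sum_(j <= k < n) weight k * u k.
  under eq_bigr do rewrite mulr_sumr.
  rewrite exchange_big_nat/=; apply: eq_bigr => k _.
  by rewrite /weight mulr_suml; apply: eq_bigr => r _; rewrite mulrA.
by rewrite /scheme_rhs (ex 1%N (fun k => U (n - k)%N x)) (ex 0%N (fun=> U 0%N x)) mulr_suml.
Qed.

Hypothesis tau0 : 0 < tau.
Hypothesis htheta : forall r, (1 <= r <= s)%N -> 0 < theta r <= 1.
Hypothesis a0 : forall r, (1 <= r <= s)%N -> 0 <= a r.

Lemma weight_le0 k : weight k.+1 <= 0.
Proof.
rewrite /weight big_nat; apply: sumr_le0 => r /andP[r1 rs].
have rP : (1 <= r <= s)%N by rewrite r1.
rewrite mulr_ge0_le0//; last exact: omegaS_le0 (htheta rP).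
by rewrite divr_ge0 ?a0 ?powR_ge0.
Qed.

Lemma weight_sum_ge0 n : 0 <= \sum_(0 <= k < n) weight k.
Proof.
rewrite exchange_big_nat/= big_nat; apply: sumr_ge0 => r /andP[r1 rs].
have rP : (1 <= r <= s)%N by rewrite r1.
rewrite -mulr_sumr mulr_ge0//; last exact: omega_sum_ge0 (htheta rP).
by rewrite divr_ge0 ?a0 ?powR_ge0.
Qed.

Lemma weight0_gt0 : (1 <= s)%N -> 0 < a 1%N -> 0 < weight 0%N.
Proof.
move=> s1 a1; rewrite /weight big_ltn// ltr_pwDl//.
  by rewrite mulr1 divr_gt0// powR_gt0.
rewrite big_nat; apply: sumr_ge0 => r /andP[r1 rs].
have rP : (1 <= r <= s)%N by rewrite (ltnW r1).
by rewrite mulr1 divr_ge0 ?a0 ?powR_ge0.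
Qed.

End scheme.

(** * The stability estimate *)

Section stability.
Context {R : realType} (n0 : nat).
Notation d := n0.+1.
Variable Om : set 'rV[R]_d.
Hypothesis hOm : bounded_convex_domain Om.
Notation leb := (lebesgue_rV R d).
Variables (s : nat) (theta a : nat -> R).
Hypothesis s1 : (1 <= s)%N.
Hypothesis htheta : forall r, (1 <= r <= s)%N -> 0 < theta r <= 1.
Hypothesis a1 : 0 < a 1%N.
Hypothesis a0 : forall r, (1 <= r <= s)%N -> 0 <= a r.
Variables (alpha epsp epsm : 'I_d -> R).
Hypothesis halpha : forall l, 1 < alpha l <= 2.
Hypothesis hepsp : forall l, 0 <= epsp l.
Hypothesis hepsm : forall l, 0 <= epsm l.
Variables (tau : R) (N : nat) (f g : 'rV[R]_d -> R -> R) (U V : nat -> 'rV[R]_d -> R).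
Hypothesis tau0 : 0 < tau.
Hypothesis hU : scheme_solution Om s a theta alpha epsp epsm tau N f g U.
Hypothesis hV : scheme_solution Om s a theta alpha epsp epsm tau N f g V.
Hypothesis hgrad : forall n, (1 <= n <= N)%N -> zero_gradient_on_frontier Om (U n - V n).
Hypothesis hJ : forall n, (1 <= n <= N)%N -> forall l sg, J0 Om sg l (alpha l) (U n - V n).

Let mO : measurable Om := domain_measurable hOm.
Let e n : 'rV[R]_d -> R := U n - V n.
Notation q := (weight s a theta tau).

Let L2e n : (n <= N)%N -> L2 Om (e n).
Proof.
case: n => [|n] nN; last by have [w []] := @hJ n.+1 nN ord0 Plus.
by have [L2U _] := hU; have [L2V _] := hV; exact: (sq_integrableB mO L2U L2V).
Qed.

(** Difference of the two schemes: [f] cancels, and the differences of Caputo derivatives are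
    exchanged for the limits [w], whose pairing with [e n] has a known sign. *)
Let weak n : (1 <= n <= N)%N -> exists2 w : 'I_d * side -> 'rV[R]_d -> R,
  (forall i, sq_integrable leb Om (w i) /\ \int[leb]_(x in Om) (w i x * e n x) <= 0) &
  {ae leb, forall x, Om x -> q 0%N * e n x =
    \sum_(l < d) epsp l * w (l, Plus) x + \sum_(l < d) epsm l * w (l, Minus) x +
    (\sum_(1 <= k < n) - q k * e (n - k)%N x + (\sum_(0 <= k < n) q k) * e 0%N x)}.
Proof.
move=> nN; have [w hw] := choice (fun i : 'I_d * side => hJ nN i.1 i.2).
exists w.
  move=> i; have [_ Lw _] := hw i; split => //.
  exact: inner_derivative_le0 (hw i).
have [_ /(_ _ nN) [tU cU sU gU]] := hU; have [_ /(_ _ nN) [tV cV sV gV]] := hV.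
have wcap sg : {ae leb, forall x, forall l, Om x ->
    w (l, sg) x = caputo Om sg l (alpha l) (U n) x - caputo Om sg l (alpha l) (V n) x}.
  apply: ae_forall_ord => l.
  apply: (derivative_eq_caputo hOm (halpha l) (tU l) (tV l) _ _ _ (hgrad nN) (hw (l, sg))).
  - by apply: ae_impl cU => x h Ox; exact: h.
  - by apply: ae_impl cV => x h Ox; exact: h.
  - by move=> x fx; rewrite gU// gV.
apply: ae_impl (ae_and (ae_and sU sV) (ae_and (wcap Plus) (wcap Minus))).
move=> x [[eU eV] [wp wm]] Ox; have := eU Ox; have := eV Ox.
rewrite !scheme_lhsE !scheme_rhsE => hv hu.
have Ep : \sum_(l < d) epsp l * w (l, Plus) x =
    \sum_(l < d) epsp l * caputo Om Plus l (alpha l) (U n) x -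
    \sum_(l < d) epsp l * caputo Om Plus l (alpha l) (V n) x.
  by rewrite -sumrB; apply: eq_bigr => l _; rewrite wp// mulrBr.
have Em : \sum_(l < d) epsm l * w (l, Minus) x =
    \sum_(l < d) epsm l * caputo Om Minus l (alpha l) (U n) x -
    \sum_(l < d) epsm l * caputo Om Minus l (alpha l) (V n) x.
  by rewrite -sumrB; apply: eq_bigr => l _; rewrite wm// mulrBr.
have Ek : \sum_(1 <= k < n) - q k * e (n - k)%N x =
    \sum_(1 <= k < n) q k * V (n - k)%N x - \sum_(1 <= k < n) q k * U (n - k)%N x.
  by rewrite -sumrB; apply: eq_bigr => k _; rewrite /e !fctE; ring.
(* The sums enter as opaque variables, which leaves a purely algebraic subtraction. *)
have alg (k u v A1 A2 B1 B2 C1 C2 D F u0 v0 : R) :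
    k * u - A1 - B1 = F - C2 + D * u0 -> k * v - A2 - B2 = F - C1 + D * v0 ->
    k * (u - v) = A1 - A2 + (B1 - B2) + (C1 - C2 + D * (u0 - v0)).
  move=> h1 h2; rewrite mulrBr.
  have -> : k * u = F - C2 + D * u0 + A1 + B1 by rewrite -h1; ring.
  have -> : k * v = F - C1 + D * v0 + A2 + B2 by rewrite -h2; ring.
  ring.
rewrite Ep Em Ek; exact: (alg _ _ _ _ _ _ _ _ _ _ _ _ _ hu hv).
Qed.

Lemma stability n : (n <= N)%N -> inner Om (e n) (e n) <= inner Om (e 0%N) (e 0%N).
Proof.
elim/ltn_ind: n => n IH nN; have [->//|n0'] := posnP n.
have n1N : (1 <= n <= N)%N by rewrite n0'.
have [w hw heq] := weak n1N; have Ln := L2e nN.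
set E0 := inner Om (e 0%N) (e 0%N); set E := inner Om (e n) (e n).
(* Common bound of the pairings [(e j, e n)] for [j < n], from Young's inequality with parameter 1
   and the induction hypothesis. *)
pose B := (E0 + E) / 2.
have young j : (j < n)%N -> \int[leb]_(x in Om) (e j x * e n x) <= B.
  move=> jn; have jN : (j <= N)%N := leq_trans (ltnW jn) nN.
  have := Rintegral_young mO ltr01 (L2e jN) Ln.
  rewrite invr1 !mul1r ler_norml => /andP[_ h]; apply: (le_trans h).
  have := IH j jn jN; rewrite /B /E0 /E /inner; lra.
have hp sg (eps : 'I_d -> R) : (forall l, 0 <= eps l) ->
    sq_integrable leb Om (fun x => \sum_(l < d) eps l * w (l, sg) x) /\
    \int[leb]_(x in Om) ((\sum_(l < d) eps l * w (l, sg) x) * e n x) <= 0.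
  move=> eps0.
  have := @inner_sum_le _ _ _ leb Om mO _ (index_enum 'I_d) eps (fun l => w (l, sg)) (e n) 0 Ln.
  rewrite mulr0; apply=> l _; have [h1 h2] := hw (l, sg).
  by split; [exact: eps0|exact: h1|exact: h2].
have [Lp ep] := hp Plus epsp hepsp; have [Lm em] := hp Minus epsm hepsm.
have [|Lk ek] := @inner_sum_le _ _ _ leb Om mO _ (index_iota 1 n) (fun k => - q k)
    (fun k => e (n - k)%N) (e n) B Ln.
  move=> k; rewrite mem_index_iota => /andP[k1 kn]; split.
  - by rewrite oppr_ge0 -(prednK k1); exact: weight_le0.
  - by apply: L2e; rewrite (leq_trans (leq_subr _ _)).
  - by apply: young; rewrite ltn_subrL k1 n0'.
have Q0 := weight_sum_ge0 tau htheta a0 n.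
set Q := \sum_(0 <= k < n) q k in Q0 heq.
have L0 := L2e (leq0n N); have LQ := sq_integrableZ mO Q L0.
pose Fp x := \sum_(l < d) epsp l * w (l, Plus) x.
pose Fm x := \sum_(l < d) epsm l * w (l, Minus) x.
pose Fk x := \sum_(1 <= k < n) - q k * e (n - k)%N x.
have total : q 0%N * E = \int[leb]_(x in Om) (Fp x * e n x) +
    \int[leb]_(x in Om) (Fm x * e n x) + (\int[leb]_(x in Om) (Fk x * e n x) +
    Q * \int[leb]_(x in Om) (e 0%N x * e n x)).
  have ip := sq_integrableM mO Lp Ln; have im := sq_integrableM mO Lm Ln.
  have ik := sq_integrableM mO Lk Ln; have i0 := sq_integrableM mO L0 Ln.
  have iQ := integrable_scale Q mO i0.
  have ien := sq_integrableM mO Ln Ln.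
  rewrite -RintegralZl// -RintegralZl//.
  rewrite -(RintegralD mO ip im) -(RintegralD mO ik iQ).
  rewrite -(RintegralD mO (integrable_addR mO ip im) (integrable_addR mO ik iQ)).
  rewrite /Rintegral; congr fine; apply: ae_eq_integral => //.
  - by have := integrable_scale (q 0%N) mO ien; case/integrableP.
  - by have := integrable_addR mO (integrable_addR mO ip im) (integrable_addR mO ik iQ);
      case/integrableP.
  apply: ae_impl heq => x h Ox; congr EFin; rewrite mulrA h// /Fp /Fm /Fk; ring.
(* The coefficients of the history terms and of [e 0] are nonnegative and add up to [q 0], so their
   common bound [B] is weighted by exactly [q 0]. *)
have split_q : q 0%N = \sum_(1 <= k < n) - q k + Q.
  by rewrite /Q (big_ltn n0') sumrN; ring.
have q0 := weight0_gt0 theta tau0 a0 s1 a1.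
have yQ := ler_wpM2l Q0 (young 0%N n0').
have key : q 0%N * E <= q 0%N * B.
  rewrite total split_q mulrDl; move: ep em ek yQ; rewrite /Fp /Fm /Fk.
  set i1 := \int[leb]_(x in Om) _; set i2 := \int[leb]_(x in Om) _.
  set i3 := \int[leb]_(x in Om) _; set i4 := Q * \int[leb]_(x in Om) _.
  by move=> *; lra.
(* After cancelling [q 0 > 0], the inequality [E <= (E0 + E) / 2] is [E <= E0]. *)
by move: key; rewrite ler_pM2l// /B; lra.
Qed.

End stability.

Unset Implicit Arguments.
Set Strict Implicit.
Set Printing Implicit Defensive.

Theorem theorem3 (R : realType) (d : nat) (hd : d = 2%N \/ d = 3%N)
    (Om : set 'rV[R]_d) (hOm : bounded_convex_domain Om)
    (s : nat) (hs : (1 <= s)%N) (theta a : nat -> R)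
    (htheta : forall r, (1 <= r <= s)%N -> 0 < theta r /\ theta r <= 1)
    (ha1 : 0 < a 1%N)
    (ha : forall r, (2 <= r <= s)%N -> 0 <= a r)
    (alpha epsp epsm : 'I_d -> R)
    (halpha : forall l, 1 < alpha l /\ alpha l <= 2)
    (hepsp : forall l, 0 <= epsp l)
    (hepsm : forall l, 0 <= epsm l)
    (T : R) (hT : 0 < T) (N : nat) (hN : (0 < N)%N)
    (f g : 'rV[R]_d -> R -> R)
    (U V : nat -> 'rV[R]_d -> R)
    (hU : scheme_solution Om s a theta alpha epsp epsm (T / N%:R) N f g U)
    (hV : scheme_solution Om s a theta alpha epsp epsm (T / N%:R) N f g V)
    (hgrad : forall n, (1 <= n <= N)%N ->
      zero_gradient_on_frontier Om (U n - V n))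
    (hJ : forall n, (1 <= n <= N)%N -> forall l sg,
      J0 Om sg l (alpha l) (U n - V n)) :
  forall n, (1 <= n <= N)%N ->
    L2norm Om (U n - V n) <= L2norm Om (U 0%N - V 0%N).
Proof.
move=> n /andP[_ nN].
(* Dimension 0 is excluded by [hd], which exposes [d] as a successor, the form used by the charts
   along coordinate lines. *)
case: d hd Om hOm alpha epsp epsm halpha hepsp hepsm f g U V hU hV hgrad hJ => [[]//|d] _.
move=> Om hOm alpha epsp epsm halpha hepsp hepsm f g U V hU hV hgrad hJ.
apply: ler_wsqrtr; apply: (stability hOm hs _ ha1 _ _ hepsp hepsm _ hU hV hgrad hJ nN).
- by move=> r /htheta [-> ->].
(* Nonnegativity of [a 1] comes from [ha1], that of the later coefficients from [ha]. *)
- by move=> [//|[|r]] rs; [exact: ltW|exact: ha].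
- by move=> l; apply/andP; exact: halpha.
- by rewrite divr_gt0// ltr0n.
Qed.
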